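(* The variance of the multiplicity of the eigenvalue $0$ of the random binary increasing tree $\mathcal{B}_n$ with $n$ vertices satisfies, as $n\to\infty$, \[\mathbb{V}(N_0(\mathcal{B}_n)) = K_2 n + \mathcal{O}(1),\] where $K_2 = 4C_1-2\sqrt{5}\,C_1-C_1^2+C_2 \approx 0.057162$, with the constants $C_1$ and $C_2$ as defined in the context.
   Context: A binary increasing tree with $n$ vertices is a rooted tree in which every vertex has at most one left child and at most one right child, with vertex labels $1,\dots,n$, each used once, increasing along every path starting at the root. There are $n!$ of them, and the random binary increasing tree $\mathcal{B}_n$ is uniformly distributed among them. $N_0(T)$ is the multiplicity of $0$ as an eigenvalue of the adjacency matrix of the underlying undirected graph of $T$. $\mathbb{V}$ denotes variance. Let \[g(v)=\frac{(8+4\sqrt{5})v^{2\sqrt{5}}+(84+36\sqrt{5})v^{\sqrt{5}}-(22+10\sqrt{5})}{(7+3\sqrt{5}-2v^{\sqrt{5}})^2},\qquad C_1=\int_0^1 g(v)\,dv.\] For $0\le x<1$ define \[F_-(x) = \frac{\sqrt{5}-1}{2(1-x)} - \frac{2\sqrt{5}}{(1-x)\big(2-(7+3\sqrt{5})(1-x)^{-\sqrt{5}}\big)} - 1,\] \[G(x)=\frac{1}{(1-x)^2}\int_0^x g(1-u)\,du,\] \[G_-(x) = \frac{(1-x)^{\sqrt{5}-1}}{\big(7+3\sqrt{5}-2(1-x)^{\sqrt{5}}\big)^2} \int_0^x \frac{\big(7+3\sqrt{5}-2(1-u)^{\sqrt{5}}\big)^2}{(1-u)^{\sqrt{5}-1}}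 \Big(\frac{2G(u)}{1-u} -F_-'(u)\Big)\,du.\] Finally, let $C_2$ be the (convergent) integral \[C_2 = \int_0^1 \Big( 1-4(1-u)G(u) + 2(1-u)^2G(u)^2 + 8(1-u)^2(1 + F_-(u)) G_-(u) - \frac{2C_1^2}{(1-u)^2} \Big) \,du.\] *)

(* Defs.v *)
From HB Require Import structures.
From mathcomp Require Import all_boot all_order all_algebra.
From mathcomp Require Import finmap.
From mathcomp Require Import all_classical all_reals all_analysis.

Set Implicit Arguments.
Unset Strict Implicit.
Unset Printing Implicit Defensive.

Import Order.TTheory GRing.Theory Num.Theory.
Import numFieldNormedType.Exports.

Local Open Scope classical_set_scope.
Local Open Scope ring_scope.

(* [Node l x r] has root labelled [x], left subtree [l] and right subtree [r];
   an [EmptyTree] subtree means that the corresponding child is absent. *)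
Inductive bintree : Type :=
  | EmptyTree
  | Node of bintree & nat & bintree.

HB.instance Definition _ := gen_eqMixin bintree.
HB.instance Definition _ := gen_choiceMixin bintree.

Fixpoint vertices (T : bintree) : seq nat :=
  if T is Node l x r then x :: vertices l ++ vertices r else [::].

Definition root_vertex (T : bintree) : seq nat :=
  if T is Node _ x _ then [:: x] else [::].

(* Edges are oriented from parent to child. *)
Fixpoint edges (T : bintree) : seq (nat * nat) :=
  if T is Node l x r then
    [seq (x, y) | y <- root_vertex l ++ root_vertex r] ++ edges l ++ edges r
  else [::].

Definition tree_adjacent (T : bintree) (x y : nat) : bool :=
  ((x, y) \in edges T) || ((y, x) \in edges T).

(* Labels increase along every path from the root iff they increase along
   every parent-to-child edge. *)
Definition increasing_trees (n : nat) : set bintree :=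
  [set T | perm_eq (vertices T) (iota 1 n) /\
           forall x y : nat, (x, y) \in edges T -> (x < y)%N].

(* Without finiteness, [\sum_(T \in increasing_trees n) _] and
   [fset_set (increasing_trees n)] could take their default values. *)
Lemma finite_increasing_trees (n : nat) : finite_set (increasing_trees n).
Proof.
pose S m := [set T | (size (vertices T) <= m)%N /\
                     forall x, x \in vertices T -> (x <= n)%N].
have finS m : finite_set (S m).
  elim: m => [|m IHm].
    apply: (@sub_finite_set _ _ [set EmptyTree]); last exact: finite_set1.
    by move=> [|l x r] [].
  pose f (p : bintree * nat * bintree) := Node p.1.1 p.1.2 p.2.
  apply: (@sub_finite_set _ _
    ([set EmptyTree] `|` f @` (S m `*` `I_n.+1 `*` S m))).
    move=> [|l x r] [szT leT]; first by left.
    right; exists (l, x, r) => //.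
    move: szT; rewrite /= size_cat ltnS => szT.
    do !split => /=.
    - exact: leq_trans (leq_addr _ _) szT.
    - by move=> y yl; apply: leT; rewrite /= inE mem_cat yl orbT.
    - by rewrite ltnS; apply: leT; rewrite /= mem_head.
    - exact: leq_trans (leq_addl _ _) szT.
    - by move=> y yr; apply: leT; rewrite /= inE mem_cat yr !orbT.
  rewrite finite_setU; split; first exact: finite_set1.
  apply: finite_image; apply: finite_setX => //.
  by apply: finite_setX => //; exact: finite_II.
apply: sub_finite_set (finS n) => T [permT _]; split.
  by rewrite (perm_size permT) size_iota.
by move=> x; rewrite (perm_mem permT) mem_iota add1n ltnS => /andP[].
Qed.

Section RandomTree.
Variable R : realType.

Definition adjacency_mx (T : bintree) : 'M[R]_(size (vertices T)) :=
  \matrix_(i, j) (tree_adjacent T (nth 0%N (vertices T) i)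
                                  (nth 0%N (vertices T) j))%:R.

Definition N0 (T : bintree) : nat := mup 0 (char_poly (adjacency_mx T)).

(* Expectation and variance under the uniform distribution on the binary
   increasing trees with n vertices. *)
Definition tree_expectation (n : nat) (X : bintree -> R) : R :=
  (\sum_(T \in increasing_trees n) X T)
  / (#|` fset_set (increasing_trees n)|)%fset%:R.

Definition tree_variance (n : nat) (X : bintree -> R) : R :=
  tree_expectation n (fun T => (X T - tree_expectation n X) ^+ 2).

End RandomTree.

Section Constants.
Variable R : realType.

Local Notation s5 := (Num.sqrt 5 : R).
Local Notation mu := (@lebesgue_measure R).

Definition g (v : R) : R :=
  ((8 + 4 * s5) * v `^ (2 * s5) + (84 + 36 * s5) * v `^ s5 - (22 + 10 * s5))
  / (7 + 3 * s5 - 2 * v `^ s5) ^+ 2.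

Definition C1 : R := \int[mu]_(v in `[0, 1]) g v.

Definition F_minus (x : R) : R :=
  (s5 - 1) / (2 * (1 - x))
  - 2 * s5 / ((1 - x) * (2 - (7 + 3 * s5) * (1 - x) `^ (- s5)))
  - 1.

Definition G (x : R) : R :=
  1 / (1 - x) ^+ 2 * \int[mu]_(u in `[0, x]) g (1 - u).

Definition G_minus (x : R) : R :=
  (1 - x) `^ (s5 - 1) / (7 + 3 * s5 - 2 * (1 - x) `^ s5) ^+ 2
  * \int[mu]_(u in `[0, x])
      ((7 + 3 * s5 - 2 * (1 - u) `^ s5) ^+ 2 / (1 - u) `^ (s5 - 1)
       * (2 * G u / (1 - u) - F_minus^`()%classic u)).

(* The integrand is bounded on [0, 1[ (its 1 / (1 - u) singularities cancel),
   so the improper integral up to 1 is a Lebesgue integral. *)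
Definition C2 : R :=
  \int[mu]_(u in `[0, 1[)
    (1 - 4 * (1 - u) * G u + 2 * (1 - u) ^+ 2 * G u ^+ 2
     + 8 * (1 - u) ^+ 2 * (1 + F_minus u) * G_minus u
     - 2 * C1 ^+ 2 / (1 - u) ^+ 2).

Definition K2 : R := 4 * C1 - 2 * s5 * C1 - C1 ^+ 2 + C2.

End Constants.

(* Main.v *)
(* Deleting the root expresses the characteristic polynomial of a tree through
   those of its two subtrees, and keeping track of signs and of powers of X
   shows that N0 follows a greedy leaf-to-root matching: a root with no
   unmatched child stays unmatched and adds 1 to the sum of the nullities of the
   two subtrees, any other root subtracts 1. In a random tree the sizes of the
   subtrees are uniform and, given the sizes, the subtrees are independent and
   uniform. Hence Y = N0 - lam (n + 1) is additive up to a toll of 1 or -1, and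
   for a suitable lam its expectation is bounded. The expectation of Y times the
   indicator that the root is matched is bounded too, because the probability of
   this event is eventually close to (sqrt 5 - 1) / 2. The recursion for E[Y^2]
   then gives E[Y^2] = K n + O(1). The generating functions of the moments
   satisfy a Riccati equation, whose solution is 1 + F_minus, and linear
   equations, which identify G and G_minus; integrating the one for E[Y^2] up to
   1 gives K = K2. For the numerical value, an integrating factor removes the
   inner integral, and the remaining functions of w = (1 - x)^(sqrt 5) are
   replaced by Taylor polynomials whose residuals are bounded by exact
   arithmetic in Z[sqrt 5]. *)
From Stdlib Require Import ZArith.
Require Import Defs.
From mathcomp Require Import all_boot all_order all_algebra.
From mathcomp Require Import finmap.
From mathcomp Require Import all_classical all_reals all_analysis.
From mathcomp Require Import ring lra zify ssrZ.
Set Implicit Arguments.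
Unset Strict Implicit.
Unset Printing Implicit Defensive.
Import Order.TTheory GRing.Theory Num.Theory.
Import numFieldNormedType.Exports.
Local Open Scope classical_set_scope.
Local Open Scope ring_scope.
Local Delimit Scope Z_scope with coqZ.

(** * Nullity of a tree *)

(** The generating functions are used only on the real interval [0, 1[, without singularity
    analysis. The O(1) errors come from elementary recurrences, in which [lam] and [K] exist merely
    as suprema. The resulting bounds of order 1 / (1 - x) then act as boundary conditions at 1: a
    first-order linear equation with its value at 0 and its behaviour at 1 both prescribed is
    overdetermined, and this forces lam = C1 and K = K2. The delicate moment is the mixed one, of Y
    and the matched indicator, since plain absolute values do not close its recursion. The limit
    (sqrt 5 - 1) / 2 of the matching probability has to be split off. What remains is a linear
    recurrence with negative feedback, which amplifies a bounded source by at most 2 - 1 / sqrt 5 <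
    1.56, and the induction closes once the probability is close enough to its limit. The same
    amplification acts on the deviation of the probability itself, but quadratically, so that the
    deviation shrinks as soon as it is below 1 / 1.56. *)

Fixpoint unmatched (T : bintree) : bool :=
  if T is Node l _ r then ~~ unmatched l && ~~ unmatched r else false.

(** A Schur complement without inverses: multiplication on the right by [Z], of determinant
    [\det N], clears the lower left block, and the factor [\det N] is then cancelled. *)
Lemma det_bordered (K : idomainType) n (x : K) (u : 'rV[K]_n) (v : 'cV[K]_n)
    (N : 'M[K]_n) : \det N != 0 ->
  \det (block_mx x%:M u v N) = x * \det N - (u *m \adj N *m v) 0 0.
Proof.
move=> N0.
pose Z := block_mx (\det N)%:M 0 (- (\adj N *m v)) 1%:M : 'M[K]_(1 + n).
have detZ : \det Z = \det N by rewrite det_lblock det1 mulr1 det_scalar1.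
apply: (mulIf N0); rewrite -{1}detZ -det_mulmx.
rewrite mulmx_block !mulmxN !mulmx0 !mulmx1 !add0r (mulmxA N) mul_mx_adj.
rewrite (mul_scalar_mx (\det N) v) (mul_mx_scalar (\det N) v) subrr det_ublock; congr (_ * _).
rewrite mulmxA.
by rewrite -scalar_mxM det_mx11 !mxE mulr1n.
Qed.

(** The candidate [A] satisfies [N *m A = (\det N)%:M]; multiplying by [\adj N] on the left and
    cancelling [\det N] entrywise identifies it. *)
Lemma adj_block_diag (K : idomainType) a b (L : 'M[K]_a) (M : 'M[K]_b) :
  \det L != 0 -> \det M != 0 ->
  \adj (block_mx L 0 0 M) =
  block_mx (\det M *: \adj L) 0 0 (\det L *: \adj M).
Proof.
move=> L0 M0; set N := block_mx L 0 0 M; set A := block_mx _ _ _ _.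
have dN : \det N = \det L * \det M by rewrite det_ublock.
have NA : N *m A = (\det N)%:M.
  rewrite mulmx_block !mulmx0 !mul0mx !addr0 !add0r -!scalemxAr. rewrite !mul_mx_adj.
  by rewrite !scale_scalar_mx dN [in RHS]scalar_mx_block mulrC.
have := mul_adj_mx N; move/(congr1 (mulmx^~ A)); rewrite -mulmxA NA.
rewrite mul_mx_scalar mul_scalar_mx => /matrixP E; apply/matrixP => i j.
have := E i j; rewrite !mxE; apply: mulfI.
by rewrite dN mulf_neq0.
Qed.

Lemma edges_vertices T x y : (x, y) \in edges T ->
  (x \in vertices T) && (y \in vertices T).
Proof.
have rootP S z : z \in root_vertex S -> z \in vertices S.
  by case: S => [|l a r] //=; rewrite inE => /eqP ->; rewrite mem_head.
elim: T => [|l IHl a r IHr] //=; rewrite !mem_cat !inE !mem_cat.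
case/or3P => [/mapP[z zr [-> ->]]|/IHl/andP[-> ->]|/IHr/andP[-> ->]];
  rewrite ?orbT //.
rewrite eqxx /=; move: zr; rewrite mem_cat.
by case/orP => /rootP ->; rewrite ?orbT.
Qed.

Lemma tree_adjacent_sym T x y : tree_adjacent T x y = tree_adjacent T y x.
Proof. by rewrite /tree_adjacent orbC. Qed.

Lemma tree_adjacent_root l a r y : uniq (vertices (Node l a r)) ->
  tree_adjacent (Node l a r) a y = (y \in root_vertex l ++ root_vertex r).
Proof.
rewrite /= mem_cat negb_or => /andP[/andP[al ar] _].
have no S z : a \notin vertices S -> ((a, z) \in edges S = false) * ((z, a) \in edges S =
  false).
  by move=> aS; split; apply: contraNF aS => /edges_vertices/andP[].
rewrite /tree_adjacent /= !mem_cat !no // !orbF.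
rewrite (mem_map (f := pair a)) ?mem_cat => [|? ? []//].
rewrite orbC; case: mapP => // -[z + [_ az]]; rewrite -az mem_cat.
have rootP S w : w \in root_vertex S -> w \in vertices S.
  by case: S => [|? ? ?] //=; rewrite inE => /eqP ->; rewrite mem_head.
by case/orP => /rootP; rewrite ?(negPf al) ?(negPf ar).
Qed.

Lemma tree_adjacent_child l a r y z : y != a -> z != a ->
  tree_adjacent (Node l a r) y z = tree_adjacent l y z || tree_adjacent r y z.
Proof.
move=> ya za; rewrite /tree_adjacent /= !mem_cat.
have E u v : u != a -> (u, v) \in [seq (a, w) | w <- root_vertex l ++ root_vertex r] = false.
  by move=> ua; apply/mapP => -[w _ [ua' _]]; rewrite ua' eqxx in ua.
by rewrite !E //=; do 4 case: (_ \in _).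
Qed.

Lemma tree_adjacent_out T y z : (y \notin vertices T) || (z \notin vertices T) ->
  tree_adjacent T y z = false.
Proof.
apply: contraTF => /orP[] /edges_vertices/andP[-> ->] //.
Qed.

Section CharPoly.
Variable R : realType.

(** The dimension is a separate parameter because [size (vertices (Node l a r))] is only
    propositionally equal to [1 + (nl + nr)], the form that block matrices require. *)
Definition cmx (e : rel nat) (vs : seq nat) n : 'M[{poly R}]_n :=
  \matrix_(i, j) ('X *+ (i == j :> nat) - (e (nth 0%N vs i) (nth 0%N vs j))%:R).

Lemma char_poly_cmx T :
  char_poly (adjacency_mx R T) =
  \det (cmx (tree_adjacent T) (vertices T) (size (vertices T))).
Proof.
by congr (\det _); apply/matrixP => i j; rewrite !mxE -val_eqE /= polyC_natr.
Qed.

(** [vertices] is a preorder listing, so the root of a nonempty subtree has index 0 in its block,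
    and the row joining [a] to a block is -1 there and 0 elsewhere. As labels are distinct, no
    adjacency crosses the two blocks. *)
Lemma cmx_node l a r : uniq (vertices (Node l a r)) ->
  let nl := size (vertices l) in let nr := size (vertices r) in
  let u := row_mx (\row_(j < nl) - (j == 0%N :> nat)%:R)
                  (\row_(j < nr) - (j == 0%N :> nat)%:R) : 'rV[{poly R}]_(nl + nr) in
  cmx (tree_adjacent (Node l a r)) (vertices (Node l a r)) (1 + (nl + nr)) =
  block_mx 'X%:M u u^T
    (block_mx (cmx (tree_adjacent l) (vertices l) nl) 0 0
              (cmx (tree_adjacent r) (vertices r) nr)).
Proof.
move=> uT nl nr u.
have := uT; rewrite /= mem_cat negb_or cat_uniq.
move=> /andP[/andP[al ar] /and3P[ul lr ur]].
have memv S (i : 'I_(size (vertices S))) : nth 0%N (vertices S) i \in vertices S.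
  by rewrite mem_nth.
have ne S (i : 'I_(size (vertices S))) : a \notin vertices S -> nth 0%N (vertices S) i != a.
  by move=> aS; apply: contraNneq aS => <-.
have lrF (i : 'I_nl) : nth 0%N (vertices l) i \notin vertices r.
  by apply/negP => ir; case/hasP: lr; exists (nth 0%N (vertices l) i).
have rlF (i : 'I_nr) : nth 0%N (vertices r) i \notin vertices l.
  by apply/negP => ir; case/hasP: lr; exists (nth 0%N (vertices r) i).
have nthl (i : 'I_nl) : nth 0%N (vertices l ++ vertices r) i = nth 0%N (vertices l) i.
  by rewrite nth_cat ltn_ord.
have nthr (i : 'I_nr) : nth 0%N (vertices l ++ vertices r) (nl + i) = nth 0%N (vertices r) i.
  by rewrite nth_cat ltnNge leq_addr /= addKn.
have rootE S (i : 'I_(size (vertices S))) : uniq (vertices S) ->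
   (nth 0%N (vertices S) i \in root_vertex S) = (i == 0%N :> nat).
  case: S i => [|? b ?] /= i; first by case: i.
  by rewrite inE => /andP[b' _]; case: i => -[|i] //= ii; rewrite ?eqxx //;
    apply: contraNF b' => /eqP <-; rewrite mem_nth.
have rootF S z : z \notin vertices S -> z \in root_vertex S = false.
  by case: S => [|? b ?] //=; rewrite !inE negb_or => /andP[/negPf->].
have adjl (i : 'I_nl) : tree_adjacent (Node l a r) a (nth 0%N (vertices l) i) = (i == 0%N :>
  nat).
  by rewrite tree_adjacent_root // mem_cat rootE // (rootF r) // orbF.
have adjr (i : 'I_nr) : tree_adjacent (Node l a r) a (nth 0%N (vertices r) i) = (i == 0%N :>
  nat).
  by rewrite tree_adjacent_root // mem_cat rootE // (rootF l).
have adja : tree_adjacent (Node l a r) a a = false.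
  by rewrite tree_adjacent_root // mem_cat !rootF.
apply/matrixP => i j; rewrite !mxE.
case: (splitP i) => i' ii; rewrite mxE; case: (splitP j) => j' jj; rewrite ii jj.
- by rewrite !ord1 !mxE /= adja subr0 mulr1n.
- rewrite !ord1 !mxE /=; case: (splitP j') => k kk; rewrite kk !mxE.
    by rewrite nthl adjl mulr0n sub0r.
  by rewrite nthr adjr mulr0n sub0r.
- rewrite !ord1 !mxE /= tree_adjacent_sym; case: (splitP i') => k kk; rewrite kk !mxE.
    by rewrite nthl adjl mulr0n sub0r.
  by rewrite nthr adjr mulr0n sub0r.
rewrite !mxE /= !add0n /= eqSS; case: (splitP i') => k kk; rewrite mxE;
  case: (splitP j') => m mm; rewrite kk mm !mxE ?nthl ?nthr
    tree_adjacent_child // ?ne //.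
- by rewrite (@tree_adjacent_out r) ?orbF // lrF.
- rewrite !tree_adjacent_out ?lrF ?rlF ?orbT //= subr0.
  by rewrite (_ : _ == _ = false) ?mulr0n //; apply/negP => /eqP; have := ltn_ord k; lia.
- rewrite !tree_adjacent_out ?lrF ?rlF ?orbT //= subr0.
  by rewrite (_ : _ == _ = false) ?mulr0n //; apply/negP => /eqP; have := ltn_ord m; lia.
- by rewrite (@tree_adjacent_out l) ?eqn_add2l // rlF.
Qed.

(* The characteristic polynomial of a tree, paired with that of the tree
   without its root (0 for the empty tree). *)
Fixpoint cpolys (T : bintree) : {poly R} * {poly R} :=
  if T is Node l _ r then
    let: (pl, ql) := cpolys l in let: (pr, qr) := cpolys r in
    ('X * (pl * pr) - (ql * pr + pl * qr), pl * pr)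
  else (1, 0).

Definition first_row n : 'rV[{poly R}]_n := \row_j - (j == 0%N :> nat)%:R.

(** The third component is what [det_bordered] consumes one level higher: this quadratic form is the
    cofactor of the root, the polynomial of the tree without its root. For the empty tree it is an
    empty sum, whence the 0 in [cpolys]. *)
Lemma cmx_cpolys T n : uniq (vertices T) -> n = size (vertices T) ->
  let M := cmx (tree_adjacent T) (vertices T) n in
  [/\ \det M = (cpolys T).1, \det M != 0 &
      (first_row n *m \adj M *m (first_row n)^T) 0 0 = (cpolys T).2].
Proof.
elim: T n => [|l IHl a r IHr] n uT nE.
  rewrite nE /=; split; rewrite ?det_mx00 ?oner_neq0 //.
  by rewrite mxE big_ord0.
have uT' := uT; move: uT'; rewrite /= cat_uniq => /and4P[_ ul _ ur].
have {IHl}[dl l0 al] := IHl _ ul erefl.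
have {IHr}[dr r0 ar] := IHr _ ur erefl.
have M0 : \det (cmx (tree_adjacent (Node l a r)) (vertices (Node l a r)) n) != 0.
  by rewrite nE -char_poly_cmx monic_neq0 // char_poly_monic.
move: M0; have -> : n = (1 + (size (vertices l) + size (vertices r)))%N.
  by rewrite nE /= size_cat.
move: (cmx_node uT) => /= -> M0; split => //.
  rewrite det_bordered; last by rewrite det_ublock mulf_neq0.
  rewrite adj_block_diag // det_ublock dl dr mul_row_block !mulmx0 addr0 add0r.
  rewrite tr_row_mx mul_row_col -!scalemxAr -!scalemxAl mxE.
  rewrite [X in _ - (X + _)]mxE [X in _ - (_ + X)]mxE [X in _ - (_ * X + _)]al.
  rewrite [X in _ - (_ + _ * X)]ar.
  case: (cpolys l) => pl ql; case: (cpolys r) => pr qr /=.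
  by ring.
set u := row_mx _ _; set N := block_mx (cmx _ _ _) _ _ _.
have -> : (cpolys (Node l a r)).2 = \det N.
  rewrite det_ublock dl dr /=.
  by case: (cpolys l) => pl ql; case: (cpolys r) => pr qr.
set A := \adj _; have -> : (first_row (1 + (size (vertices l) + size (vertices r))) *m A *m
   (first_row (1 + (size (vertices l) + size (vertices r))))^T) 0 0 = A 0 0.
  rewrite mxE (bigD1 0) //= big1 => [|i i0]; last first.
    by move/negPf: i0; rewrite -val_eqE /= => i0; rewrite !mxE i0 oppr0 mulr0.
  rewrite !mxE (bigD1 0) //= big1 => [|i i0]; last first.
    by move/negPf: i0; rewrite -val_eqE /= => i0; rewrite !mxE i0 oppr0 mul0r.
  by rewrite !mxE /= !addr0 mulrN1 mulN1r opprK.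
rewrite mxE /cofactor expr0 mul1r; congr (\det _).
apply/matrixP => i j; rewrite mxE mxE -[in LHS](rshift1 i) -[in LHS](rshift1 j).
by rewrite block_mxEdr.
Qed.

Lemma mup_Xn_mul (n : nat) (p : {poly R}) : p.[0] != 0 -> mup 0 ('X^n * p) = n.
Proof.
move=> p0; rewrite mupMl ?rootE //.
have -> : 'X = 'X - 0%:P :> {poly R} by rewrite polyC0 subr0.
by rewrite mup_XsubCX eqxx.
Qed.

(* Up to a common sign [e], P ~ e X^n p with p(0) > 0, and Q, the polynomial
   of the tree without its root, is e X^(n-1) q with q(0) > 0 if the root is
   unmatched, and - e X^(n+1) q with q(0) >= 0 otherwise. The signs exclude
   cancellations in P = X P_l P_r - Q_l P_r - P_l Q_r. *)
Definition sign_form (b : bool) (n : nat) (PQ : {poly R} * {poly R}) :=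
  exists (e : R) (p q : {poly R}),
  [/\ PQ.1 = 'X^n * (e%:P * p), e ^+ 2 = 1, 0 < p.[0] &
    if b then [/\ (0 < n)%N, PQ.2 = 'X^(n.-1) * (e%:P * q) & 0 < q.[0]]
    else PQ.2 = - ('X^(n.+1) * (e%:P * q)) /\ 0 <= q.[0]].

Lemma sign_form_mup b n PQ : sign_form b n PQ -> mup 0 PQ.1 = n.
Proof.
move=> [e [p [q [-> e2 p0 _]]]]; apply: mup_Xn_mul.
rewrite hornerM hornerC mulf_neq0 //; last by rewrite gt_eqF.
by apply/eqP => e0; move: e2; rewrite e0 expr0n => /eqP; rewrite eq_sym oner_eq0.
Qed.

(** An absent child counts as matched, so a single vertex has nullity 1. The truncated predecessor
    is a true one, by [nul_gt0]. *)
Fixpoint nul (T : bintree) : nat :=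
  if T is Node l _ r then
    if ~~ unmatched l && ~~ unmatched r then (nul l + nul r).+1 else (nul l + nul r).-1
  else 0.

(** If some child is unmatched, the lowest power in [X P_l P_r - Q_l P_r - P_l Q_r] comes from the Q
    terms of the unmatched children, one degree below the sum of the nullities; the other terms are
    two degrees higher, and the sign becomes [- (e * e')]. If no child is unmatched, the minus signs
    inside Q_l and Q_r make all three terms agree in sign, one degree above the sum. *)
Lemma cpolys_sign T : sign_form (unmatched T) (nul T) (cpolys T).
Proof.
elim: T => [|l IHl a r IHr] /=.
  exists 1, 1, 0; split => /=.
  - by rewrite expr0 polyC1 !mul1r.
  - by rewrite expr1n.
  - by rewrite hornerC.
  - by rewrite !mulr0 oppr0 hornerC.
move: IHl IHr; case: (cpolys l) => pl ql; case: (cpolys r) => pr qr.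
move=> [e [p [q [/= -> e2 p0 Hl]]]] [e' [p' [q' [/= -> e2' p0' Hr]]]].
have ee : (e * e') ^+ 2 = 1 by rewrite exprMn e2 e2' mulr1.
case: (unmatched l) Hl => [[nl -> q0]|[-> q0]]; case: (unmatched r) Hr => [[nr -> q0']|[->
  q0']] /=.
- exists (- (e * e')), (q * p' + p * q' - 'X^2 * (p * p')), (p * p').
  move: nl nr; case: (nul l) => // n; case: (nul r) => // m _ _ /=.
  rewrite ?addSn ?addnS /= !hornerE; split; rewrite ?sqrrN //.
  + by rewrite !rmorphN !rmorphM /= !exprSr exprD; ring.
  + rewrite ?(mul0r, subr0, expr0n) /=; nra.
  + split; last by nra.
    by rewrite !rmorphN !rmorphM /= !exprSr exprD; ring.
- exists (- (e * e')), (q * p' - 'X^2 * (p * p' + p * q')), (p * p').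
  move: nl; case: (nul l) => // n; move: (nul r) => m _ /=.
  rewrite ?addSn ?addnS /= !hornerE; split; rewrite ?sqrrN //.
  + by rewrite !rmorphN !rmorphM /= !exprSr exprD; ring.
  + rewrite ?(mul0r, subr0, expr0n) /=; nra.
  + split; last by nra.
    by rewrite !rmorphN !rmorphM /= !exprSr exprD; ring.
- exists (- (e * e')), (p * q' - 'X^2 * (p * p' + q * p')), (p * p').
  move: nr; case: (nul r) => // n; move: (nul l) => m _ /=.
  rewrite ?addSn ?addnS /= !hornerE; split; rewrite ?sqrrN //.
  + by rewrite !rmorphN !rmorphM /= !exprSr exprD; ring.
  + rewrite ?(mul0r, subr0, expr0n) /=; nra.
  + split; last by nra.
    by rewrite !rmorphN !rmorphM /= !exprSr exprD; ring.
- exists (e * e'), (p * p' + q * p' + p * q'), (p * p').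
  move: (nul l) (nul r) => n m; rewrite !hornerE; split => //.
  + by rewrite !rmorphM /= !exprSr exprD; ring.
  + nra.
  + split => //; last by nra.
    by rewrite !rmorphM /= exprD; ring.
Qed.

Lemma nul_gt0 T : unmatched T -> (0 < nul T)%N.
Proof. by move=> fT; have [e [p [q]]] := cpolys_sign T; rewrite fT => -[_ _ _ []]. Qed.

Lemma N0_nul T : uniq (vertices T) -> N0 R T = nul T.
Proof.
move=> uT; rewrite /N0 char_poly_cmx.
have [-> _ _] := cmx_cpolys uT erefl.
exact: sign_form_mup (cpolys_sign T).
Qed.

End CharPoly.

(** * Uniform random increasing trees *)

Fixpoint leaf_insertions (x : nat) (T : bintree) : seq bintree :=
  if T is Node l a r then
    [seq Node l' a r | l' <- leaf_insertions x l] ++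
    [seq Node l a r' | r' <- leaf_insertions x r]
  else [:: Node EmptyTree x EmptyTree].

(** The largest label of an increasing tree sits at a leaf, so each tree on n + 1 labels arises from
    exactly one tree on n labels by hanging a leaf at a vacant place. *)
Fixpoint tree_list (n : nat) : seq bintree :=
  if n is m.+1 then flatten [seq leaf_insertions n T | T <- tree_list m]
  else [:: EmptyTree].

(** This cuts off the whole subtree at [x], which is a single leaf when [x] is the largest label of
    an increasing tree. *)
Fixpoint leaf_removal (x : nat) (T : bintree) : bintree :=
  if T is Node l a r then
    if a == x then EmptyTree else Node (leaf_removal x l) a (leaf_removal x r)
  else EmptyTree.

Lemma leaf_removal_id x T : x \notin vertices T -> leaf_removal x T = T.
Proof.
elim: T => [|l IHl a r IHr] //=; rewrite inE mem_cat !negb_or.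
by case/and3P => xa xl xr; rewrite eq_sym (negPf xa) IHl // IHr.
Qed.

Lemma leaf_insertionsK x T T' : x \notin vertices T ->
  T' \in leaf_insertions x T -> leaf_removal x T' = T.
Proof.
elim: T T' => [|l IHl a r IHr] T' /=; first by rewrite inE => _ /eqP -> /=; rewrite eqxx.
rewrite inE mem_cat !negb_or => /and3P[xa xl xr].
rewrite mem_cat => /orP[] /mapP[S SS ->] /=; rewrite eq_sym (negPf xa).
  by rewrite (IHl S) // leaf_removal_id.
by rewrite (IHr S) // leaf_removal_id.
Qed.

Lemma perm_leaf_insertions x T T' : T' \in leaf_insertions x T ->
  perm_eq (vertices T') (x :: vertices T).
Proof.
elim: T T' => [|l IHl a r IHr] T' /=; first by rewrite inE => /eqP ->.
rewrite mem_cat => /orP[] /mapP[S SS ->] /=.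
  apply: (@perm_trans _ (a :: x :: vertices l ++ vertices r)).
    by rewrite perm_cons -cat_cons perm_cat2r IHl.
  by rewrite -[a :: x :: _]/([:: a] ++ [:: x] ++ _) perm_catCA.
apply: (@perm_trans _ (a :: x :: vertices l ++ vertices r)).
  rewrite perm_cons -[x :: _]/([:: x] ++ _) perm_sym perm_catCA perm_cat2l.
  by rewrite perm_sym IHr.
by rewrite -[a :: x :: _]/([:: a] ++ [:: x] ++ _) perm_catCA.
Qed.

Lemma leaf_insertions_uniq x T : x \notin vertices T -> uniq (leaf_insertions x T).
Proof.
elim: T => [|l IHl a r IHr] //=; rewrite inE mem_cat !negb_or => /and3P[xa xl xr].
rewrite cat_uniq !map_inj_uniq ?IHl ?IHr ?andbT //=; last 2 first.
- by move=> ? ? [].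
- by move=> ? ? [].
(* A tree in both halves would have a left subtree equal to [l] and also one vertex larger than
   [l]. *)
apply/hasP => -[_ /mapP[r' rr ->] /mapP[l' ll [ll' _]]].
have := perm_leaf_insertions ll; rewrite -ll' => /perm_size /=; lia.
Qed.

Lemma tree_list_vertices n T : T \in tree_list n -> perm_eq (vertices T) (iota 1 n).
Proof.
elim: n T => [|n IHn] T; first by rewrite inE => /eqP ->.
case/flatten_mapP => S SS /perm_leaf_insertions TS.
rewrite (perm_trans TS) // -(addn1 n) (iotaD 1 n 1) add1n addn1 /=.
by rewrite perm_sym perm_catC perm_sym cat1s perm_cons IHn.
Qed.

Lemma tree_list_notin n T : T \in tree_list n -> n.+1 \notin vertices T.
Proof. by move=> /tree_list_vertices /perm_mem ->; rewrite mem_iota; lia. Qed.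

Lemma tree_list_uniq n : uniq (tree_list n).
Proof.
elim: n => // n IHn; rewrite [tree_list _]/=.
have : {subset tree_list n <= tree_list n} by [].
elim: {1 2 4}(tree_list n) IHn => //= T s IHs /andP[Ts us] sub.
rewrite cat_uniq IHs // ?leaf_insertions_uniq; last 2 first.
- by rewrite tree_list_notin // sub ?mem_head.
- by move=> S Ss; apply: sub; rewrite inE Ss orbT.
rewrite andbT /=; apply/hasP => -[S /flatten_mapP[T' T's ST'] ST].
have := leaf_insertionsK (tree_list_notin (sub _ (mem_head _ _))) ST.
rewrite (leaf_insertionsK _ ST'); last first.
  by rewrite tree_list_notin // sub // inE T's orbT.
by move=> E; move: Ts; rewrite -E T's.
Qed.

Lemma leaf_insertions_edges x T T' u v : T' \in leaf_insertions x T ->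
  (u, v) \in edges T' -> ((u, v) \in edges T) || ((u \in vertices T) && (v == x)).
Proof.
have rootI S S' w : S' \in leaf_insertions x S -> w \in root_vertex S' ->
    w \in root_vertex S \/ w = x.
  case: S => [|l b r] /=; first by rewrite inE => /eqP -> /=; rewrite inE => /eqP; right.
  by rewrite mem_cat => /orP[] /mapP[? _ ->] /= ->; left.
have pairE a w (s : seq nat) : (u, w) \in [seq (a, y) | y <- s] = (u == a) && (w \in s).
  apply/mapP/andP => [[y ys [-> ->]]|[/eqP -> ws]]; first by rewrite eqxx.
  by exists w.
elim: T T' => [|l IHl a r IHr] T' /=; first by rewrite inE => /eqP ->.
rewrite mem_cat => /orP[] /mapP[S SS ->] /=; rewrite !mem_cat !pairE !mem_cat inE.
  case/or3P => [/andP[ua /orP[|vr]]|/(IHl _ SS)/orP[->|/andP[ul ->]]|->];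
    rewrite ?mem_cat ?ua ?vr ?ul ?orbT //=.
  by case/(rootI _ _ _ SS) => [->|->]; rewrite ?eqxx ?orbT.
case/or3P => [/andP[ua /orP[vl|]]|->|/(IHr _ SS)/orP[->|/andP[ul ->]]];
  rewrite ?mem_cat ?ua ?vl ?ul ?orbT //=.
by case/(rootI _ _ _ SS) => [->|->]; rewrite ?eqxx ?orbT.
Qed.

Lemma leaf_removal_edges x T : {subset edges (leaf_removal x T) <= edges T}.
Proof.
have rootR S : {subset root_vertex (leaf_removal x S) <= root_vertex S}.
  by case: S => [|l b r] z /=; [rewrite in_nil|case: ifP => _ /=; rewrite ?in_nil].
elim: T => [|l IHl a r IHr] //= -[u v]; case: ifP => //= _.
rewrite !mem_cat => /or3P[|/IHl ->|/IHr ->]; rewrite ?orbT //.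
case/mapP => w; rewrite mem_cat => wlr [-> ->].
apply/orP; left; apply/mapP; exists w => //.
by rewrite mem_cat; case/orP: wlr => /rootR ->; rewrite ?orbT.
Qed.

Lemma leaf_insertions_removal x T : uniq (vertices T) -> x \in vertices T ->
  (forall y, y \in vertices T -> (y <= x)%N) ->
  (forall u v, (u, v) \in edges T -> (u < v)%N) ->
  T \in leaf_insertions x (leaf_removal x T).
Proof.
elim: T => [|l IHl a r IHr] //= /andP[_]; rewrite cat_uniq => /and3P[ul lr ur].
have rootP S z : z \in root_vertex S -> z \in vertices S.
  by case: S => [|? ? ?] //=; rewrite inE => /eqP ->; rewrite mem_head.
rewrite inE mem_cat => xT le lt.
case: eqP => [ax|/eqP ax] /=.
  (* A nonempty child of the vertex [x] would carry a label above [x], against maximality. *)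
  have nil S : {subset vertices S <= a :: vertices l ++ vertices r} ->
      {subset root_vertex S <= root_vertex l ++ root_vertex r} -> S = EmptyTree.
    case: S => [|? b ?] //= sub subr.
    have := le b (sub _ (mem_head _ _)); rewrite -ax leqNgt lt //.
    rewrite mem_cat; apply/orP; left; apply: map_f; apply: subr.
    by rewrite inE.
  have lE : l = EmptyTree.
    by apply: nil => y yl; rewrite ?inE mem_cat yl ?orbT.
  have rE : r = EmptyTree.
    by apply: nil => y yr; rewrite ?inE mem_cat yr ?orbT.
  by rewrite lE rE ax inE.
rewrite eq_sym (negPf ax) /= in xT.
rewrite mem_cat; case/orP: xT => xT; apply/orP; [left|right].
  have xr : x \notin vertices r.
    by apply/negP => xr; case/hasP: lr; exists x.
  rewrite (leaf_removal_id xr); apply/mapP; exists l => //.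
  apply: IHl => // [y yl|u v uv]; first by apply: le; rewrite inE mem_cat yl orbT.
  by apply: lt; rewrite !mem_cat uv !orbT.
have xl : x \notin vertices l.
  by apply/negP => xl; case/hasP: lr; exists x.
rewrite (leaf_removal_id xl); apply/mapP; exists r => //.
apply: IHr => // [y yl|u v uv]; first by apply: le; rewrite inE mem_cat yl !orbT.
by apply: lt; rewrite !mem_cat uv !orbT.
Qed.

Lemma increasing_treesE n : increasing_trees n = [set` tree_list n].
Proof.
apply/seteqP; split => T /=; last first.
  move=> TL; split; first exact: tree_list_vertices.
  elim: n T TL => [|n IHn] T; first by rewrite inE => /eqP ->.
  case/flatten_mapP => S SS TS x y /(leaf_insertions_edges TS)/orP[/(IHn _ SS)//|].
  case/andP => xS /eqP ->; move: xS.
  by rewrite (perm_mem (tree_list_vertices SS)) mem_iota; lia.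
elim: n T => [|n IHn] T [pT iT].
  by move: pT => /perm_size /=; case: T iT => // _; rewrite inE.
have TS : T \in leaf_insertions n.+1 (leaf_removal n.+1 T).
  apply: leaf_insertions_removal => //.
  - by rewrite (perm_uniq pT) iota_uniq.
  - by rewrite (perm_mem pT) mem_iota; lia.
  - by move=> y; rewrite (perm_mem pT) mem_iota; lia.
apply/flatten_mapP; exists (leaf_removal n.+1 T) => //.
apply: IHn; split; last by move=> x y /leaf_removal_edges/iT.
have := perm_leaf_insertions TS; rewrite perm_sym => /perm_trans/(_ pT).
by rewrite -(addn1 n) (iotaD 1 n 1) add1n addn1 perm_sym perm_catC perm_sym cat1s perm_cons.
Qed.

(** The subtrees of a random tree carry label sets other than 1, ..., k. Functions of the shape
    alone can be evaluated without relabelling them. *)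
Fixpoint unlabel (T : bintree) : bintree :=
  if T is Node l _ r then Node (unlabel l) 0 (unlabel r) else EmptyTree.

Section Expectation.
Variable R : realType.

Definition label_free (f : bintree -> R) := forall T, f (unlabel T) = f T.

Definition tsum (n : nat) (f : bintree -> R) : R := \sum_(T <- tree_list n) f T.

Lemma tsum_ext {n} f g : f =1 g -> tsum n f = tsum n g.
Proof. by move=> fg; apply: eq_bigr => T _; exact: fg. Qed.

Lemma tsumD n f g : tsum n (fun T => f T + g T) = tsum n f + tsum n g.
Proof. exact: big_split. Qed.

Lemma tsumZ n c f : tsum n (fun T => c * f T) = c * tsum n f.
Proof. by rewrite /tsum mulr_sumr. Qed.

Lemma tsum_sum n (s : seq bintree) (F : bintree -> bintree -> R) :
  tsum n (fun T => \sum_(S <- s) F S T) = \sum_(S <- s) tsum n (F S).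
Proof. exact: exchange_big. Qed.

Lemma unlabel_leaf_insertions x y T :
  map unlabel (leaf_insertions x (unlabel T)) = map unlabel (leaf_insertions y T).
Proof.
have shapeK S : unlabel (unlabel S) = unlabel S.
  by elim: S => //= l -> a r ->.
elim: T => //= l IHl a r IHr; rewrite !map_cat -!map_comp; congr (_ ++ _).
  rewrite (eq_map (g := (fun l' => Node l' 0 (unlabel r)) \o unlabel)); last first.
    by move=> l' /=; rewrite shapeK.
  by rewrite map_comp IHl -map_comp.
rewrite (eq_map (g := (fun r' => Node (unlabel l) 0 r') \o unlabel)); last first.
  by move=> l' /=; rewrite shapeK.
by rewrite map_comp IHr -map_comp.
Qed.

Definition isum (f : bintree -> R) T := \sum_(S <- leaf_insertions 0 T) f S.

Lemma isumE f x T : label_free f ->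
  \sum_(S <- leaf_insertions x T) f S = isum f T.
Proof.
move=> lf; rewrite /isum -(eq_bigr _ (fun T _ => lf T)) -[RHS](eq_bigr _ (fun T _ => lf T)).
rewrite -(big_map unlabel predT f) -[RHS](big_map unlabel predT f).
by rewrite -(unlabel_leaf_insertions x) (unlabel_leaf_insertions x 0).
Qed.

Lemma isum_label_free f : label_free f -> label_free (isum f).
Proof.
move=> lf T; rewrite /isum -(eq_bigr _ (fun T _ => lf T)) -[RHS](eq_bigr _ (fun T _ => lf T)).
rewrite -(big_map unlabel predT f) -[RHS](big_map unlabel predT f).
by rewrite (unlabel_leaf_insertions 0 0).
Qed.

Lemma tsum_insert n f : label_free f -> tsum n.+1 f = tsum n (isum f).
Proof.
move=> lf; rewrite /tsum /= big_flatten big_map.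
by apply: eq_bigr => T _; rewrite isumE.
Qed.

(** The binomial coefficient counts the label sets of the left subtree, but no relabelling bijection
    is built: by induction, the new leaf enters the left or the right subtree, and Pascal's rule
    adds the two contributions. *)
Lemma tsum_rec n f : label_free f ->
  tsum n.+1 f = \sum_(k < n.+1) 'C(n, k)%:R *
    tsum k (fun l => tsum (n - k) (fun r => f (Node l 0 r))).
Proof.
elim: n f => [|n IHn] f lf.
  by rewrite big_ord1 bin0 mul1r /tsum /= !big_seq1 -lf.
rewrite tsum_insert // (IHn _ (isum_label_free lf)).
pose A i j := tsum i (fun l => tsum j (fun r => f (Node l 0 r))).
have E (k : 'I_n.+1) : tsum k (fun l => tsum (n - k) (fun r => isum f (Node l 0 r))) =
    A k.+1 (n - k)%N + A k (n - k).+1.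
  rewrite /A tsum_insert; last by move=> T; apply: tsum_ext => S; rewrite -lf -[RHS]lf /=;
    congr (f (Node _ _ _)); elim: T => //= ? -> ? ? ->.
  rewrite -tsumD; apply: tsum_ext => l.
  rewrite tsum_insert; last by move=> T; rewrite -lf -[RHS]lf /=; congr (f (Node _ _ _));
    elim: T => //= ? -> ? ? ->.
  rewrite /isum -tsum_sum -tsumD; apply: tsum_ext => r /=.
  by rewrite big_cat !big_map.
under eq_bigr do rewrite E mulrDr.
rewrite big_split /= [RHS]big_ord_recl bin0 mul1r subn0 /=.
under [in RHS]eq_bigr do rewrite /bump leq0n add1n binS natrD mulrDl subSS.
rewrite big_split /= [X in _ = _ + (X + _)]big_ord_recr /= bin_small // mul0r addr0.
rewrite [X in _ + X = _]big_ord_recl bin0 mul1r subn0 /=.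
rewrite addrCA; congr (_ + _); rewrite addrC; congr (_ + _).
apply: eq_bigr => i _; rewrite /bump leq0n add1n; congr (_ * A _ _).
by have := ltn_ord i; lia.
Qed.

Lemma size_tree_list n : (size (tree_list n))%:R = n`!%:R :> R.
Proof.
have sizeE m : (size (tree_list m))%:R = tsum m (fun=> 1).
  by rewrite /tsum big_const_seq count_predT iter_addr_0.
rewrite sizeE; elim/ltn_ind: n => -[|n] IHn; first by rewrite /tsum big_seq1.
rewrite tsum_rec // (eq_bigr (fun=> n`!%:R)) => [|k _].
  by rewrite sumr_const card_ord -[LHS]mulr_natl -natrM factS.
have kn : (k <= n)%N by rewrite -ltnS.
rewrite (tsum_ext (g := fun l => (n - k)`!%:R * 1)) => [|l]; last first.
  by rewrite mulr1 IHn // ltnS leq_subr.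
rewrite tsumZ IHn // -!natrM; congr _%:R.
by rewrite -(bin_fact kn); lia.
Qed.

Local Notation E := (@tree_expectation R).

Lemma tree_expectationE n f : E n f = tsum n f / n`!%:R.
Proof.
have fin : finite_set [set` tree_list n].
  by rewrite -increasing_treesE; exact: finite_increasing_trees.
rewrite /tree_expectation increasing_treesE -fsbig_seq ?tree_list_uniq //.
congr (_ / _); rewrite -size_tree_list; congr _%:R; apply: perm_size.
apply: uniq_perm; rewrite ?tree_list_uniq ?fset_uniq // => T.
by rewrite in_fset_set // mem_setE.
Qed.

Lemma tree_expectation_ext n f g : {in tree_list n, f =1 g} -> E n f = E n g.
Proof.
by move=> fg; rewrite !tree_expectationE; congr (_ / _); apply: eq_big_seq => T; exact: fg.
Qed.

Lemma tree_expectationD n f g : E n (fun T => f T + g T) = E n f + E n g.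
Proof. by rewrite !tree_expectationE tsumD mulrDl. Qed.

Lemma tree_expectationZ n c f : E n (fun T => c * f T) = c * E n f.
Proof. by rewrite !tree_expectationE tsumZ mulrA. Qed.

Lemma tree_expectation_cst n c : E n (fun=> c) = c.
Proof.
rewrite tree_expectationE /tsum big_const_seq count_predT iter_addr_0.
by rewrite -[c *+ _]mulr_natr size_tree_list mulfK // pnatr_eq0 -lt0n fact_gt0.
Qed.

Lemma tree_expectation_le n f g : (forall T, f T <= g T) -> E n f <= E n g.
Proof.
move=> fg; rewrite !tree_expectationE ler_wpM2r ?invr_ge0 //.
by apply: ler_sum => T _; exact: fg.
Qed.

Lemma tree_expectation0 f : E 0 f = f EmptyTree.
Proof. by rewrite tree_expectationE /tsum big_seq1 divr1. Qed.

(** The product of ['C(n, k)] with the numbers k! and (n - k)! of subtrees is n!, whatever k; this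
    is the uniformity of the left size. *)
Lemma tree_expectation_rec n f : label_free f ->
  E n.+1 f = n.+1%:R^-1 * \sum_(k < n.+1)
    E k (fun l => E (n - k) (fun r => f (Node l 0 r))).
Proof.
move=> lf; rewrite tree_expectationE tsum_rec // mulr_suml mulr_sumr.
apply: eq_bigr => k _; have kn : (k <= n)%N by rewrite -ltnS.
rewrite tree_expectationE [X in _ = _ * (X / _)](tsum_ext (g := fun l => (n - k)`!%:R^-1 *
  tsum (n - k) (fun r => f (Node l 0 r)))); last first.
  by move=> l; rewrite tree_expectationE mulrC.
have nz m : m`!%:R != 0 :> R by rewrite pnatr_eq0 -lt0n fact_gt0.
rewrite tsumZ factS -(bin_fact kn) !natrM.
have b0 : 'C(n, k)%:R != 0 :> R by rewrite pnatr_eq0 -lt0n bin_gt0.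
by field; rewrite b0 !nz nat1r pnatr_eq0.
Qed.

End Expectation.

(** * Recursions for the moments *)

Section Recursions.
Variable R : realType.
Local Notation E := (@tree_expectation R).

Definition cauchyp (x y : nat -> R) (n : nat) : R := \sum_(k < n.+1) x k * y (n - k)%N.

Lemma cauchypC x y n : cauchyp x y n = cauchyp y x n.
Proof.
rewrite /cauchyp (reindex_inj rev_ord_inj) /=; apply: eq_bigr => k _.
by rewrite subSS subKn 1?mulrC // -ltnS.
Qed.

Lemma tree_expectation_node {n} f (s : seq ((bintree -> R) * (bintree -> R))) :
  label_free f ->
  (forall l r, f (Node l 0 r) = \sum_(pq <- s) pq.1 l * pq.2 r) ->
  n.+1%:R * E n.+1 f = \sum_(pq <- s) cauchyp (E^~ pq.1) (E^~ pq.2) n.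
Proof.
move=> lf fs; rewrite tree_expectation_rec // mulVKf ?pnatr_eq0 //.
rewrite /cauchyp exchange_big /=; apply: eq_bigr => k _.
have EE m g : E m (fun T => \sum_(pq <- s) g pq T) = \sum_(pq <- s) E m (g pq).
  elim: s {fs} => [|pq s IHs].
    rewrite big_nil -[RHS](tree_expectation_cst m (0 : R)).
    by apply: tree_expectation_ext => T _; rewrite big_nil.
  rewrite big_cons -IHs -tree_expectationD; apply: tree_expectation_ext => T _.
  by rewrite big_cons.
transitivity (E k (fun l => \sum_(pq <- s) E (n - k) pq.2 * pq.1 l)).
  apply: tree_expectation_ext => l _.
  rewrite (tree_expectation_ext (g := fun r => \sum_(pq <- s) pq.1 l * pq.2 r)) => [|r _].
    by rewrite EE; apply: eq_bigr => pq _; rewrite tree_expectationZ mulrC.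
  exact: fs.
by rewrite EE; apply: eq_bigr => pq _; rewrite tree_expectationZ mulrC.
Qed.

Definition matched (T : bintree) : R := (~~ unmatched T)%:R.

(* Subtracting [lam] times the number of vertices plus one keeps [N0] additive
   over the two subtrees of the root, up to a toll of 1 or -1. *)
Definition cnul (lam : R) (T : bintree) : R :=
  (nul T)%:R - lam * (size (vertices T)).+1%:R.

Lemma unmatched_unlabel T : unmatched (unlabel T) = unmatched T.
Proof. by elim: T => //= l -> a r ->. Qed.

Lemma nul_unlabel T : nul (unlabel T) = nul T.
Proof. by elim: T => //= l -> a r ->; rewrite !unmatched_unlabel. Qed.

Lemma size_unlabel T : size (vertices (unlabel T)) = size (vertices T).
Proof. by elim: T => //= l IHl a r IHr; rewrite !size_cat IHl IHr. Qed.

Lemma matched_unlabel : label_free matched.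
Proof. by move=> T; rewrite /matched unmatched_unlabel. Qed.

Lemma cnul_unlabel lam : label_free (cnul lam).
Proof. by move=> T; rewrite /cnul nul_unlabel size_unlabel. Qed.

Lemma matched_node l a r : matched (Node l a r) = 1 - matched l * matched r.
Proof.
by rewrite /matched /=; case: (unmatched l); case: (unmatched r);
  rewrite /= ?mulr0 ?mul0r ?mulr1 ?subr0 ?subrr.
Qed.

Lemma cnul_node lam l a r : cnul lam (Node l a r) =
  cnul lam l + cnul lam r + (2 * (matched l * matched r) - 1).
Proof.
have sE : (size (vertices (Node l a r))).+1 = ((size (vertices l)).+1 + (size (vertices
  r)).+1)%N.
  by rewrite /= size_cat; lia.
rewrite /cnul sE natrD /matched [nul (Node _ _ _)]/= {sE}.
case fl: (unmatched l); case fr: (unmatched r) => /=; last first.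
- by rewrite -addn1 !natrD; ring.
(* An unmatched child has positive nullity, so the predecessor in [nul] is not truncated. *)
all: rewrite -subn1 natrB ?natrD; first by ring.
all: by rewrite addn_gt0 ?(nul_gt0 R fl) ?(nul_gt0 R fr) ?orbT.
Qed.

Definition b_ n := E n matched.
Definition d_ lam n := E n (cnul lam).
Definition c_ lam n := E n (fun T => cnul lam T * matched T).
Definition m_ lam n := E n (fun T => cnul lam T ^+ 2).

Let one : bintree -> R := fun=> 1.

Lemma E_one n : E n one = 1. Proof. exact: tree_expectation_cst. Qed.

Lemma cauchyp1r x n : cauchyp x (E^~ one) n = \sum_(k < n.+1) x k.
Proof. by apply: eq_bigr => k _; rewrite E_one mulr1. Qed.

Lemma cauchyp1l x n : cauchyp (E^~ one) x n = \sum_(k < n.+1) x k.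
Proof. by rewrite cauchypC cauchyp1r. Qed.

Lemma cauchyp11 n : cauchyp (E^~ one) (E^~ one) n = n.+1%:R.
Proof.
by rewrite cauchyp1r (eq_bigr (fun=> 1)) ?sumr_const ?card_ord // => k _; rewrite E_one.
Qed.

Lemma cauchypZl a f y n :
  cauchyp (E^~ (fun T => a * f T)) y n = a * cauchyp (E^~ f) y n.
Proof.
by rewrite mulr_sumr; apply: eq_bigr => k _; rewrite tree_expectationZ mulrA.
Qed.

Lemma b_rec n : n.+1%:R * b_ n.+1 = n.+1%:R - cauchyp b_ b_ n.
Proof.
rewrite (tree_expectation_node (s := [:: (one, one); (fun T => -1 * matched T, matched)])).
- by rewrite big_cons big_seq1 /= cauchyp11 cauchypZl mulN1r.
- exact: matched_unlabel.
- by move=> l r; rewrite matched_node big_cons big_seq1 /= /one; ring.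
Qed.

Lemma d_rec lam n : n.+1%:R * d_ lam n.+1 =
  2 * \sum_(k < n.+1) d_ lam k + 2 * cauchyp b_ b_ n - n.+1%:R.
Proof.
rewrite (tree_expectation_node (s := [:: (cnul lam, one); (one, cnul lam);
   (fun T => 2 * matched T, matched); (fun T => -1 * one T, one)])).
- rewrite !big_cons big_nil /= (cauchypZl 2 matched) (cauchypZl (-1) one).
  rewrite cauchyp1r cauchyp1l cauchyp11 /d_ /b_.
  move: (\sum_(k < n.+1) E k (cnul lam)) (cauchyp (E^~ matched) (E^~ matched) n).
  by move=> u v; ring.
- exact: cnul_unlabel.
- by move=> l r; rewrite cnul_node !big_cons big_nil /= /one; ring.
Qed.

Lemma unmatched_node l a r : 1 - matched (Node l a r) = matched l * matched r.
Proof. by rewrite matched_node; ring. Qed.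

Lemma matched_idem T : matched T * matched T = matched T.
Proof. by rewrite /matched; case: (unmatched T); rewrite /= ?mulr0 ?mulr1. Qed.

(** The complement [1 - matched] of a node is the product of the indicators of its children, and the
    toll is 1 wherever that product is nonzero. Passing through the complement thus leaves only
    products of [cnul * matched], or of [matched], with [matched]. *)
Lemma c_rec lam n : n.+1%:R * c_ lam n.+1 =
  n.+1%:R * d_ lam n.+1 - 2 * cauchyp (c_ lam) b_ n - cauchyp b_ b_ n.
Proof.
have -> : c_ lam n.+1 = d_ lam n.+1 - E n.+1 (fun T => cnul lam T * (1 - matched T)).
  apply/eqP; rewrite eq_sym subr_eq -tree_expectationD; apply/eqP.
  by apply: tree_expectation_ext => T _; ring.
rewrite mulrBr -addrA; congr (_ + _); rewrite -opprD; congr (- _).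
rewrite (tree_expectation_node (s := [:: (fun T => cnul lam T * matched T, matched);
   (matched, fun T => cnul lam T * matched T); (matched, matched)])).
- by rewrite !big_cons big_nil /= [cauchyp (E^~ matched) (E^~ (fun _ => _ * _)) _]cauchypC
  /c_ /b_; ring.
- by move=> T; rewrite cnul_unlabel matched_unlabel.
- move=> l r; rewrite unmatched_node cnul_node !big_cons big_nil /=.
  by rewrite -[in RHS](matched_idem l) -[in RHS](matched_idem r) /matched;
     case: (unmatched l); case: (unmatched r) => /=; ring.
Qed.

(** The toll squares to 1. In the cross term [2 (Y_l + Y_r) (2 m_l m_r - 1)] the factors [Y m]
    regroup into the mixed moment [c_], and the symmetry between left and right doubles 4 to 8. *)
Lemma m_rec lam n : n.+1%:R * m_ lam n.+1 =
  2 * \sum_(k < n.+1) m_ lam k + 2 * cauchyp (d_ lam) (d_ lam) n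
  + 8 * cauchyp (c_ lam) b_ n - 4 * \sum_(k < n.+1) d_ lam k + n.+1%:R.
Proof.
rewrite (tree_expectation_node (s := [:: (fun T => cnul lam T ^+ 2, one);
  (one, fun T => cnul lam T ^+ 2);
   (fun T => 2 * cnul lam T, cnul lam);
   (fun T => 4 * (cnul lam T * matched T), matched);
   (matched, fun T => 4 * (cnul lam T * matched T));
   (fun T => -2 * cnul lam T, one); (one, fun T => -2 * cnul lam T); (one, one)])).
- rewrite !big_cons big_nil /=.
  rewrite [cauchyp (E^~ one) (E^~ (fun _ => _ ^+ 2)) _]cauchypC.
  rewrite [cauchyp (E^~ one) (E^~ (fun _ => -2 * _)) _]cauchypC.
  rewrite [cauchyp (E^~ matched) (E^~ (fun _ => 4 * _)) _]cauchypC.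
  rewrite (cauchypZl 2 (cnul lam)) !(cauchypZl (-2) (cnul lam)).
  rewrite !(cauchypZl 4 (fun T => cnul lam T * matched T)) cauchyp11 !cauchyp1r /m_ /b_ /c_ /d_.
  move: (\sum_(k < n.+1) E k (cnul lam)) (\sum_(k < n.+1) E k (fun T => cnul lam T ^+ 2)).
  move: (cauchyp (E^~ (cnul lam)) _ _) (cauchyp (E^~ (fun T => cnul lam T * matched T)) _ _).
  by move=> x y u v; ring.
- by move=> T; rewrite cnul_unlabel.
- move=> l r; rewrite cnul_node !big_cons big_nil /= /one /matched.
  by case: (unmatched l); case: (unmatched r) => /=; ring.
Qed.

Lemma cnul_empty lam : cnul lam EmptyTree = - lam.
Proof. by rewrite /cnul /= mulr1 sub0r. Qed.

Lemma b_0 : b_ 0 = 1. Proof. by rewrite /b_ tree_expectation0. Qed.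
Lemma d_0 lam : d_ lam 0 = - lam. Proof. by rewrite /d_ tree_expectation0 cnul_empty. Qed.
Lemma c_0 lam : c_ lam 0 = - lam.
Proof. by rewrite /c_ tree_expectation0 cnul_empty /matched mulr1. Qed.
Lemma m_0 lam : m_ lam 0 = lam ^+ 2.
Proof. by rewrite /m_ tree_expectation0 cnul_empty sqrrN. Qed.

Lemma b_ge0 n : 0 <= b_ n.
Proof.
by rewrite -(tree_expectation_cst n (0 : R)); apply: tree_expectation_le => T;
  rewrite /matched ler0n.
Qed.

Lemma b_le1 n : b_ n <= 1.
Proof.
by rewrite -(tree_expectation_cst n (1 : R)); apply: tree_expectation_le => T;
  rewrite /matched lern1 leq_b1.
Qed.

Lemma tree_size n T : T \in tree_list n -> size (vertices T) = n.
Proof. by move=> /tree_list_vertices /perm_size; rewrite size_iota. Qed.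

Lemma d_shift lam n : d_ lam n = d_ 0 n - lam * n.+1%:R.
Proof.
rewrite -(tree_expectation_cst n (lam * n.+1%:R)) -[X in _ - X]mul1r -mulNr
  -tree_expectationZ -tree_expectationD.
by apply: tree_expectation_ext => T /tree_size Tn; rewrite /cnul Tn; ring.
Qed.

Lemma variance_cnul lam n :
  tree_variance n (fun T => (N0 R T)%:R) = m_ lam n - d_ lam n ^+ 2.
Proof.
have N0E T : T \in tree_list n -> (N0 R T)%:R = cnul lam T + lam * n.+1%:R.
  move=> Tn; rewrite N0_nul ?(perm_uniq (tree_list_vertices Tn)) ?iota_uniq //.
  by rewrite /cnul (tree_size Tn) subrK.
rewrite /tree_variance (tree_expectation_ext N0E) tree_expectationD tree_expectation_cst.
rewrite (tree_expectation_ext (g := fun T => cnul lam T ^+ 2 + (-2 * d_ lam n * cnul lam T +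
  d_ lam n ^+ 2))).
  by rewrite tree_expectationD tree_expectationD tree_expectationZ tree_expectation_cst /m_
    /d_; ring.
by move=> T Tn; rewrite N0E // /d_; ring.
Qed.

End Recursions.

(** * Boundedness of the moments *)

Section Asymptotics.
Variable R : realType.
Local Notation s5 := (Num.sqrt 5 : R).
Local Notation beta := ((s5 - 1) / 2).

Lemma sqrt5_sqr : s5 ^+ 2 = 5.
Proof. by rewrite sqr_sqrtr. Qed.

Lemma lt_sqrt5 (a : R) : 0 <= a -> a ^+ 2 < 5 -> a < s5.
Proof. by have := sqrt5_sqr; have : 0 <= s5 by [exact: sqrtr_ge0]; nra. Qed.

Lemma sqrt5_lt (a : R) : 0 <= a -> 5 < a ^+ 2 -> s5 < a.
Proof. by have := sqrt5_sqr; have : 0 <= s5 by [exact: sqrtr_ge0]; nra. Qed.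

(** These are consecutive convergents of the continued fraction of sqrt 5. *)
Lemma sqrt5_bounds : 38 / 17 < s5 < 161 / 72.
Proof.
apply/andP; split; first by apply: lt_sqrt5; lra.
by apply: sqrt5_lt; lra.
Qed.

Lemma eventually_le_nat (x : R) : exists N : nat, forall n, (N <= n)%N -> x <= n%:R.
Proof.
exists (Num.bound `|x|) => n Nn.
have xb := archi_boundP (normr_ge0 x).
apply: le_trans (ler_norm x) _; apply: le_trans (ltW xb) _.
by rewrite ler_nat.
Qed.

(** Subtracting consecutive instances shows that [u n] has increments [2 t_n / ((n + 2) (n + 3))],
    which telescope against [2 T / (n + 2)]. So [q] increases, [p] decreases, and [L] is the
    supremum of [q]. Multiplying the error [2 T / (n + 2)] back by n + 2 and adding [t n] gives
    [3 T]. *)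
Lemma additive_recurrence (a t : nat -> R) (T : R) :
  (forall n, `|t n| <= T) ->
  (forall n, n.+1%:R * a n.+1 = n.+1%:R * t n + 2 * \sum_(k < n.+1) a k) ->
  exists L, forall n, `|a n - L * n.+1%:R| <= 3 * T.
Proof.
move=> tT arec.
have T0 : 0 <= T by apply: le_trans (tT 0%N).
pose u n := (a n.+1 - t n) / n.+2%:R.
have a1 : a 1%N = t 0%N + 2 * a 0%N by have := arec 0%N; rewrite big_ord1; lra.
have u0 : u 0%N = a 0%N by rewrite /u a1; field.
have n1 n : 1 <= n.+1%:R :> R by rewrite ler1n.
have uS n : u n.+1 = u n + 2 * t n / (n.+2%:R * n.+3%:R).
  have := arec n.+1; rewrite big_ord_recr /= mulrDr.
  have -> : 2 * \sum_(i < n.+1) a i = n.+1%:R * a n.+1 - n.+1%:R * t n.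
    by rewrite arec; ring.
  move=> E; rewrite /u; move: E.
  rewrite -[n.+3%:R]natr1 -[n.+2%:R]natr1; move: (n.+1%:R) (n1 n) => n' n'1 E.
  have -> : a n.+2 = t n.+1 + (n' * a n.+1 - n' * t n + 2 * a n.+1) / (n' + 1).
    apply: (mulfI (x := n' + 1)); first by rewrite gt_eqF //; lra.
    by rewrite E; field; rewrite gt_eqF //; lra.
  by field; rewrite !gt_eqF //; lra.
pose p n := u n + 2 * T / n.+2%:R; pose q n := u n - 2 * T / n.+2%:R.
have step n : 2 * T / (n.+2%:R * n.+3%:R) = 2 * T / n.+2%:R - 2 * T / n.+3%:R.
  rewrite -[n.+3%:R]natr1; move: (n.+2%:R) (n1 n.+1) => n' n'1.
  by field; rewrite !gt_eqF //; lra.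
have tb n : `|2 * t n / (n.+2%:R * n.+3%:R)| <= 2 * T / (n.+2%:R * n.+3%:R).
  have : 0 <= (n.+2%:R * n.+3%:R : R)^-1 by rewrite invr_ge0 mulr_ge0.
  move: (_^-1) => i i0; have := tT n; rewrite !ler_norml => /andP[t1 t2].
  by apply/andP; split; nra.
have pS n : p n.+1 <= p n.
  by rewrite /p uS; have := tb n; rewrite step; move: (2 * t n / _) (2 * T / n.+2%:R) (2 * T
    / n.+3%:R) => X Y Z; rewrite ler_norml => /andP[]; lra.
have qS n : q n <= q n.+1.
  by rewrite /q uS; have := tb n; rewrite step; move: (2 * t n / _) (2 * T / n.+2%:R) (2 * T
    / n.+3%:R) => X Y Z; rewrite ler_norml => /andP[]; lra.
have pm : {homo p : m n / (m <= n)%N >-> n <= m}.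
  by apply: homo_leq => // x y z xy yz; exact: le_trans yz xy.
have qm : {homo q : m n / (m <= n)%N >-> m <= n}.
  by apply: homo_leq => // x y z xy yz; exact: le_trans xy yz.
have qp n : q n <= p n.
  by rewrite /q /p; have : 0 <= 2 * T / n.+2%:R by [rewrite divr_ge0 ?mulr_ge0];
    move: (_ / _) => Y; lra.
have qpmn m n : q m <= p n.
  apply: le_trans (qm _ _ (leq_maxl m n)) _.
  by apply: le_trans (qp _) _; apply: pm; exact: leq_maxr.
exists (sup (range q)).
have Lub n : q n <= sup (range q).
  by apply: ub_le_sup; [exists (p 0%N) => _ [m _ <-]; exact: qpmn|exists n].
have Llb n : sup (range q) <= p n.
  by apply: ge_sup; [exists (q 0%N), 0%N|move=> _ [m _ <-]; exact: qpmn].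
move: (sup _) Lub Llb => L Lub Llb [|n].
  rewrite mulr1 -u0; have := Lub 0%N; have := Llb 0%N; rewrite /p /q.
  move=> ? ?; rewrite ler_norml; apply/andP; split; lra.
have uL : `|u n - L| <= 2 * T / n.+2%:R.
  by rewrite ler_norml; have := Lub n; have := Llb n; rewrite /p /q; move: (_ / _) => Y *;
    apply/andP; split; lra.
have -> : a n.+1 - L * n.+2%:R = t n + n.+2%:R * (u n - L).
  by rewrite /u; move: (n.+2%:R) (n1 n.+1) => n' n'1; field; rewrite gt_eqF //; lra.
apply: le_trans (ler_normD _ _) _; rewrite normrM (ger0_norm (ler0n _ _)).
have := ler_wpM2l (ler0n R n.+2) uL; rewrite mulrCA divff ?pnatr_eq0 //.
by have := tT n; lra.
Qed.

(** The partial sums satisfy [(n + 1) S' = (n + 1 - 2 beta) S + O((n + 1) h)]. A linear bound of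
    slope [g] is preserved when [(1 + 2 beta) g = h], and [1 + 2 beta = sqrt 5]. Positivity of [N]
    ensures that [n + 1 - 2 beta] is nonnegative. *)
Lemma linear_recurrence_sum (x : nat -> R) (h : R) (N M : nat) : (0 < N)%N -> 0 <= h ->
  (forall n, (N <= n < M)%N ->
    `|n.+1%:R * x n.+1 + 2 * beta * \sum_(k < n.+1) x k| <= n.+1%:R * h) ->
  forall n, (N <= n <= M)%N ->
    `|\sum_(k < n.+1) x k| <= h / s5 * n.+1%:R + `|\sum_(k < N.+1) x k|.
Proof.
move=> N0 h0 Hx; have /andP[s1 s2] := sqrt5_bounds.
have s0 : 0 < s5 by lra.
have hs : 0 <= h / s5 by rewrite divr_ge0 // ltW.
elim=> [|n IHn] /andP[Nn nM]; first by rewrite leqNgt N0 in Nn.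
move: Nn; rewrite leq_eqVlt => /orP[/eqP->|Nn].
  by rewrite lerDr mulr_ge0.
have {IHn} := IHn _; rewrite -ltnS Nn (ltnW nM) => /(_ isT).
have {Hx} := Hx n; rewrite -[(N <= n)%N]ltnS Nn nM => /(_ isT).
rewrite [in X in _ -> _ -> is_true X]big_ord_recr /=.
move: (\sum_(k < n.+1) x k) `|\sum_(k < N.+1) x k| (normr_ge0 (\sum_(k < N.+1) x k)).
move=> S A A0 E IH.
have n1 : (2 : R) <= n.+1%:R by rewrite ler_nat; exact: leq_ltn_trans N0 Nn.
rewrite -[n.+2%:R]natr1; move: (n.+1%:R : R) (x n.+1) n1 E IH => n' y n1 E IH.
have n'0 : 0 < n' by lra.
rewrite -(@ler_pM2l _ n') // -[X in X * _ <= _](gtr0_norm n'0) -normrM.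
have -> : n' * (S + y) = (n' - 2 * beta) * S + (n' * y + 2 * beta * S) by ring.
apply: le_trans (ler_normD _ _) _; rewrite normrM (ger0_norm (x := n' - _)); last by lra.
have I1 : (n' - 2 * beta) * `|S| <= (n' - 2 * beta) * (h / s5 * n' + A).
  by apply: ler_wpM2l => //; lra.
have hE : h = s5 * (h / s5) by rewrite mulrC divfK // gt_eqF.
rewrite hE in E; apply: le_trans (lerD I1 E) _.
move: (h / s5) hs => g g0; rewrite -subr_ge0.
have -> : n' * (g * (n' + 1) + A) - ((n' - 2 * beta) * (g * n' + A) + n' * (s5 * g)) =
  2 * beta * A by field.
by rewrite mulr_ge0 //; lra.
Qed.

(** The constant bounds [1 + 2 beta / sqrt 5 = 2 - 1 / sqrt 5], about 1.553. *)
Lemma linear_recurrence_bound (x : nat -> R) (h A : R) (n : nat) : 0 <= A ->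
  `|n.+1%:R * x n.+1 + 2 * beta * \sum_(k < n.+1) x k| <= n.+1%:R * h ->
  `|\sum_(k < n.+1) x k| <= h / s5 * n.+1%:R + A ->
  `|x n.+1| <= (156 / 100) * h + 2 * A / n.+1%:R.
Proof.
move=> A0 E S; have /andP[s1 s2] := sqrt5_bounds.
have n1 : 1 <= n.+1%:R :> R by rewrite ler1n.
move: (n.+1%:R : R) n1 (x n.+1) (\sum_(k < n.+1) x k) E S => n' n1 y S E IH.
have n'0 : 0 < n' by lra.
have h0 : 0 <= h by rewrite -(pmulr_rge0 _ n'0); exact: le_trans (normr_ge0 _) E.
have g1 : h / s5 * (s5 - 1) <= 56 / 100 * h.
  have -> : h / s5 * (s5 - 1) = h * (1 - s5^-1) by field; rewrite gt_eqF //; lra.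
  rewrite mulrC; apply: ler_wpM2r => //; rewrite lerBlDl -lerBlDr.
  rewrite -(@ler_pM2r _ s5) ?mulVf ?gt_eqF //; lra.
rewrite -(@ler_pM2l _ n') // -[X in X * _ <= _](gtr0_norm n'0) -normrM.
have -> : n' * y = (n' * y + 2 * beta * S) - 2 * beta * S by ring.
apply: le_trans (ler_normB _ _) _.
rewrite (normrM (2 * beta) S) (ger0_norm (x := 2 * beta)); last by lra.
have I1 : 2 * beta * `|S| <= 2 * beta * (h / s5 * n' + A) by apply: ler_wpM2l => //; lra.
apply: le_trans (lerD E I1) _.
have -> : 2 * beta * (h / s5 * n' + A) = (h / s5 * (s5 - 1)) * n' + (s5 - 1) * A by field;
  rewrite gt_eqF //; lra.
have -> : n' * (156 / 100 * h + 2 * A / n') = n' * h + (56 / 100 * h) * n' + 2 * A by field;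
  rewrite gt_eqF.
have : h / s5 * (s5 - 1) * n' <= 56 / 100 * h * n' by apply: ler_wpM2r => //; lra.
have : (s5 - 1) * A <= 2 * A by apply: ler_wpM2r => //; lra.
move: (h / s5 * (s5 - 1) * n') => z; lra.
Qed.

Local Notation b := (@b_ R).
Local Notation cauchyp := (@cauchyp R).
(** [beta] is the positive root of [x^2 = 1 - x], the constant solution of [b_rec]. Subtracting it
    leaves a linear recurrence with a quadratic source. *)
Definition excess (n : nat) : R := b n - beta.

Lemma excess_rec n : n.+1%:R * excess n.+1 + 2 * beta * \sum_(k < n.+1) excess k = - cauchyp
  excess excess n.
Proof.
have s2 := sqrt5_sqr.
have E : cauchyp b b n = cauchyp excess excess n + 2 * beta * (\sum_(k < n.+1) excess k) +
  n.+1%:R * beta ^+ 2.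
  have -> : n.+1%:R * beta ^+ 2 = \sum_(k < n.+1) beta ^+ 2.
    by rewrite sumr_const card_ord mulr_natl.
  rewrite -[2 * beta]/(2 * ((s5 - 1) / 2)).
  have -> : 2 * ((s5 - 1) / 2) * (\sum_(k < n.+1) excess k) =
     \sum_(k < n.+1) beta * excess k + \sum_(k < n.+1) beta * excess (n - k)%N.
    rewrite [X in _ = _ + X](reindex_inj rev_ord_inj) /=.
    rewrite [X in _ = _ + X](eq_bigr (fun k : 'I_n.+1 => beta * excess k)) => [|k _].
      by rewrite -!mulr_sumr; field.
    by rewrite subSS subKn // -ltnS.
  by rewrite -!big_split; apply: eq_bigr => k _; rewrite /excess /=; ring.
have := b_rec R n; rewrite E {1}/excess.
have b2 : beta ^+ 2 = 1 - beta by field: s2.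
by rewrite mulrBr => ->; rewrite b2; ring.
Qed.

Lemma excess_bound n : `|excess n| <= 62 / 100.
Proof.
have /andP[s1 s2] := sqrt5_bounds.
have := b_ge0 R n; have := b_le1 R n; rewrite /excess => ? ?.
by rewrite ler_norml; apply/andP; split; lra.
Qed.

Lemma sum_ltn_nat (K n : nat) : \sum_(k < n) ((k < K)%N)%:R <= K%:R :> R.
Proof.
suff -> : \sum_(k < n) ((k < K)%N)%:R = (minn n K)%:R :> R.
  by rewrite ler_nat geq_minr.
elim: n => [|n IHn]; first by rewrite big_ord0 min0n.
rewrite big_ord_recr /= IHn -natrD; congr _%:R.
case: (ltnP n K) => nK; first by rewrite (minn_idPl nK) addn1.
by rewrite (minn_idPr (leqW nK)) addn0.
Qed.

Lemma sum_tail_bound (x : nat -> R) (rho : R) (K n : nat) : 0 <= rho ->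
  (forall k, `|x k| <= 1) -> (forall k, (K <= k)%N -> `|x k| <= rho) ->
  \sum_(k < n) `|x k| <= n%:R * rho + K%:R.
Proof.
move=> r0 x1 xK.
have -> : n%:R * rho = \sum_(k < n) rho by rewrite sumr_const card_ord mulr_natl.
apply: le_trans (lerD (lexx _) (sum_ltn_nat K n)); rewrite -big_split /=.
apply: ler_sum => k _; case: ltnP => kK; last by rewrite addr0; exact: xK.
by apply: le_trans (x1 k) _; rewrite lerDr.
Qed.

(** Both factors lie in the tail except for at most [2 K] indices, each contributing at most 1. *)
Lemma cauchyp_tail_bound (x : nat -> R) (rho : R) (K n : nat) : 0 <= rho ->
  (forall k, `|x k| <= 1) -> (forall k, (K <= k)%N -> `|x k| <= rho) ->
  `|cauchyp x x n| <= n.+1%:R * rho ^+ 2 + 2 * K%:R.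
Proof.
move=> r0 x1 xK; apply: le_trans (ler_norm_sum _ _ _) _.
have -> : n.+1%:R * rho ^+ 2 = \sum_(k < n.+1) rho ^+ 2 by rewrite sumr_const card_ord
  mulr_natl.
rewrite mulr_natl mulr2n addrA.
apply: le_trans (lerD (lerD (lexx _) (sum_ltn_nat K n.+1)) (sum_ltn_nat K n.+1)).
rewrite [X in _ <= _ + X](reindex_inj rev_ord_inj) /= -!big_split /=.
apply: ler_sum => k _; rewrite subSS normrM.
have H y z : 0 <= y -> y <= 1 -> 0 <= z -> z <= 1 -> y * z <= 1 :> R.
  by move=> *; rewrite -[1]mulr1; apply: ler_pM.
have r2 : 0 <= rho ^+ 2 by rewrite exprn_ge0.
case: (ltnP k K) => kK; first by have := H _ _ (normr_ge0 _) (x1 k) (normr_ge0 _) (x1 (n -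
  k)%N); case: (_ < K)%N => /=; lra.
case: (ltnP (n - k) K) => nK; first by have := H _ _ (normr_ge0 _) (x1 k) (normr_ge0 _) (x1
  (n - k)%N); rewrite /=; lra.
by rewrite !addr0 expr2; apply: ler_pM => //; exact: xK.
Qed.

(* Starting from 0.62, finitely many steps bring the excess below 0.23, small
   enough to close the induction of [c_bounded]. *)
Lemma excess_step (rho rho' : R) : 0 <= rho -> 156 / 100 * rho ^+ 2 < rho' ->
  (exists K, forall n, (K <= n)%N -> `|excess n| <= rho) ->
  exists K, forall n, (K <= n)%N -> `|excess n| <= rho'.
Proof.
move=> r0 rr' [K rK].
have x1 k : `|excess k| <= 1 by have := excess_bound k; lra.
pose del := (rho' - 156 / 100 * rho ^+ 2) / 4.
have del0 : 0 < del by rewrite /del; lra.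
have [N1 HN1] := eventually_le_nat (2 * K%:R / del).
pose N := N1.+1; pose h := rho ^+ 2 + del.
have h0 : 0 <= h by have : 0 <= rho ^+ 2 by [rewrite exprn_ge0]; rewrite /h; lra.
have HN n : (N <= n)%N -> `|n.+1%:R * excess n.+1 + 2 * beta * \sum_(k < n.+1) excess k| <=
  n.+1%:R * h.
  move=> Nn; rewrite excess_rec normrN; apply: le_trans (cauchyp_tail_bound n r0 x1 rK) _.
  rewrite mulrDr lerD2l -ler_pdivrMr //.
  by apply: HN1; exact: leqW (ltnW Nn).
pose A := `|\sum_(k < N.+1) excess k|.
have [N2 HN2] := eventually_le_nat (2 * A / del).
exists (maxn N N2).+1 => -[//|n]; rewrite ltnS geq_max => /andP[Nn N2n].
have S := linear_recurrence_sum (isT : (0 < N)%N) h0 (fun m Hm => HN m (proj1 (andP Hm))) (n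
  := n) (M := n).
have {S} := S _; rewrite Nn leqnn => /(_ isT) S.
have := linear_recurrence_bound (normr_ge0 _) (HN n Nn) S; rewrite -/A => E.
have : 2 * A / n.+1%:R <= del.
  by rewrite ler_pdivrMr // [del * _]mulrC -ler_pdivrMr //; apply: HN2; apply: leqW.
by move: E; move: (2 * A / _) => z; rewrite /h; move: rr'; rewrite /del;
  move: (rho ^+ 2) => r2; lra.
Qed.

Lemma excess_eventually_small : exists K, forall n, (K <= n)%N -> `|excess n| <= 23 / 100.
Proof.
(* Read from the bottom up, these are iterates of [rho -> 1.56 rho^2], slightly enlarged. Its
   repelling fixed point 1 / 1.56, about 0.641, lies above the initial 0.62, so they decrease. *)
apply: (@excess_step (250 / 1000)); [lra|lra|].
apply: (@excess_step (400 / 1000)); [lra|lra|].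
apply: (@excess_step (500 / 1000)); [lra|lra|].
apply: (@excess_step (565 / 1000)); [lra|lra|].
apply: (@excess_step (600 / 1000)); [lra|lra|].
apply: (@excess_step (620 / 1000)); [lra|lra|].
by exists 0%N => n _; apply: le_trans (excess_bound n) _; lra.
Qed.

Local Notation c := (@c_ R).
Local Notation d := (@d_ R).
Local Notation m := (@m_ R).

Lemma cauchyp_bound (x y : nat -> R) (A B : R) n :
  (forall k, (k <= n)%N -> `|x k| <= A) -> (forall k, (k <= n)%N -> `|y k| <= B) ->
  `|cauchyp x y n| <= n.+1%:R * (A * B).
Proof.
move=> xA yB; apply: le_trans (ler_norm_sum _ _ _) _.
have -> : n.+1%:R * (A * B) = \sum_(k < n.+1) (A * B) by rewrite sumr_const card_ord mulr_natl.
apply: ler_sum => k _; rewrite normrM; apply: ler_pM => //.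
  by apply: xA; rewrite -ltnS.
by apply: yB; exact: leq_subr.
Qed.

(** Strong induction on a bound [B]. With [b] split as [beta + excess], the source is at most
    [H + B / 2], and the amplification 1.56 turns this into [1.56 H + 0.78 B], which leaves room
    below [B]. *)
Lemma c_bounded (lam D : R) : (forall n, `|d lam n| <= D) -> exists A, forall n, `|c lam n|
  <= A.
Proof.
move=> dD.
have D0 : 0 <= D by apply: le_trans (dD 0%N).
have [K HK] := excess_eventually_small.
have x1 k : `|excess k| <= 1 by have := excess_bound k; lra.
have b1 k : `|b k| <= 1 by rewrite ger0_norm ?b_ge0 ?b_le1.
(* From here on [K / (n + 1)] is at most 0.02, and [2 (0.23 + 0.02) = 1 / 2]. *)
have [N1 HN1] := eventually_le_nat (50 * K%:R : R).
pose N := N1.+1; pose H := D + 1.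
have key n B : (N <= n)%N -> 0 <= B -> (forall k, (k <= n)%N -> `|c lam k| <= B) ->
    `|n.+1%:R * c lam n.+1 + 2 * beta * \sum_(k < n.+1) c lam k| <= n.+1%:R * (H + B / 2).
  move=> Nn B0 cB.
  have E : cauchyp (c lam) b n = cauchyp (c lam) excess n + beta * \sum_(k < n.+1) c lam k.
    by rewrite mulr_sumr -big_split /=; apply: eq_bigr => k _; rewrite /excess; ring.
  have -> : n.+1%:R * c lam n.+1 + 2 * beta * \sum_(k < n.+1) c lam k =
      n.+1%:R * d lam n.+1 - 2 * cauchyp (c lam) excess n - cauchyp b b n.
    by rewrite c_rec E; ring.
  have H1 : `|cauchyp (c lam) excess n| <= B * (n.+1%:R * (23 / 100) + K%:R).
    apply: le_trans (ler_norm_sum _ _ _) _.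
    have -> : \sum_(i < n.+1) `|c lam i * excess (n - i)%N| = \sum_(i < n.+1) `|c lam (n -
      i)%N| * `|excess i|.
      by rewrite (reindex_inj rev_ord_inj) /=; apply: eq_bigr => i _;
        rewrite subSS subKn ?normrM // -ltnS.
    apply: le_trans (_ : B * \sum_(i < n.+1) `|excess i| <= _).
      rewrite mulr_sumr; apply: ler_sum => i _; apply: ler_wpM2r => //.
      by apply: cB; exact: leq_subr.
    by apply: ler_wpM2l => //; apply: sum_tail_bound => //; lra.
  have H2 : 50 * K%:R <= n.+1%:R :> R by apply: HN1; exact: leqW (ltnW Nn).
  have H3 := @cauchyp_bound b b 1 1 n (fun k _ => b1 k) (fun k _ => b1 k).
  have H4 : `|n.+1%:R * d lam n.+1| <= n.+1%:R * D.
    by rewrite normrM ger0_norm // ler_wpM2l.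
  apply: le_trans (ler_normB _ _) _; apply: le_trans (lerD (ler_normB _ _) (lexx _)) _.
  rewrite (normrM 2) (ger0_norm (x := 2)) //.
  apply: le_trans (lerD (lerD H4 (ler_wpM2l _ H1)) H3) _ => //.
  have : B * K%:R <= B * (n.+1%:R / 50) by apply: ler_wpM2l => //; lra.
  by rewrite /H; move: (n.+1%:R) (K%:R) => n' k'; rewrite -subr_ge0 => BK; nra.
pose A := `|\sum_(k < N.+1) c lam k|.
have A0 : 0 <= A by exact: normr_ge0.
(* The induction needs [1.56 H + 2 A <= 0.22 B]; the factor 10 suffices. The sum covers the finitely
   many initial terms. *)
pose B := \sum_(k < N.+1) `|c lam k| + 10 * (H + A).
have S0 : 0 <= \sum_(k < N.+1) `|c lam k| by apply: sumr_ge0.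
have B0 : 0 <= B by rewrite /B /H; lra.
exists B; elim/ltn_ind => n IHn.
have [nN|Nn] := leqP n N.
  apply: le_trans (_ : \sum_(k < N.+1) `|c lam k| <= _); last by rewrite /B /H; lra.
  by rewrite (bigD1 (inord n)) //= inordK // lerDl; apply: sumr_ge0.
case: n Nn IHn => // n; rewrite ltnS => Nn IHn.
have HB0 : 0 <= H + B / 2 by rewrite /H; lra.
have key' j : (N <= j < n)%N -> `|j.+1%:R * c lam j.+1 + 2 * beta * \sum_(k < j.+1) c lam k|
  <= j.+1%:R * (H + B / 2).
  move=> /andP[Nj jn]; apply: key => // k kj; apply: IHn.
  by rewrite ltnS; apply: leq_trans kj _; exact: ltnW.
have := linear_recurrence_sum (isT : (0 < N)%N) HB0 key' (n := n).
rewrite Nn leqnn => /(_ isT) SS.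
have E := key n B Nn B0 (fun k kn => IHn k (kn : (k < n.+1)%N)).
have := linear_recurrence_bound A0 E SS.
have : 2 * A / n.+1%:R <= 2 * A.
  by rewrite ler_pdivrMr // ler_peMr ?ler1n // mulr_ge0.
move: (2 * A / n.+1%:R) => z; move: S0 HB0 B0; rewrite /B /H.
by move: (\sum_(k < N.+1) _) => S'; lra.
Qed.

Lemma moments_asymptotics : exists lam K A : R,
  [/\ forall n, `|d lam n| <= A, forall n, `|c lam n| <= A &
      forall n, `|m lam n - K * n.+1%:R| <= A].
Proof.
have b1 k : `|b k| <= 1 by rewrite ger0_norm ?b_ge0 ?b_le1.
have n1 n : n.+1%:R != 0 :> R by rewrite pnatr_eq0.
have bb n : `|cauchyp b b n / n.+1%:R| <= 1.
  rewrite normrM normfV (@ger0_norm _ n.+1%:R) // ler_pdivrMr // mul1r.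
  by have := @cauchyp_bound b b 1 1 n (fun k _ => b1 k) (fun k _ => b1 k); rewrite !mulr1.
pose t n := 2 * (cauchyp b b n / n.+1%:R) - 1.
(* With no centering, the slope found here is the growth rate of the mean nullity; centering by it
   leaves the bound [3 * 3]. *)
have [||lam Hlam] := @additive_recurrence (d 0) t 3.
- by move=> n; have := bb n; rewrite /t; move: (_ / _) => z;
  rewrite !ler_norml => /andP[? ?]; apply/andP; split; lra.
- by move=> n; rewrite d_rec /t; field.
have dD n : `|d lam n| <= 9 by rewrite d_shift; apply: le_trans (Hlam n) _; lra.
have [C HC] := c_bounded dD.
have C0 : 0 <= C by apply: le_trans (HC 0%N).
pose u n := (2 * cauchyp (d lam) (d lam) n + 8 * cauchyp (c lam) b n - 4 * \sum_(k < n.+1) d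
  lam k) / n.+1%:R + 1.
have [||K HK] := @additive_recurrence (m lam) u (2 * 81 + 8 * C + 36 + 1).
- move=> n; rewrite /u.
  have H1 := @cauchyp_bound (d lam) (d lam) 9 9 n (fun k _ => dD k) (fun k _ => dD k).
  have H2 := @cauchyp_bound (c lam) b C 1 n (fun k _ => HC k) (fun k _ => b1 k).
  have H3 : `|\sum_(k < n.+1) d lam k| <= n.+1%:R * 9.
    apply: le_trans (ler_norm_sum _ _ _) _.
    have -> : n.+1%:R * 9 = \sum_(k < n.+1) (9 : R) by rewrite sumr_const card_ord mulr_natl.
    by apply: ler_sum => k _.
  apply: le_trans (ler_normD _ _) _; rewrite normr1 lerD2r.
  rewrite normrM normfV (@ger0_norm _ n.+1%:R) // ler_pdivrMr //.
  move: H1 H2 H3; rewrite !ler_norml => /andP[? ?] /andP[? ?] /andP[? ?].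
  by apply/andP; split; nra.
- by move=> n; rewrite m_rec /u; field.
exists lam, K, (9 + C + 3 * (2 * 81 + 8 * C + 36 + 1)); split => n.
- by apply: le_trans (dD n) _; lra.
- by apply: le_trans (HC n) _; lra.
- by apply: le_trans (HK n) _; lra.
Qed.

End Asymptotics.

(** * Integer polynomials over Z[sqrt 5] *)

Section IntegerPolynomials.
Variable R : realType.
Local Notation s5 := (Num.sqrt 5 : R).

(* Locked, so that no unary integer is ever computed by unification. *)
Definition Zr (z : Z) : R := (locked int_of_Z z)%:~R.

Lemma ZrD a b : Zr (Z.add a b) = Zr a + Zr b.
Proof. by rewrite /Zr -lock -[Z.add a b]/(a + b) rmorphD rmorphD. Qed.

Lemma ZrN a : Zr (Z.opp a) = - Zr a.
Proof. by rewrite /Zr -lock -[Z.opp a]/(- a) rmorphN rmorphN. Qed.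

Lemma ZrM a b : Zr (Z.mul a b) = Zr a * Zr b.
Proof. by rewrite /Zr -lock -[Z.mul a b]/(a * b) rmorphM rmorphM. Qed.

Lemma Zr_ge0 a : Z.leb Z0 a -> 0 <= Zr a.
Proof. by case: a => [|p|p] //= _; rewrite /Zr -lock /= ?ler0z. Qed.

Lemma ler_Zr a b : Z.leb a b -> Zr a <= Zr b.
Proof.
move=> ab; rewrite -subr_ge0 -ZrN -ZrD; apply: Zr_ge0.
by apply/Z.leb_le; move/Z.leb_le: ab; lia.
Qed.

Lemma Zr_abs a : Zr (Z.abs a) = `|Zr a|.
Proof.
case: a => [|p|p] /=; first by rewrite /Zr -lock normr0.
- by rewrite ger0_norm // Zr_ge0.
- by rewrite -[Z.neg p]/(Z.opp (Z.pos p)) ZrN normrN ger0_norm // Zr_ge0.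
Qed.

(* [(a, b)] stands for a + b sqrt 5. *)
Definition zs := (Z * Z)%type.
Definition zs_val (x : zs) : R := Zr x.1 + Zr x.2 * s5.
Definition zs_add (x y : zs) : zs := (Z.add x.1 y.1, Z.add x.2 y.2).
Definition zs_mul (x y : zs) : zs :=
  (Z.add (Z.mul x.1 y.1) (Z.mul 5 (Z.mul x.2 y.2)), Z.add (Z.mul x.1 y.2) (Z.mul x.2 y.1)).

Lemma zs_valD x y : zs_val (zs_add x y) = zs_val x + zs_val y.
Proof. by rewrite /zs_val !ZrD; ring. Qed.

Lemma Zr1 : Zr 1 = 1. Proof. by rewrite /Zr -lock. Qed.

Lemma Zr5 : Zr 5 = 5. Proof. by rewrite /Zr -lock. Qed.

Lemma zs_valM x y : zs_val (zs_mul x y) = zs_val x * zs_val y.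
Proof.
have s2 := sqrt5_sqr R.
by rewrite /zs_val !ZrD !ZrM Zr5; ring: s2.
Qed.

Fixpoint peval (l : seq zs) (w : R) : R :=
  if l is x :: l' then zs_val x + w * peval l' w else 0.

Fixpoint padd (l m : seq zs) : seq zs :=
  match l, m with
  | [::], _ => m
  | _, [::] => l
  | x :: l', y :: m' => zs_add x y :: padd l' m'
  end.

Definition pscale (c : zs) (l : seq zs) := [seq zs_mul c x | x <- l].

Fixpoint pmul (l m : seq zs) : seq zs :=
  if l is x :: l' then padd (pscale x m) ((Z0, Z0) :: pmul l' m) else [::].

Lemma peval_add l m w : peval (padd l m) w = peval l w + peval m w.
Proof.
elim: l m => [|x l IHl] [|y m] /=; rewrite ?add0r ?addr0 //.
by rewrite zs_valD IHl; ring.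
Qed.

Lemma peval_scale c l w : peval (pscale c l) w = zs_val c * peval l w.
Proof.
by elim: l => [|x l IHl] /=; [rewrite mulr0|rewrite zs_valM IHl; ring].
Qed.

Lemma zs_val0 : zs_val (Z0, Z0) = 0.
Proof. by rewrite /zs_val /Zr -lock /= mul0r addr0. Qed.

Lemma peval_mul l m w : peval (pmul l m) w = peval l w * peval m w.
Proof.
elim: l => [|x l IHl] /=; first by rewrite mul0r.
by rewrite peval_add /= peval_scale IHl zs_val0; ring.
Qed.

(** The operator [c + sqrt 5 w d/dw], which multiplies the k-th coefficient by [c + k sqrt 5]. It is
    what differentiation in x becomes for functions of [w = (1 - x)^(sqrt 5)] times a power of
    [1 - x]. *)
Fixpoint ptheta (c : zs) (l : seq zs) : seq zs :=
  if l is x :: l' then zs_mul c x :: ptheta (zs_add c (Z0, Zpos xH)) l' else [::].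

Fixpoint pderiv (l : seq zs) (w : R) : R :=
  if l is x :: l' then peval l' w + w * pderiv l' w else 0.

Lemma peval_theta c l w :
  peval (ptheta c l) w = zs_val c * peval l w + s5 * w * pderiv l w.
Proof.
elim: l c => [|x l IHl] c /=; first by rewrite !mulr0 addr0.
rewrite zs_valM IHl zs_valD.
have -> : zs_val (Z0, Zpos xH) = s5 by rewrite /zs_val /Zr -lock /= add0r mul1r.
by ring.
Qed.

Definition sqrt5_digits : Z := 2236067977499789%coqZ.

Lemma Zr_pow10 n : Zr (Z.pow 10 (Z.of_nat n)) = 10 ^+ n.
Proof.
elim: n => [|n IHn]; first by rewrite /Zr -lock.
have Z10 : Zr 10 = 10 by rewrite /Zr -lock.
by rewrite Nat2Z.inj_succ Z.pow_succ_r ?ZrM ?IHn ?exprS ?Z10 //; exact: Nat2Z.is_nonneg.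
Qed.

Lemma sqrt5_approx : Zr sqrt5_digits <= 10 ^+ 15 * s5 <= Zr sqrt5_digits + 1.
Proof.
have s2 := sqrt5_sqr R; have s0 : 0 <= s5 by exact: sqrtr_ge0.
have T0 : 0 < (10 : R) ^+ 15 by rewrite exprn_gt0.
have d0 : 0 <= Zr sqrt5_digits by apply: Zr_ge0.
have E : (10 ^+ 15 * s5) ^+ 2 = Zr (Z.mul 5 (Z.mul (Z.pow 10 (Z.of_nat 15)) (Z.pow 10
  (Z.of_nat 15)))).
  by rewrite ZrM ZrM Zr5 (Zr_pow10 15) exprMn s2; ring.
have p0 : 0 <= 10 ^+ 15 * s5 by rewrite mulr_ge0 // ltW.
apply/andP; split.
  rewrite -(@ler_pXn2r _ 2) ?nnegrE // E expr2 -ZrM.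
  by apply: ler_Zr; vm_compute.
have e1 : Zr sqrt5_digits + 1 = Zr (Z.add sqrt5_digits 1) by rewrite ZrD Zr1.
rewrite e1 -(@ler_pXn2r _ 2) ?nnegrE //; last by apply: Zr_ge0.
by rewrite E expr2 -ZrM; apply: ler_Zr; vm_compute.
Qed.

(** Adding the rational part and the approximated irrational part before taking absolute values
    keeps their cancellation; the last term covers the error of [sqrt5_digits]. *)
Definition zs_bound (x : zs) : Z :=
  Z.add (Z.abs (Z.add (Z.mul (Z.pow 10 (Z.of_nat 15)) x.1) (Z.mul x.2 sqrt5_digits))) (Z.abs
    x.2).

Lemma zs_boundP x : 10 ^+ 15 * `|zs_val x| <= Zr (zs_bound x).
Proof.
have T0 : 0 <= (10 : R) ^+ 15 by rewrite exprn_ge0.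
rewrite /zs_bound ZrD !Zr_abs ZrD 2!ZrM (Zr_pow10 15).
rewrite -[X in X * _](ger0_norm T0) -normrM /zs_val mulrDr.
have -> : 10 ^+ 15 * Zr x.1 + 10 ^+ 15 * (Zr x.2 * s5) =
  10 ^+ 15 * Zr x.1 + Zr x.2 * Zr sqrt5_digits + Zr x.2 * (10 ^+ 15 * s5 - Zr sqrt5_digits)
    by ring.
apply: le_trans (ler_normD _ _) _; rewrite lerD2l normrM ler_piMr //.
have /andP[h1 h2] := sqrt5_approx.
by rewrite ger0_norm ?subr_ge0 // lerBlDl.
Qed.

Definition pbound (l : seq zs) : Z := foldr (fun x z => Z.add (zs_bound x) z) Z0 l.

Lemma pboundP l w : 0 <= w <= 1 -> 10 ^+ 15 * `|peval l w| <= Zr (pbound l).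
Proof.
have T0 : 0 <= (10 : R) ^+ 15 by rewrite exprn_ge0.
move=> /andP[w0 w1]; elim: l => [|x l IHl] /=; first by rewrite normr0 mulr0 Zr_ge0.
rewrite ZrD; apply: le_trans (lerD (zs_boundP x) IHl); rewrite -mulrDr.
apply: ler_wpM2l => //; apply: le_trans (ler_normD _ _) _.
by rewrite lerD2l normrM (ger0_norm w0) ler_piMl.
Qed.

Lemma pbound_le l (n : nat) w : 0 <= w <= 1 ->
  Z.leb (pbound l) (Z.pow 10 (Z.of_nat (n + 15))) -> `|peval l w| <= 10 ^+ n.
Proof.
move=> w01 /ler_Zr; rewrite Zr_pow10 exprD => h.
have T0 : 0 < (10 : R) ^+ 15 by rewrite exprn_gt0.
by rewrite -(@ler_pM2l _ (10 ^+ 15)) // [X in _ <= X]mulrC; apply: le_trans (pboundP l w01) h.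
Qed.

Definition zs_total (l : seq zs) : zs := foldr zs_add (Z0, Z0) l.

Lemma peval1 l : peval l 1 = zs_val (zs_total l).
Proof. by elim: l => [|x l IHl] /=; rewrite ?zs_val0 // zs_valD mul1r IHl. Qed.

End IntegerPolynomials.

(** * Generating functions *)

Section PowerSeries.
Variable R : realType.
Local Notation cauchyp := (@cauchyp R).

Definition tame (a : nat -> R) := forall x, `|x| < 1 -> cvgn (pseries a x).

Lemma pseriesE a x n : pseries a x n = \sum_(k < n) a k * x ^+ k :> R.
Proof. by rewrite /pseries /series /= big_mkord. Qed.

Lemma triangular_sum (f : nat -> nat -> R) N :
  \sum_(n < N) \sum_(k < n.+1) f k (n - k)%N = \sum_(i < N) \sum_(j < N - i) f i j.
Proof.
elim: N => [|N IHN]; first by rewrite !big_ord0.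
rewrite big_ord_recr /= IHN [RHS]big_ord_recr /= subSn // subnn big_ord1.
rewrite [in RHS](eq_bigr (fun i : 'I_N => \sum_(j < N - i) f i j + f i (N - i)%N)) => [|i _];
  last first.
  by rewrite subSn ?big_ord_recr // ltnW.
by rewrite big_split /= -addrA; congr (_ + _); rewrite big_ord_recr /= subnn.
Qed.

Lemma tame_norm a x : tame a -> `|x| < 1 -> cvgn (series (fun i => `|a i * x ^+ i|)).
Proof.
move=> ta x1; pose K := (1 + `|x|) / 2.
have K0 : 0 <= K by rewrite /K; have := normr_ge0 x; lra.
have xK : `|x| < `|K| by rewrite (ger0_norm K0) /K; lra.
have K1 : `|K| < 1 by rewrite (ger0_norm K0) /K; lra.
have := @is_cvg_pseries_inside_norm R a K `|x| (ta _ K1).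
rewrite normr_id => /(_ xK); rewrite /pseries (_ : (fun i => _) = (fun i => `|a i * x ^+ i|))
  //.
by apply/funext => i /=; rewrite normrM normrX.
Qed.

(** The triangle [i + j < N] lies between the squares of sides N / 2 and N. For absolute values both
    squares have the same limit, so the part of the large square outside the triangle vanishes, and
    it dominates the difference of the signed sums. *)
Lemma cvg_pseries_cauchyp a b x : tame a -> tame b -> `|x| < 1 ->
  pseries (cauchyp a b) x @ \oo --> limn (pseries a x) * limn (pseries b x).
Proof.
move=> ta tb x1.
pose u i := a i * x ^+ i; pose v i := b i * x ^+ i.
have PE N : pseries (cauchyp a b) x N = \sum_(i < N) \sum_(j < N - i) u i * v j.
  rewrite pseriesE -(triangular_sum (fun i j => u i * v j)).
  apply: eq_bigr => n _; rewrite mulr_suml; apply: eq_bigr => k _.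
  have kn : (k <= n)%N by rewrite -ltnS.
  have -> : x ^+ n = x ^+ k * x ^+ (n - k) by rewrite -exprD subnKC.
  by rewrite /u /v; ring.
pose A' N := series (fun i => `|u i|) N; pose B' N := series (fun i => `|v i|) N.
pose C' N := \sum_(i < N) \sum_(j < N - i) `|u i| * `|v j|.
have A'E N : A' N = \sum_(i < N) `|u i| by rewrite /A' /series /= big_mkord.
have B'E N : B' N = \sum_(i < N) `|v i| by rewrite /B' /series /= big_mkord.
have cA : cvgn A' by exact: tame_norm.
have cB : cvgn B' by exact: tame_norm.
have sub_sum (f : nat -> R) m n : (forall i, 0 <= f i) -> (m <= n)%N ->
    \sum_(i < m) f i <= \sum_(i < n) f i.
  move=> f0 mn; rewrite -(subnKC mn) big_split_ord /= lerDl.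
  by apply: sumr_ge0.
have prodE (f g : nat -> R) m n : (\sum_(i < m) f i) * (\sum_(j < n) g j) =
    \sum_(i < m) \sum_(j < n) f i * g j.
  by rewrite mulr_suml; apply: eq_bigr => i _; rewrite mulr_sumr.
have uv0 i j : 0 <= `|u i| * `|v j| by rewrite mulr_ge0.
have CU N : C' N <= A' N * B' N.
  rewrite A'E B'E (prodE (fun i => `|u i|) (fun j => `|v j|)); apply: ler_sum => i _.
  by apply: (sub_sum (fun j => `|u i| * `|v j|)) => //; exact: leq_subr.
have CL N : A' N./2 * B' N./2 <= C' N.
  rewrite A'E B'E (prodE (fun i => `|u i|) (fun j => `|v j|)) /C'.
  have h2 : (N./2 + N./2 <= N)%N by rewrite addnn -{2}(odd_double_half N) leq_addl.
  have hN : (N./2 <= N)%N by exact: leq_trans (leq_addl _ _) h2.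
  apply: le_trans (sub_sum (fun i => \sum_(j < N - i) `|u i| * `|v j|) _ _ _ hN); last first.
    by move=> i; apply: sumr_ge0.
  apply: ler_sum => i _; apply: (sub_sum (fun j => `|u i| * `|v j|)) => //.
  rewrite leq_subRL; last by apply: leq_trans hN; exact: ltnW.
  by apply: leq_trans h2; rewrite leq_add2r ltnW.
have half : (N./2 @[N --> \oo] --> \oo)%N.
  apply/cvgnyPge => M; near=> N.
  have : (M.*2 <= N)%N by near: N; exact: nbhs_infty_ge.
  by move=> /half_leq; rewrite doubleK.
have cAB : A' N * B' N @[N --> \oo] --> limn A' * limn B' by apply: cvgM.
have cAB2 : A' N./2 * B' N./2 @[N --> \oo] --> limn A' * limn B'.
  exact: (cvg_comp _ _ half cAB).
have cC : C' @ \oo --> limn A' * limn B'.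
  apply: squeeze_cvgr cAB2 cAB; near=> N.
  by rewrite CU CL.
have cD : (A' N * B' N - C' N) @[N --> \oo] --> (0 : R).
  by rewrite -[0](subrr (limn A' * limn B')); apply: cvgB.
have D N : `|pseries a x N * pseries b x N - pseries (cauchyp a b) x N| <= A' N * B' N - C' N.
  rewrite PE !pseriesE A'E B'E (prodE u v) (prodE (fun i => `|u i|) (fun j => `|v j|)) /C'
    -!sumrB.
  apply: le_trans (ler_norm_sum _ _ _) _; apply: ler_sum => i _.
  have spl (f : nat -> R) : \sum_(j < N) f j - \sum_(j < N - i) f j = \sum_(j < i) f (N - i +
    j)%N.
    have spl0 p q : \sum_(j < p + q) f j - \sum_(j < p) f j = \sum_(j < q) f (p + j)%N.
      by rewrite big_split_ord /= addrAC subrr add0r.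
    by rewrite -(spl0 (N - i)%N i) subnK // ltnW.
  rewrite (spl (fun j => u i * v j)) (spl (fun j => `|u i| * `|v j|)).
  by apply: le_trans (ler_norm_sum _ _ _) _; apply: ler_sum => j _; rewrite normrM.
have cE : (pseries a x N * pseries b x N - pseries (cauchyp a b) x N) @[N --> \oo] --> (0 : R).
  have cst0 : (fun=> 0) @ \oo --> (0 : R) by exact: cvg_cst.
  apply: norm_cvg0.
  apply: (squeeze_cvgr (f := fun=> 0) (h := fun N => A' N * B' N - C' N)) => //.
  by near=> N; rewrite normr_ge0 D.
have cab : (pseries a x N * pseries b x N) @[N --> \oo] --> limn (pseries a x) * limn
  (pseries b x).
  by apply: cvgM; [exact: ta|exact: tb].
have -> : pseries (cauchyp a b) x = (fun N => pseries a x N * pseries b x N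
    - (pseries a x N * pseries b x N - pseries (cauchyp a b) x N)).
  by apply/funext => N; rewrite opprB addrC subrK.
rewrite -[X in _ --> X]subr0; exact: cvgB cab cE.
Unshelve. all: by end_near. Qed.

Lemma tame_cauchyp a b : tame a -> tame b -> tame (cauchyp a b).
Proof. by move=> ta tb x x1; apply/cvg_ex; exists (limn (pseries a x) * limn (pseries b x));
  exact: cvg_pseries_cauchyp. Qed.

Definition psum (a : nat -> R) (x : R) : R := limn (pseries a x).

Lemma psum_cauchyp a b x : tame a -> tame b -> `|x| < 1 ->
  psum (cauchyp a b) x = psum a x * psum b x.
Proof. by move=> ta tb x1; apply: cvg_lim => //; exact: cvg_pseries_cauchyp. Qed.

Lemma pseriesD (a b : nat -> R) x : pseries (fun n => a n + b n) x = (fun n => pseries a x n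
  + pseries b x n).
Proof.
by apply/funext => n; rewrite !pseriesE -big_split; apply: eq_bigr => k _; rewrite mulrDl.
Qed.

Lemma pseriesZ c (a : nat -> R) x : pseries (fun n => c * a n) x = (fun n => c * pseries a x n).
Proof.
by apply/funext => n; rewrite !pseriesE mulr_sumr; apply: eq_bigr => k _; rewrite mulrA.
Qed.

Lemma tameD a b : tame a -> tame b -> tame (fun n => a n + b n).
Proof. by move=> ta tb x x1; rewrite pseriesD; apply: is_cvgD; [exact: ta|exact: tb]. Qed.

Lemma tameZ c a : tame a -> tame (fun n => c * a n).
Proof. by move=> ta x x1; rewrite pseriesZ; apply: is_cvgM; [exact: is_cvg_cst|exact: ta]. Qed.

Lemma psumD a b x : tame a -> tame b -> `|x| < 1 ->
  psum (fun n => a n + b n) x = psum a x + psum b x.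
Proof. by move=> ta tb x1; rewrite /psum pseriesD limD //; [exact: ta|exact: tb]. Qed.

Lemma psumZ c a x : tame a -> `|x| < 1 -> psum (fun n => c * a n) x = c * psum a x.
Proof.
move=> ta x1; rewrite /psum pseriesZ; apply: cvg_lim => //.
by apply: cvgM; [exact: cvg_cst|exact: ta].
Qed.

Lemma tame_dom (a b : nat -> R) : (forall n, `|a n| <= b n) -> tame b -> tame a.
Proof.
move=> ab tb x x1; apply: normed_cvg; rewrite /normed_series_of /=.
apply: series_le_cvg (tb `|x| _); rewrite ?normr_id //= => n.
- by rewrite mulr_ge0 ?exprn_ge0 //; exact: le_trans (normr_ge0 _) (ab n).
- by rewrite normrM normrX ler_wpM2r ?exprn_ge0.
Qed.

Lemma cvg_pseries1 x : `|x| < 1 -> pseries (fun=> 1 : R) x @ \oo --> (1 - x)^-1.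
Proof.
move=> x1; have := @cvg_geometric_series R 1 x x1; rewrite mul1r.
by rewrite /pseries; congr (_ --> _); congr (_ @ _).
Qed.

Lemma tame1 : tame (fun=> 1).
Proof. by move=> x x1; apply/cvg_ex; exists (1 - x)^-1; exact: cvg_pseries1. Qed.

Lemma psum1 x : `|x| < 1 -> psum (fun=> 1) x = (1 - x)^-1.
Proof. by move=> x1; apply: cvg_lim => //; exact: cvg_pseries1. Qed.

Lemma tame_bounded (a : nat -> R) A : (forall n, `|a n| <= A) -> tame a.
Proof.
move=> aA; apply: (@tame_dom _ (fun=> A * 1)); first by move=> n; rewrite mulr1.
by apply: tameZ; exact: tame1.
Qed.

Lemma cauchyp_cst1 a n : cauchyp a (fun=> 1) n = \sum_(k < n.+1) a k.
Proof. by apply: eq_bigr => k _; rewrite mulr1. Qed.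

Lemma succ_cauchyp : (fun n => n.+1%:R) = cauchyp (fun=> 1) (fun=> 1).
Proof. by apply/funext => n; rewrite cauchyp_cst1 sumr_const card_ord. Qed.

Lemma tame_succ : tame (fun n => n.+1%:R).
Proof. by rewrite succ_cauchyp; apply: tame_cauchyp; exact: tame1. Qed.

Lemma psum_succ x : `|x| < 1 -> psum (fun n => n.+1%:R) x = (1 - x) ^- 2.
Proof.
move=> x1; rewrite succ_cauchyp psum_cauchyp ?psum1 //; try exact: tame1.
by rewrite -expr2 exprVn.
Qed.

Lemma tame_partial_sums a : tame a -> tame (fun n => \sum_(k < n.+1) a k).
Proof.
move=> ta; rewrite (_ : (fun n => _) = cauchyp a (fun=> 1)); last by apply/funext => n;
  rewrite cauchyp_cst1.
by apply: tame_cauchyp => //; exact: tame1.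
Qed.

Lemma psum_partial_sums a x : tame a -> `|x| < 1 ->
  psum (fun n => \sum_(k < n.+1) a k) x = psum a x / (1 - x).
Proof.
move=> ta x1; rewrite (_ : (fun n => _) = cauchyp a (fun=> 1)); last by apply/funext => n;
  rewrite cauchyp_cst1.
by rewrite psum_cauchyp ?psum1 //; exact: tame1.
Qed.

Lemma psum0 a : psum a 0 = a 0%N.
Proof.
apply: cvg_lim => //; apply/cvgrPdist_le => e e0; near=> n.
have n0 : (0 < n)%N by near: n; exact: nbhs_infty_gt.
rewrite pseriesE -(prednK n0) big_ord_recl expr0 mulr1 big1 ?addr0 ?subrr ?normr0 ?ltW // =>
  i _.
by rewrite expr0n mulr0.
Unshelve. all: by end_near. Qed.

Lemma psum_bound a A x : (forall n, `|a n| <= A) -> 0 <= x < 1 -> `|psum a x| <= A / (1 - x).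
Proof.
move=> aA /andP[x0 x1]; have x1' : `|x| < 1 by rewrite ger0_norm.
have A0 : 0 <= A by apply: le_trans (aA 0%N).
have cv : (fun n => `|pseries a x n|) @ \oo --> `|psum a x|.
  by apply: cvg_norm; exact: (tame_bounded aA).
rewrite -(cvg_lim _ cv) //; apply: limr_le; first by apply/cvg_ex; exists `|psum a x|.
near=> n; rewrite pseriesE; apply: le_trans (ler_norm_sum _ _ _) _.
apply: le_trans (_ : \sum_(i < n) A * x ^+ i <= _).
  by apply: ler_sum => i _; rewrite normrM normrX (ger0_norm x0) ler_wpM2r ?exprn_ge0.
rewrite -mulr_sumr ler_wpM2l // -[_^-1]mul1r ler_pdivlMr ?subr_gt0 // mulrC.
have := subrX1 x n; have : 0 <= x ^+ n by exact: exprn_ge0.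
move: (x ^+ n) (\sum_(i < n) _) => y S; nra.
Unshelve. all: by end_near. Qed.

(** With [K] strictly between [|x|] and 1, the terms [a_n K^n] are bounded, and the derived series
    is dominated by a multiple of [(n + 1) (|x| / K)^n]. *)
Lemma tame_diffs a : tame a -> tame (pseries_diffs a).
Proof.
move=> ta x x1; pose K := (1 + `|x|) / 2.
have x0 := normr_ge0 x.
have K0 : 0 < K by rewrite /K; lra.
have K1 : `|K| < 1 by rewrite (gtr0_norm K0) /K; lra.
have [M [Mreal HM]] := cvg_series_bounded (ta _ K1).
have bd n : `|a n * K ^+ n| <= `|M + 1|.
  by apply: HM => //; rewrite (lt_le_trans _ (ler_norm _)) // ltrDl.
have q1 : `|(`|x| / K)| < 1.
  have q0 : 0 <= `|x| / K by rewrite divr_ge0 // ltW.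
  by rewrite (ger0_norm q0) ltr_pdivrMr // mul1r /K; lra.
have ts := @tameZ (`|M + 1| / K) _ tame_succ.
apply: normed_cvg; rewrite /normed_series_of /=.
apply: series_le_cvg (ts _ q1) => //= n.
- by rewrite !mulr_ge0 ?exprn_ge0 ?invr_ge0 ?divr_ge0 // ltW.
rewrite /pseries_diffs !normrM normrX (ger0_norm (ler0n _ _)).
have -> : `|a n.+1| = `|a n.+1 * K ^+ n.+1| / K ^+ n.+1.
  by rewrite normrM normrX (gtr0_norm K0) mulfK // gt_eqF ?exprn_gt0.
have -> : `|M + 1| / K * n.+1%:R * (`|x| / K) ^+ n = n.+1%:R * (`|M + 1| / K ^+ n.+1) * `|x|
  ^+ n.
  by rewrite exprMn exprVn exprS; field; rewrite !gt_eqF ?exprn_gt0.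
by rewrite ler_wpM2r ?exprn_ge0 // ler_wpM2l // ler_wpM2r // invr_ge0 exprn_ge0 // ltW.
Qed.

Lemma is_derive_psum a (x : R) : tame a -> `|x| < 1 ->
  is_derive x (1 : R) (psum a) (psum (pseries_diffs a) x).
Proof.
move=> ta x1; pose K := (1 + `|x|) / 2.
have x0 := normr_ge0 x.
have K0 : 0 < K by rewrite /K; lra.
have K1 : `|K| < 1 by rewrite (gtr0_norm K0) /K; lra.
apply: (@pseries_snd_diffs _ _ K).
- exact: ta.
- exact: tame_diffs.
- by apply: tame_diffs => //; exact: tame_diffs.
- by rewrite (gtr0_norm K0) /K; lra.
Qed.

(** Convergence and value travel together, so that the generating function of a whole recursion is
    assembled by a single term. *)
Definition is_psum a x l := tame a /\ psum a x = l.

Lemma is_psumP a x : tame a -> is_psum a x (psum a x). Proof. by []. Qed.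

Lemma is_psumD x a b l l' : `|x| < 1 -> is_psum a x l -> is_psum b x l' ->
  is_psum (fun n => a n + b n) x (l + l').
Proof. by move=> x1 [ta <-] [tb <-]; split; [exact: tameD|exact: psumD]. Qed.

Lemma is_psumZ x c a l : `|x| < 1 -> is_psum a x l -> is_psum (fun n => c * a n) x (c * l).
Proof. by move=> x1 [ta <-]; split; [exact: tameZ|exact: psumZ]. Qed.

Lemma is_psum_cauchyp x a b l l' : `|x| < 1 -> is_psum a x l -> is_psum b x l' ->
  is_psum (cauchyp a b) x (l * l').
Proof. by move=> x1 [ta <-] [tb <-]; split; [exact: tame_cauchyp|exact: psum_cauchyp]. Qed.

Lemma is_psum_partial_sums x a l : `|x| < 1 -> is_psum a x l ->
  is_psum (fun n => \sum_(k < n.+1) a k) x (l / (1 - x)).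
Proof. by move=> x1 [ta <-]; split; [exact: tame_partial_sums|exact: psum_partial_sums]. Qed.

Lemma is_psum_succ x : `|x| < 1 -> is_psum (fun n => n.+1%:R) x ((1 - x) ^- 2).
Proof. by split; [exact: tame_succ|exact: psum_succ]. Qed.

(** * Differential equations and growth at 1 of the moment generating functions *)

Section GeneratingFunctions.
Local Notation b := (@b_ R).
Local Notation d := (@d_ R).
Local Notation c := (@c_ R).
Local Notation m := (@m_ R).
Variables (lam K A : R).
Hypothesis dA : forall n, `|d lam n| <= A.
Hypothesis cA : forall n, `|c lam n| <= A.
Hypothesis mA : forall n, `|m lam n - K * n.+1%:R| <= A.

Lemma tame_b : tame b.
Proof. by apply: (@tame_bounded _ 1) => n; rewrite ger0_norm ?b_ge0 ?b_le1. Qed.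

Lemma tame_d : tame (d lam). Proof. exact: tame_bounded dA. Qed.
Lemma tame_c : tame (c lam). Proof. exact: tame_bounded cA. Qed.

Lemma tame_m : tame (m lam).
Proof.
rewrite (_ : m lam = (fun n => (m lam n - K * n.+1%:R) + K * n.+1%:R)); last first.
  by apply/funext => n; rewrite subrK.
by apply: tameD; [exact: tame_bounded mA|apply: tameZ; exact: tame_succ].
Qed.

Let B := psum b.
Let E := psum (d lam).
Let C := psum (c lam).
Let M := psum (m lam).

(** The derived coefficients [(n + 1) a_(n + 1)] are the left sides of the moment recursions;
    partial sums become division by [1 - x], and Cauchy products become products. *)
Lemma is_derive_B (x : R) : `|x| < 1 -> is_derive x (1 : R) B ((1 - x) ^- 2 - B x ^+ 2).
Proof.
move=> x1; apply: is_derive_eq; first exact: is_derive_psum tame_b x1.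
rewrite (_ : pseries_diffs b = (fun n => n.+1%:R + -1 * cauchyp b b n)); last first.
  by apply/funext => n; rewrite /pseries_diffs b_rec mulN1r.
have [_ ->] := is_psumD x1 (is_psum_succ x1) (is_psumZ (-1) x1 (is_psum_cauchyp x1 (is_psumP
  x tame_b) (is_psumP x tame_b))).
by rewrite mulN1r expr2.
Qed.

Lemma is_derive_E (x : R) : `|x| < 1 ->
  is_derive x (1 : R) E (2 * E x / (1 - x) + 2 * B x ^+ 2 - (1 - x) ^- 2).
Proof.
move=> x1; apply: is_derive_eq; first exact: is_derive_psum tame_d x1.
rewrite (_ : pseries_diffs (d lam) = (fun n => 2 * (\sum_(k < n.+1) d lam k)
   + (2 * cauchyp b b n + -1 * n.+1%:R))); last first.
  by apply/funext => n; rewrite /pseries_diffs d_rec; ring.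
have [_ ->] := is_psumD x1 (is_psumZ (2) x1 (is_psum_partial_sums x1 (is_psumP x tame_d)))
  (is_psumD x1 (is_psumZ (2) x1 (is_psum_cauchyp x1 (is_psumP x tame_b) (is_psumP x tame_b)))
    (is_psumZ (-1) x1 (is_psum_succ x1))).
by rewrite -/B -/E; ring.
Qed.

Lemma is_derive_C (x : R) : `|x| < 1 -> is_derive x (1 : R) C
  (2 * E x / (1 - x) + B x ^+ 2 - (1 - x) ^- 2 - 2 * B x * C x).
Proof.
move=> x1; apply: is_derive_eq; first exact: is_derive_psum tame_c x1.
rewrite (_ : pseries_diffs (c lam) = (fun n => 2 * (\sum_(k < n.+1) d lam k)
   + (cauchyp b b n + (-1 * n.+1%:R + -2 * cauchyp (c lam) b n)))); last first.
  by apply/funext => n; rewrite /pseries_diffs c_rec d_rec; ring.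
have [_ ->] := is_psumD x1 (is_psumZ (2) x1 (is_psum_partial_sums x1 (is_psumP x tame_d)))
  (is_psumD x1 (is_psum_cauchyp x1 (is_psumP x tame_b) (is_psumP x tame_b)) (is_psumD x1
    (is_psumZ (-1) x1 (is_psum_succ x1)) (is_psumZ (-2) x1 (is_psum_cauchyp x1 (is_psumP x
      tame_c) (is_psumP x tame_b))))).
by rewrite -/B -/E -/C; ring.
Qed.

Lemma is_derive_M (x : R) : `|x| < 1 -> is_derive x (1 : R) M
  (2 * M x / (1 - x) + 2 * E x ^+ 2 + 8 * C x * B x - 4 * E x / (1 - x) + (1 - x) ^- 2).
Proof.
move=> x1; apply: is_derive_eq; first exact: is_derive_psum tame_m x1.
rewrite (_ : pseries_diffs (m lam) = (fun n => 2 * (\sum_(k < n.+1) m lam k)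
   + (2 * cauchyp (d lam) (d lam) n + (8 * cauchyp (c lam) b n +
     (-4 * (\sum_(k < n.+1) d lam k) + n.+1%:R))))); last first.
  by apply/funext => n; rewrite /pseries_diffs m_rec; ring.
have [_ ->] := is_psumD x1 (is_psumZ (2) x1 (is_psum_partial_sums x1 (is_psumP x tame_m)))
  (is_psumD x1 (is_psumZ (2) x1 (is_psum_cauchyp x1 (is_psumP x tame_d) (is_psumP x tame_d)))
    (is_psumD x1 (is_psumZ (8) x1 (is_psum_cauchyp x1 (is_psumP x tame_c) (is_psumP x
      tame_b))) (is_psumD x1 (is_psumZ (-4) x1 (is_psum_partial_sums x1 (is_psumP x tame_d)))
        (is_psum_succ x1)))).
by rewrite -/B -/E -/C -/M; ring.
Qed.

Lemma B_0 : B 0 = 1. Proof. by rewrite /B psum0 b_0. Qed.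
Lemma E_0 : E 0 = - lam. Proof. by rewrite /E psum0 d_0. Qed.
Lemma C_0 : C 0 = - lam. Proof. by rewrite /C psum0 c_0. Qed.
Lemma M_0 : M 0 = lam ^+ 2. Proof. by rewrite /M psum0 m_0. Qed.

Lemma E_bound x : 0 <= x < 1 -> `|E x| <= A / (1 - x). Proof. exact: psum_bound dA. Qed.
Lemma C_bound x : 0 <= x < 1 -> `|C x| <= A / (1 - x). Proof. exact: psum_bound cA. Qed.

Lemma M_bound x : 0 <= x < 1 -> `|M x - K / (1 - x) ^+ 2| <= A / (1 - x).
Proof.
move=> x01; have /andP[x0 x1] := x01.
have x1' : `|x| < 1 by rewrite ger0_norm.
have := psum_bound mA x01.
rewrite (_ : (fun n => _) = (fun n => m lam n + - K * n.+1%:R)); last first.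
  by apply/funext => n; rewrite mulNr.
by have [_ ->] := is_psumD x1' (is_psumP x tame_m) (is_psumZ (- K) x1' (is_psum_succ x1'));
  rewrite mulNr.
Qed.

Lemma B_ge0 x : 0 <= x < 1 -> 0 <= B x.
Proof.
move=> /andP[x0 x1]; apply: limr_ge; first by apply: tame_b; rewrite ger0_norm.
by near=> n; rewrite pseriesE; apply: sumr_ge0 => i _; rewrite mulr_ge0 ?b_ge0 ?exprn_ge0.
Unshelve. all: by end_near. Qed.

End GeneratingFunctions.
End PowerSeries.

(** * Derivatives and integrals *)

Section Calculus.
Variable R : realType.
Local Notation mu := (@lebesgue_measure R).
Implicit Types (f g F : R -> R) (x a b l : R).

Definition isd f x l := is_derive x (1 : R) f l.

Lemma isd_eq f x l l' : isd f x l -> l = l' -> isd f x l'.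
Proof. by move=> h <-. Qed.

Lemma isdC l x : isd (fun=> l) x 0.
Proof. exact: is_derive_cst. Qed.

Lemma isd_id x : isd (fun y => y) x 1.
Proof. exact: is_derive_id. Qed.

Lemma isdD f g x a b : isd f x a -> isd g x b -> isd (fun y => f y + g y) x (a + b).
Proof. exact: is_deriveD. Qed.

Lemma isdN f x a : isd f x a -> isd (fun y => - f y) x (- a).
Proof. exact: is_deriveN. Qed.

Lemma isdB f g x a b : isd f x a -> isd g x b -> isd (fun y => f y - g y) x (a - b).
Proof. exact: is_deriveB. Qed.

Lemma isdM f g x a b : isd f x a -> isd g x b -> isd (fun y => f y * g y) x (a * g x + f x * b).
Proof.
move=> fa gb; apply: isd_eq; first exact: is_deriveM fa gb.
by rewrite /GRing.scale /= addrC [g x * a]mulrC.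
Qed.

Lemma isdZ l f x a : isd f x a -> isd (fun y => l * f y) x (l * a).
Proof. by move=> fa; apply: isd_eq; [exact: isdM (isdC l x) fa|rewrite mul0r add0r]. Qed.

Lemma isd_sqr f x a : isd f x a -> isd (fun y => f y ^+ 2) x (2 * f x * a).
Proof. by move=> fa; apply: isd_eq; [exact: (isdM fa fa)|ring]. Qed.

Lemma isdV f x a : isd f x a -> f x != 0 -> isd (fun y => (f y)^-1) x (- a / f x ^+ 2).
Proof.
move=> fa fx; apply: isd_eq; first exact: is_deriveV fx fa.
by rewrite /GRing.scale /=; field.
Qed.

Lemma isd_near f g x a : (\forall y \near x, f y = g y) -> isd f x a -> isd g x a.
Proof. exact: near_eq_is_derive. Qed.

Lemma isd_derivable f x a : isd f x a -> derivable f x 1.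
Proof. by case. Qed.

Lemma isd_continuous f x a : isd f x a -> {for x, continuous f}.
Proof.
by move=> /isd_derivable fx; apply/differentiable_continuous; rewrite -derivable1_diffP.
Qed.

Lemma isd_within f (f' : R -> R) a b : (forall x, a <= x <= b -> isd f x (f' x)) ->
  {within `[a, b], continuous f}.
Proof.
move=> ff'; apply: derivable_within_continuous => x; rewrite in_itv /= => xab.
exact: isd_derivable (ff' x xab).
Qed.

Lemma isd_le f (f' : R -> R) eps a b : a <= b ->
  (forall x, a <= x <= b -> isd f x (f' x)) ->
  (forall x, a <= x <= b -> f' x <= eps) -> f b - f a <= eps * (b - a).
Proof.
rewrite le_eqVlt => /predU1P[->|ab] ff' f'e; first by rewrite !subrr mulr0.
have [c] := MVT ab (fun x (xab : x \in `]a, b[%R) => ff' x (subset_itv_oo_cc xab))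
  (isd_within ff').
rewrite in_itv /= => /andP[ac cb] ->; apply: ler_wpM2r; first by rewrite subr_ge0 ltW.
by apply: f'e; rewrite !ltW.
Qed.

Lemma isd_ge f (f' : R -> R) eps a b : a <= b ->
  (forall x, a <= x <= b -> isd f x (f' x)) ->
  (forall x, a <= x <= b -> eps <= f' x) -> eps * (b - a) <= f b - f a.
Proof.
move=> ab ff' f'e.
have : - f b - - f a <= - eps * (b - a).
  apply: (@isd_le (fun x => - f x) (fun x => - f' x)) => // x xab.
    by apply: isdN; exact: ff'.
  by rewrite lerN2; exact: f'e.
by rewrite mulNr; move: (eps * _) => z; lra.
Qed.

(** The mean value theorem on [[a, y]], with y close to 1. This carries a known limit at 1 back to a
    point [a], with an error governed by a bound on the derivative. *)
Lemma isd_dist_limit f (f' : R -> R) l eps A a : a < 1 ->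
  (forall x, a <= x < 1 -> isd f x (f' x)) ->
  (forall x, a <= x < 1 -> `|f' x| <= eps) ->
  (forall x, a <= x < 1 -> `|f x - l| <= A * (1 - x)) ->
  `|f a - l| <= eps * (1 - a).
Proof.
move=> a1 ff' f'e fl.
have e0 : 0 <= eps by apply: le_trans (normr_ge0 _) (f'e a _); rewrite lexx.
have A0 : 0 <= A.
  have := le_trans (normr_ge0 _) (fl a _); rewrite lexx a1 => /(_ isT).
  by rewrite pmulr_lge0 // subr_gt0.
apply/ler_addgt0Pr => d d0.
pose y := Num.max a (1 - d / (A + 1)).
have A1 : 0 < A + 1 by lra.
have dA : 0 < d / (A + 1) by rewrite divr_gt0.
have ay : a <= y by rewrite le_max lexx.
have y1 : y < 1 by rewrite gt_max a1 /=; lra.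
have Ay : A * (1 - y) <= d.
  apply: le_trans (_ : A * (d / (A + 1)) <= _).
    by apply: ler_wpM2l => //; rewrite lerBlDr -lerBlDl le_max lexx orbT.
  rewrite mulrA ler_pdivrMr //; nra.
have fy := fl y; rewrite ay y1 in fy; have {fy}fy := fy isT.
have ffy : forall x, a <= x <= y -> isd f x (f' x).
  by move=> x /andP[ax xy]; apply: ff'; rewrite ax (le_lt_trans xy).
have f'y : forall x, a <= x <= y -> `|f' x| <= eps.
  by move=> x /andP[ax xy]; apply: f'e; rewrite ax (le_lt_trans xy).
have U := isd_le ay ffy (fun x xy => le_trans (ler_norm _) (f'y x xy)).
have L := @isd_ge f f' (- eps) a y ay ffy (fun x xy => proj1 (andP (etrans (esym (ler_norml _
  _)) (f'y x xy)))).
have : eps * (y - a) <= eps * (1 - a) by apply: ler_wpM2l => //; lra.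
move: fy; rewrite !ler_norml => /andP[? ?] ?; apply/andP; split; lra.
Qed.

Lemma Rintegral_FTC f F a b : a <= b ->
  {within `[a, b], continuous f} -> {within `[a, b], continuous F} ->
  (forall x, a < x < b -> isd F x (f x)) ->
  \int[mu]_(x in `[a, b]) f x = F b - F a.
Proof.
rewrite le_eqVlt => /predU1P[->|ab] cf cF dF.
  by rewrite set_itv1 Rintegral_set1 subrr.
rewrite /Rintegral (@continuous_FTC2 R f F a b ab cf) //.
- split.
  + by move=> x; rewrite in_itv /= => /dF /isd_derivable.
  + by have /(continuous_within_itvP _ ab)[] := cF.
  + by have /(continuous_within_itvP _ ab)[] := cF.
- move=> x; rewrite in_itv /= => /dF [_ <-].
  by rewrite derive1E.
Qed.

Lemma Rintegral_FTC_isd f (f' : R -> R) F a b : a <= b ->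
  (forall x, a <= x <= b -> isd f x (f' x)) ->
  (forall x, a <= x <= b -> isd F x (f x)) ->
  \int[mu]_(x in `[a, b]) f x = F b - F a.
Proof.
move=> ab df dF; apply: Rintegral_FTC => //; [exact: isd_within df|exact: isd_within dF|].
by move=> x /andP[ax xb]; apply: dF; rewrite !ltW.
Qed.

Lemma isd_within_ex f a b : (forall x, a <= x <= b -> exists l, isd f x l) ->
  {within `[a, b], continuous f}.
Proof.
move=> df; apply: derivable_within_continuous => x; rewrite in_itv /= => /df[l].
exact: isd_derivable.
Qed.

(** [F] is controlled only below 1, so the fundamental theorem is applied on [[0, x]] and the
    remaining integral is at most [Bd (1 - x)]. Derivability of [f] supplies continuity and
    measurability. *)
Lemma Rintegral_improper f F (l Bd A : R) :
  (forall x, 0 <= x < 1 -> isd F x (f x)) ->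
  (forall x, 0 <= x < 1 -> exists l, isd f x l) ->
  (forall x, 0 <= x < 1 -> `|f x| <= Bd) ->
  (forall x, 0 <= x < 1 -> `|F x - l| <= A * (1 - x)) ->
  \int[mu]_(x in `[0, 1[) f x = l - F 0.
Proof.
move=> dF df fB FA.
have mf : measurable_fun `[0:R, 1[ f.
  apply: measurable_realfun.subspace_continuous_measurable_fun; first exact: measurable_itv.
  apply: derivable_within_continuous => x; rewrite in_itv /= => /df[l'].
  exact: isd_derivable.
have int_f : mu.-integrable `[0:R, 1[ (EFin \o f).
  apply: measurable_bounded_integrable => //.
    by rewrite /= lebesgue_measure_itv /= lte_fin ltr01 ltry.
  exists Bd; split; first exact: num_real.
  move=> y By x /=; rewrite in_itv /= => x01.
  exact: le_trans (fB x x01) (ltW By).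
have tail x : 0 <= x < 1 -> `|\int[mu]_(y in `]x, 1[) f y| <= Bd * (1 - x).
  move=> /andP[x0 x1].
  have sub : `]x, 1[ `<=` `[0:R, 1[.
    by move=> y /=; rewrite !in_itv /= => /andP[xy ->]; rewrite ltW // (le_lt_trans x0).
  have int_x : mu.-integrable `]x, 1[ (EFin \o f) by apply: integrableS int_f.
  apply: le_trans (le_normr_Rintegral _ int_x) _ => //.
  apply: le_trans (_ : \int[mu]_(y in `]x, 1[) (cst Bd y) <= _).
    apply: le_Rintegral => //.
    - exact: (integrable_norm int_x).
    - apply: measurable_bounded_integrable => //.
        by rewrite /= lebesgue_measure_itv /= lte_fin x1 -EFinB ltry.
      by exists `|Bd|; split; [exact: num_real|move=> y By z _ /=; exact: ltW].
    - by move=> y /sub /=; rewrite in_itv /=; exact: fB.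
  rewrite Rintegral_cst //= lebesgue_measure_itv /= lte_fin x1 -EFinB /=.
  by [].
have key x : 0 <= x < 1 -> `|\int[mu]_(y in `[0, 1[) f y - (l - F 0)| <= (Bd + A) * (1 - x).
  move=> x01; have /andP[x0 x1] := x01.
  have := @Rintegral_itvB R f (BLeft 0) (BLeft 1) x int_f.
  rewrite !bnd_simp x0 x1 => /(_ isT isT).
  have sub y : 0 <= y <= x -> 0 <= y < 1 by move=> /andP[-> yx]; exact: le_lt_trans x1.
  rewrite (@Rintegral_FTC f F 0 x x0); last 3 first.
  - by apply: isd_within_ex => y /sub /df.
  - by apply: isd_within_ex => y /sub /dF h; exists (f y).
  - by move=> y /andP[y0 yx]; apply: dF; rewrite ltW // (lt_trans yx).
  move=> E; have {E}-> : \int[mu]_(y in `[0, 1[) f y = \int[mu]_(y in `]x, 1[) f y + (F x - F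
    0).
    by rewrite -E subrK.
  have -> : \int[mu]_(y in `]x, 1[) f y + (F x - F 0) - (l - F 0) = \int[mu]_(y in `]x, 1[) f
    y + (F x - l).
    by ring.
  by apply: le_trans (ler_normD _ _) _; rewrite mulrDl lerD ?tail ?FA.
apply/eqP; rewrite -subr_eq0 -normr_le0; apply/ler_addgt0Pr => e e0; rewrite add0r.
set c := Bd + A in key.
have c0 : 0 <= c.
  by have := le_trans (normr_ge0 _) (key 0 _); rewrite lexx ltr01 subr0 mulr1; apply.
pose x := Num.max 0 (1 - e / (c + 1)).
have c1 : 0 < c + 1 by lra.
have ec : 0 < e / (c + 1) by rewrite divr_gt0.
have x01 : 0 <= x < 1 by rewrite /x le_max lexx /= gt_max ltr01 /=; lra.
apply: le_trans (key x x01) _.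
apply: le_trans (_ : c * (e / (c + 1)) <= _).
  by apply: ler_wpM2l => //; rewrite lerBlDr -lerBlDl le_max lexx orbT.
by rewrite mulrA ler_pdivrMr //; nra.
Qed.

End Calculus.

(** * Explicit solutions *)

Section Explicit.
Variable R : realType.
Local Notation mu := (@lebesgue_measure R).
Local Notation s5 := (Num.sqrt 5 : R).
Local Notation beta := ((s5 - 1) / 2).
Implicit Types x v : R.

Definition w_ x : R := (1 - x) `^ s5.
Definition den x : R := 7 + 3 * s5 - 2 * w_ x.
(** The solution with [phi 0 = 1] of [(1 - x) phi' = 1 - phi - phi^2], the Riccati equation after
    multiplication of the unknown by [1 - x]. [beta] is its stationary solution, and the initial
    value produces [7 + 3 sqrt 5] in [den]. *)
Definition phi x : R := beta + 2 * s5 * w_ x / den x.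

Lemma w_gt0 x : x < 1 -> 0 < w_ x.
Proof. by move=> x1; apply: powR_gt0; rewrite subr_gt0. Qed.

Lemma w_le x : 0 <= x < 1 -> w_ x <= 1 - x.
Proof.
move=> /andP[x0 x1]; have /andP[s1 s2] := sqrt5_bounds R.
by apply: ge1r_powR; [rewrite subr_gt0 x1 /=|]; lra.
Qed.

Lemma w_0 : w_ 0 = 1.
Proof. by rewrite /w_ subr0 powR1. Qed.

Lemma isd_1B x : isd (fun y => 1 - y) x (- 1).
Proof. by apply: isd_eq; [exact: isdB (isdC 1 x) (isd_id x)|rewrite sub0r]. Qed.

Lemma isd_inv1B x : x < 1 -> isd (fun y => (1 - y)^-1) x ((1 - x) ^- 2).
Proof.
move=> x1; have v0 : 1 - x != 0 by rewrite gt_eqF // subr_gt0.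
by apply: isd_eq; [exact: (@isdV _ (fun y => 1 - y) x _ (isd_1B x) v0)|rewrite opprK mul1r].
Qed.

Lemma isd_w x : x < 1 -> isd w_ x (- s5 * w_ x / (1 - x)).
Proof.
move=> x1; have v0 : 0 < 1 - x by rewrite subr_gt0.
have h2 := @is_derive1_powR R s5 (1 - x) v0.
have h3 := @is_derive1_comp R (@powR R ^~ s5) (fun y => 1 - y) x _ _ h2 (isd_1B x).
apply: (@isd_eq _ w_ _ _ _ h3).
rewrite /w_ powRB; last by rewrite (gt_eqF v0) implybT.
by rewrite powRr1 ?ltW //; field; rewrite gt_eqF.
Qed.

Lemma den_bounds x : 0 <= x < 1 -> 11 < den x < 14.
Proof.
move=> x01; have /andP[s1 s2] := sqrt5_bounds R; have /andP[x0 x1] := x01.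
have := w_le x01; have := w_gt0 x1; rewrite /den => ? ?.
by apply/andP; split; lra.
Qed.

Lemma isd_den x : x < 1 -> isd den x (2 * s5 * w_ x / (1 - x)).
Proof.
move=> x1; apply: isd_eq; first by apply: isdB; [exact: isdC|apply: isdZ; exact: isd_w].
by field; rewrite gt_eqF // subr_gt0.
Qed.

Lemma isd_phi x : 0 <= x < 1 -> isd phi x ((1 - phi x - phi x ^+ 2) / (1 - x)).
Proof.
move=> x01; have /andP[x0 x1] := x01; have /andP[D0 _] := den_bounds x01.
have D1 : den x != 0 by rewrite gt_eqF //; lra.
have v0 : 1 - x != 0 by rewrite gt_eqF // subr_gt0.
have s2 := sqrt5_sqr R.
apply: isd_eq.
  apply: isdD; first exact: isdC.
  apply: isdM; first by apply: isdZ; exact: isd_w.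
  by apply: isdV D1; exact: isd_den.
rewrite /phi; move: D1; rewrite /den; move: (w_ x) => w D1.
by field: s2; rewrite v0 D1.
Qed.

Lemma phi_0 : phi 0 = 1.
Proof.
have /andP[s1 s2] := sqrt5_bounds R; have ss := sqrt5_sqr R.
rewrite /phi /den w_0; have d0 : 5 + 3 * s5 != 0 by rewrite gt_eqF //; lra.
have -> : 7 + 3 * s5 - 2 * 1 = 5 + 3 * s5 by ring.
by field: ss.
Qed.

Lemma phi_bounds x : 0 <= x < 1 -> 0 <= phi x - beta <= (1 - x) / 2.
Proof.
move=> x01; have /andP[x0 x1] := x01; have /andP[D0 _] := den_bounds x01.
have /andP[s1 s2] := sqrt5_bounds R.
have wv := w_le x01; have w0 := w_gt0 x1.
rewrite /phi addrC addKr; apply/andP; split.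
  by rewrite divr_ge0 ?mulr_ge0 //; lra.
by rewrite ler_pdivrMr; nra.
Qed.

Lemma g_phi v : 0 <= v <= 1 -> g v = 2 * phi (1 - v) ^+ 2 - 1.
Proof.
move=> /andP[v0 v1]; rewrite /g /phi /den /w_ subKr.
have /andP[s1 s2] := sqrt5_bounds R; have ss := sqrt5_sqr R.
have -> : v `^ (2 * s5) = (v `^ s5) ^+ 2.
  by rewrite mulrC powRrM powR_mulrn // powR_ge0.
have w0 : 0 <= v `^ s5 by exact: powR_ge0.
have e1 : (1 : R) `^ s5 = 1 by rewrite powR1.
have w1 : v `^ s5 <= 1 by rewrite -[X in _ <= X]e1; apply: ge0_ler_powR; rewrite ?nnegrE; lra.
move: (v `^ s5) w0 w1 => w w0 w1.
have D0 : 7 + 3 * s5 - 2 * w != 0 by rewrite gt_eqF //; lra.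
by field: ss.
Qed.

Lemma F_minus_phi x : x < 1 -> F_minus x = phi x / (1 - x) - 1.
Proof.
move=> x1; rewrite /F_minus /phi powRN -/(w_ x); congr (_ - _).
have w0 : w_ x != 0 by rewrite gt_eqF // w_gt0.
have v0 : 1 - x != 0 by rewrite gt_eqF // subr_gt0.
have -> : 2 - (7 + 3 * s5) * (w_ x)^-1 = - den x / w_ x by rewrite /den; field.
by rewrite !invfM invrN invrK; move: (den x)^-1 => d; field.
Qed.

Lemma isd_phi_div x : 0 <= x < 1 ->
  isd (fun y => phi y / (1 - y)) x ((1 - phi x ^+ 2) / (1 - x) ^+ 2).
Proof.
move=> x01; have /andP[x0 x1] := x01.
have v0 : 1 - x != 0 by rewrite gt_eqF // subr_gt0.
apply: isd_eq.
  by apply: isdM; [exact: isd_phi|exact: isd_inv1B].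
rewrite /=. by field.
Qed.

Lemma F_minus_derive x : 0 <= x < 1 ->
  (@F_minus R)^`()%classic x = (1 - phi x ^+ 2) / (1 - x) ^+ 2.
Proof.
move=> x01; have /andP[x0 x1] := x01.
have : isd (@F_minus R) x ((1 - phi x ^+ 2) / (1 - x) ^+ 2 - 0).
  apply: (@isd_near _ (fun y => phi y / (1 - y) - 1)).
    near=> y; rewrite F_minus_phi //; near: y; exact: lt_nbhsl.
  by apply: isdB; [exact: isd_phi_div|exact: isdC].
by rewrite subr0 => -[_ <-]; rewrite derive1E.
Unshelve. all: by end_near. Qed.

End Explicit.

(** * Identification of the constants *)

Section Estimates.
Variable R : realType.

(** The expression vanishes at [h = 2 - s], [p = beta], because [1 - beta^2 = beta]; the hypotheses
    put both arguments within O(v) of these values. This is the cancellation of the 1 / (1 - u)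
    singularity in [C2]. *)
Lemma kappa_bound (s p h v : R) : 38 / 17 < s -> s < 161 / 72 -> s ^+ 2 = 5 ->
  0 <= v -> v <= 1 -> 0 <= p - (s - 1) / 2 <= v / 2 -> `|h - (2 - s)| <= 2 * v ->
  `|- 4 * (1 + h) + 8 * p * (1 - p ^+ 2)| <= 24 * v.
Proof.
move=> s1 s2 ss v0 v1 /andP[]; set e := p - _ => e0 ev hd.
have -> : - 4 * (1 + h) + 8 * p * (1 - p ^+ 2) =
    - 4 * (h - (2 - s)) + 8 * e - 8 * (e * (p ^+ 2 + p * ((s - 1) / 2) + ((s - 1) / 2) ^+ 2)).
  have -> : p = e + (s - 1) / 2 by rewrite /e subrK.
  by field: ss.
have p0 : 0 <= p by move: e0; rewrite /e; lra.
have p1 : p <= 3 / 2 by move: ev; rewrite /e; lra.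
set q := p ^+ 2 + _ + _.
have q0 : 0 <= q by rewrite /q; nra.
have q6 : q <= 4 by rewrite /q; nra.
have eq0 : 0 <= e * q by rewrite mulr_ge0.
have eq1 : e * q <= e * 4 by rewrite ler_wpM2l.
move: hd; rewrite !ler_norml => /andP[? ?].
by apply/andP; split; lra.
Qed.

Lemma integrand_bound (h psi p C k A v : R) : `|h| <= A -> `|psi| <= A -> 0 <= p -> p <= 2 ->
  `|k| <= 24 ->
  `|(1 + 4 * h + 2 * h ^+ 2 + 8 * p * psi) + C * (k + 8 * p ^+ 2 - 8 * p * (1 - p ^+ 2))|
  <= 1 + 4 * A + 2 * A ^+ 2 + 16 * A + `|C| * (24 + 32 + 48).
Proof.
move=> hA pA p0 p2 k24; apply: le_trans (ler_normD _ _) _; apply: lerD; last first.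
  rewrite normrM; apply: ler_wpM2l => //.
  move: k24; rewrite !ler_norml => /andP[? ?].
  have q0 : 0 <= p ^+ 2 by exact: sqr_ge0.
  have q4 : p ^+ 2 <= 4 by nra.
  have c0 : 0 <= p * p ^+ 2 by rewrite mulr_ge0.
  have c8 : p * p ^+ 2 <= 8 by rewrite [8](_ : _ = 2 * 4); [apply: ler_pM|ring].
  by apply/andP; split; nra.
have hh : h ^+ 2 <= A ^+ 2.
  by rewrite -real_normK ?num_real // ler_pXn2r // ?nnegrE //; exact: le_trans hA.
have pp : `|p * psi| <= 2 * A by rewrite normrM (ger0_norm p0); apply: ler_pM.
move: hA pp; rewrite !ler_norml => /andP[? ?] /andP[? ?].
have h0 : 0 <= h ^+ 2 by exact: sqr_ge0.
by apply/andP; split; lra.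
Qed.

(** By [beta^2 = 1 - beta], the factor multiplying [x] tends to [s - 2], while [H] tends to 0; every
    deviation is of order [1 - x]. *)
Lemma Lf_limit_aux (s p h H x A : R) : 38 / 17 < s -> s < 161 / 72 -> s ^+ 2 = 5 ->
  0 <= 1 - x -> 1 - x <= 1 -> 0 <= p - (s - 1) / 2 <= (1 - x) / 2 -> `|h - (2 - s)| <= 2 * (1
    - x) ->
  `|H| <= A * (1 - x) -> 0 <= A ->
  `|2 * (- H + x * (- 2 * h + 2 * p ^+ 2 - 1) - (s - 2))| <= 2 * (A + 10) * (1 - x).
Proof.
move=> s1 s2 ss v0 v1 /andP[]; set e := p - _ => e0 ev hd HA A0.
have E : - 2 * h + 2 * p ^+ 2 - 1 = - 2 * (h - (2 - s)) + 2 * (e * (p + (s - 1) / 2)) + (s - 2).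
  have -> : p = e + (s - 1) / 2 by rewrite /e subrK.
  by field: ss.
set q := - 2 * h + _ - _ in E *.
have p0 : 0 <= p + (s - 1) / 2 by move: e0; rewrite /e; lra.
have p1 : p + (s - 1) / 2 <= 2 by move: ev; rewrite /e; lra.
have f0 : 0 <= e * (p + (s - 1) / 2) by rewrite mulr_ge0.
have f1 : e * (p + (s - 1) / 2) <= e * 2 by rewrite ler_wpM2l.
have qs : `|q - (s - 2)| <= 7 * (1 - x).
  by move: hd; rewrite E !ler_norml => /andP[? ?]; apply/andP; split; lra.
have -> : 2 * (- H + x * q - (s - 2)) = 2 * (- H + x * (q - (s - 2)) - (1 - x) * (s - 2)) by
  ring.
have xq : `|x * (q - (s - 2))| <= 7 * (1 - x).
  rewrite normrM; apply: le_trans qs; rewrite -[X in _ <= X]mul1r; apply: ler_wpM2r => //.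
  by rewrite ler_norml; apply/andP; split; lra.
have vs : `|(1 - x) * (s - 2)| <= 1 - x.
  by rewrite normrM (ger0_norm v0) ler_piMr // ler_norml; apply/andP; split; lra.
rewrite normrM (ger0_norm (x := 2)) // -mulrA; apply: ler_wpM2l => //.
apply: le_trans (ler_normB _ _) _; apply: le_trans (lerD (ler_normD _ _) (lexx _)) _.
by rewrite normrN; apply: le_trans (lerD (lerD HA xq) vs) _; rewrite mulrDl; lra.
Qed.

End Estimates.

(** * Taylor polynomials in w and their exact residuals *)

Section Polynomials.
Variable R : realType.
Implicit Type w : R.
Lemma isd_peval (l : seq zs) (f : R -> R) x a : isd f x a ->
  isd (fun y => peval l (f y)) x (pderiv l (f x) * a).
Proof.
move=> fa; elim: l => [|z l IHl] /=.
  by apply: isd_eq; [exact: isdC|rewrite mul0r].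
apply: (isd_eq (isdD (isdC _ x) (isdM fa IHl))).
by ring.
Qed.

Local Notation s5 := (Num.sqrt 5 : R).
Local Notation scale := (10 ^+ 13 : R).

Definition zpoly (l : seq Z) : seq zs := [seq (z, Z0) | z <- l].
Definition zscale : Z := Z.pow 10 (Z.of_nat 13).

(* Taylor coefficients at w = 0, scaled by 10^13, of h, of the solution Xi of
   (1 + s) Xi + s w Xi' = 8 phi / den^2, and of the solution Om of
   Om + s w Om' = 1 + 4 h + 2 h^2 + den^2 (phi^2 - 1 - 2 h) Xi. *)
Definition hpoly := zpoly
  [:: (-2360679774998); 2492235949962; 604023338002; 102851255904; 16188024886; 2470956292;
    371492920; 55372390; 8209264; 1212729; 178706; 26286; 3861; 567; 83]%coqZ.
Definition xpoly := zpoly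
  [:: 81306187558; 39411063635; 10066193977; 2112459035; 403059822; 72717047; 12645201;
    2142539; 356074; 58301; 9433; 1512; 240; 38; 6]%coqZ.
Definition opoly := zpoly
  [:: (-557280900013); 1771002910181; 635679908587; 172951877296; 35889133902; 6512550487;
    1101922299; 179011073; 28342165; 4410211; 677901; 103269; 15625; 2352; 352]%coqZ.

Definition dpoly : seq zs := [:: (7, 3); (-2, 0)]%coqZ.
(* den * phi *)
Definition dphipoly : seq zs := [:: (4, 2); (1, 1)]%coqZ.

Lemma peval_dpoly w : peval dpoly w = 7 + 3 * s5 - 2 * w.
Proof.
have z : (Zr R 7 = 7) * (Zr R 3 = 3) * (Zr R (-2) = -2) * (Zr R 0 = 0).
  by do !split; rewrite /Zr -lock.
by rewrite /= /zs_val /= !z; ring.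
Qed.

Lemma peval_dphipoly w : peval dphipoly w = 4 + 2 * s5 + (1 + s5) * w.
Proof.
have z : (Zr R 4 = 4) * (Zr R 2 = 2) * (Zr R 1 = 1).
  by do !split; rewrite /Zr -lock.
by rewrite /= /zs_val /= !z; ring.
Qed.

Lemma peval_const x (w : R) : peval [:: x] w = zs_val R x.
Proof. by rewrite /= mulr0 addr0. Qed.

(** [res1], [res2] and [res3] are the residuals of the three equations, cleared of denominators by
    powers of [den] (2, 3 and 0) and of the scale (1, 1 and 2), so that all coefficients lie in
    Z[sqrt 5]. *)
Definition res1 := padd (padd (pscale (zscale, Z0) (pmul dpoly dpoly))
    (pscale (Z.mul (-2) zscale, Z0) (pmul dphipoly dphipoly)))
  (pmul (pmul dpoly dpoly) (ptheta (1, 0)%coqZ hpoly)).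

Definition res2 := padd (pscale (Z.mul 8 zscale, Z0) dphipoly)
  (pscale (-1, 0)%coqZ (pmul (pmul (pmul dpoly dpoly) dpoly) (ptheta (1, 1)%coqZ xpoly))).

Definition res3 := padd (padd (padd [:: (Z.mul zscale zscale, Z0)] (pscale (Z.mul 4 zscale,
  Z0) hpoly))
    (padd (pscale (2, 0)%coqZ (pmul hpoly hpoly))
       (pmul xpoly (padd (pscale (zscale, Z0) (padd (pmul dphipoly dphipoly) (pscale (-1,
        0)%coqZ (pmul dpoly dpoly))))
          (pscale (-2, 0)%coqZ (pmul (pmul dpoly dpoly) hpoly))))))
  (pscale (Z.opp zscale, Z0) (ptheta (1, 0)%coqZ opoly)).

Definition hh w := peval hpoly w / scale.
Definition hh' w := pderiv hpoly w / scale.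
Definition xx w := peval xpoly w / scale.
Definition xx' w := pderiv xpoly w / scale.
Definition oo w := peval opoly w / scale.
Definition oo' w := pderiv opoly w / scale.

Lemma scale_gt0 : 0 < scale. Proof. by rewrite exprn_gt0. Qed.

Lemma zs_valZ a : zs_val R (a, Z0) = Zr R a.
Proof. by rewrite /zs_val [Zr R Z0]/Zr -lock /= mul0r addr0. Qed.

Lemma Zr_zscale : Zr R zscale = scale. Proof. exact: Zr_pow10. Qed.

Lemma zs_val11 : zs_val R (1, 1)%coqZ = 1 + s5.
Proof. by rewrite /zs_val /Zr -lock /= mul1r. Qed.

Lemma Zr_small : (Zr R 1 = 1) * (Zr R (-1) = -1) * (Zr R 2 = 2) * (Zr R (-2) = -2) * (Zr R 4
  = 4) * (Zr R 8 = 8).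
Proof. by do !split; rewrite /Zr -lock. Qed.

Let pE := (peval_add, peval_mul, peval_scale, peval_theta, peval_dpoly, peval_dphipoly).
Let zE := (zs_valZ, zs_val11, ZrM, ZrN, Zr_zscale, Zr_small).

Lemma res1E w : let d := 7 + 3 * s5 - 2 * w in
  peval res1 w = scale * (d ^+ 2 - 2 * (4 + 2 * s5 + (1 + s5) * w) ^+ 2 + d ^+ 2 * (hh w + s5
    * w * hh' w)).
Proof.
have S0 := lt0r_neq0 scale_gt0.
rewrite /res1 !pE !zE /hh /hh'; move: (peval hpoly w) (pderiv hpoly w) scale S0 => a b S S0.
by field.
Qed.

Lemma res2E w : let d := 7 + 3 * s5 - 2 * w in
  peval res2 w = scale * (8 * (4 + 2 * s5 + (1 + s5) * w) - d ^+ 3 * ((1 + s5) * xx w + s5 *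
    w * xx' w)).
Proof.
have S0 := lt0r_neq0 scale_gt0.
rewrite /res2 !pE !zE /xx /xx'; move: (peval xpoly w) (pderiv xpoly w) scale S0 => a b S S0.
by field.
Qed.

Lemma res3E w : let d := 7 + 3 * s5 - 2 * w in
  peval res3 w = scale ^+ 2 * (1 + 4 * hh w + 2 * hh w ^+ 2
    + xx w * ((4 + 2 * s5 + (1 + s5) * w) ^+ 2 - d ^+ 2 - 2 * d ^+ 2 * hh w) - (oo w + s5 * w
      * oo' w)).
Proof.
have S0 := lt0r_neq0 scale_gt0.
rewrite /res3 !pE peval_const !zE /hh /xx /oo /oo'.
move: (peval hpoly w) (peval xpoly w) (peval opoly w) (pderiv opoly w) scale S0 => a b c e S S0.
by field.
Qed.

(** Undoing the scaling, with [den > 11], leaves residuals of at most 10^-9, 10^-10 and 10^-9. *)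
Lemma res_bounds w : 0 <= w <= 1 ->
  [/\ `|peval res1 w| <= 10 ^+ 6, `|peval res2 w| <= 10 ^+ 6 & `|peval res3 w| <= 10 ^+ 17].
Proof. by move=> w01; split; apply: pbound_le => //; vm_compute. Qed.

Lemma poly_bounds w : 0 <= w <= 1 -> [/\ `|hh w| <= 1, `|xx w| <= 1 / 10 & `|oo w| <= 10].
Proof.
move=> w01; have S0 := scale_gt0.
have hb : `|peval hpoly w| <= 10 ^+ 13 by apply: pbound_le => //; vm_compute.
have xb : `|peval xpoly w| <= 10 ^+ 12 by apply: pbound_le => //; vm_compute.
have ob : `|peval opoly w| <= 10 ^+ 14 by apply: pbound_le => //; vm_compute.
rewrite /hh /xx /oo !normrM !normfV !(gtr0_norm S0) !ler_pdivrMr //; split.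
- by rewrite mul1r.
- by apply: le_trans xb _; rewrite [10 ^+ 13]exprS mulrA mul1r mulVf ?mul1r ?pnatr_eq0.
- by rewrite -exprS.
Qed.

Lemma final_value :
  `|hh (1 : R) ^+ 2 - (70 + 30 * s5) * xx 1 * hh 1 + oo 1 - (57 / 10 ^+ 3 + 162 / 10 ^+ 6 +
    285 / 10 ^+ 9)| <= 1 / 10 ^+ 9.
Proof.
pose v (h1 x1 o1 t : zs) := zs_add (zs_add (zs_mul h1 h1) (zs_mul (zscale, Z0) o1))
  (zs_add (zs_mul (-1, 0)%coqZ t) (zs_mul (zs_mul (-70, -30)%coqZ x1) h1)).
have m73 : zs_val R (-70, -30)%coqZ = - (70 + 30 * s5).
  have z : (Zr R (-70) = -70) * (Zr R (-30) = -30) by split; rewrite /Zr -lock.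
  by rewrite /zs_val /= !z; ring.
have vE h1 x1 o1 t : zs_val R (v h1 x1 o1 t) = zs_val R h1 ^+ 2 + scale * zs_val R o1
    - zs_val R t - (70 + 30 * s5) * zs_val R x1 * zs_val R h1.
  by rewrite /v !(zs_valD, zs_valM) m73 !zs_valZ Zr_zscale Zr_small; ring.
(* The target 0.057162285, scaled by 10^26. *)
pose t : zs := (Z.mul 57162285 (Z.pow 10 (Z.of_nat 17)), Z0).
have b : `|peval [:: v (zs_total hpoly) (zs_total xpoly) (zs_total opoly) t] (1 : R)| <= 10
  ^+ 17
  by apply: pbound_le; [rewrite ler01 lexx|vm_compute].
have S0 := scale_gt0; have S1 := lt0r_neq0 S0.
have tE : zs_val R t = 10 ^+ 17 * ((57 * 1000 + 162) * 1000 + 285).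
  rewrite /t zs_valZ ZrM (Zr_pow10 R 17) mulrC; congr (_ * _).
  rewrite -[57162285%coqZ]/(Z.add (Z.mul (Z.add (Z.mul 57 1000) 162) 1000) 285)%coqZ.
  rewrite !(ZrD, ZrM).
  have -> : Zr R 1000 = 1000 by rewrite -[1000%coqZ]/(Z.pow 10 (Z.of_nat 3)) Zr_pow10; ring.
  by congr (_ * _ + _); [congr (_ * _ + _)|]; rewrite /Zr -lock.
have E : peval [:: v (zs_total hpoly) (zs_total xpoly) (zs_total opoly) t] (1 : R) =
    scale ^+ 2 * (hh 1 ^+ 2 - (70 + 30 * s5) * xx 1 * hh 1 + oo 1
    - (57 / 10 ^+ 3 + 162 / 10 ^+ 6 + 285 / 10 ^+ 9)).
  rewrite peval_const vE tE -!peval1 /hh /xx /oo.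
  have -> : (10 : R) ^+ 17 = scale ^+ 2 / 10 ^+ 9.
    by rewrite -exprM -[(13 * 2)%N]/(17 + 9)%N exprD mulfK // expf_neq0.
  move: (peval _ _) (peval _ _) (peval _ _) scale S1 => a c e S S1.
  by field.
move: b; rewrite E normrM (ger0_norm (sqr_ge0 _)) => b.
rewrite -(@ler_pM2l _ (scale ^+ 2)); last by rewrite exprn_gt0.
apply: le_trans b _; rewrite -exprM -[(13 * 2)%N]/(17 + 9)%N exprD mulrA mulr1 mulfK //
  expf_neq0 //.
Qed.

End Polynomials.

(** * Solving the equations and matching their behaviour at 1 *)

Section Identification.
Variable R : realType.
Local Notation mu := (@lebesgue_measure R).
Local Notation s5 := (Num.sqrt 5 : R).
Local Notation beta := ((s5 - 1) / 2).
Local Notation phi := (@phi R).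
Implicit Types x v : R.

(** Only the equations, the values at 0 and the bounds near 1 are kept from the generating
    functions. [C] stands for [lam], which [C1_C] identifies. *)
Variables (B E Cf M : R -> R) (C K A : R).
Hypothesis dB : forall x, 0 <= x < 1 -> isd B x ((1 - x) ^- 2 - B x ^+ 2).
Hypothesis dE : forall x, 0 <= x < 1 ->
  isd E x (2 * E x / (1 - x) + 2 * B x ^+ 2 - (1 - x) ^- 2).
Hypothesis dCf : forall x, 0 <= x < 1 -> isd Cf x
  (2 * E x / (1 - x) + B x ^+ 2 - (1 - x) ^- 2 - 2 * B x * Cf x).
Hypothesis dM : forall x, 0 <= x < 1 -> isd M x
  (2 * M x / (1 - x) + 2 * E x ^+ 2 + 8 * Cf x * B x - 4 * E x / (1 - x) + (1 - x) ^- 2).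
Hypothesis B0 : B 0 = 1.
Hypothesis E0 : E 0 = - C.
Hypothesis Cf0 : Cf 0 = - C.
Hypothesis M0 : M 0 = C ^+ 2.
Hypothesis Bge0 : forall x, 0 <= x < 1 -> 0 <= B x.
Hypothesis Ebd : forall x, 0 <= x < 1 -> `|E x| <= A / (1 - x).
Hypothesis Cbd : forall x, 0 <= x < 1 -> `|Cf x| <= A / (1 - x).
Hypothesis Mbd : forall x, 0 <= x < 1 -> `|M x - K / (1 - x) ^+ 2| <= A / (1 - x).

Lemma sub01 x y : 0 <= x -> x <= y < 1 -> 0 <= y < 1.
Proof. by move=> x0 /andP[xy ->]; rewrite (le_trans x0). Qed.

Lemma v_neq0 x : 0 <= x < 1 -> 1 - x != 0.
Proof. by move=> /andP[_ x1]; rewrite gt_eqF // subr_gt0. Qed.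

Lemma phi_ge0 x : 0 <= x < 1 -> 0 <= phi x.
Proof.
by move=> /phi_bounds /andP[+ _]; have /andP[s1 s2] := sqrt5_bounds R; lra.
Qed.

(* The square of the difference of two solutions of the Riccati equation is
   nonincreasing. *)
Lemma B_phi x : 0 <= x < 1 -> B x = phi x / (1 - x).
Proof.
move=> x01; have /andP[x0 x1] := x01.
pose f y := (B y - phi y / (1 - y)) ^+ 2.
pose f' y := - 2 * (B y + phi y / (1 - y)) * f y.
have y01 y : 0 <= y <= x -> 0 <= y < 1 by move=> /andP[-> yx]; exact: le_lt_trans x1.
have df y : 0 <= y <= x -> isd f y (f' y).
  move=> /y01 h; have := v_neq0 h => v0.
  apply: isd_eq.
    by apply: isd_sqr; apply: isdB; [exact: dB|exact: isd_phi_div].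
  by rewrite /f' /f; field.
have f'0 y : 0 <= y <= x -> f' y <= 0.
  move=> /y01 h; rewrite /f' mulNr mulNr oppr_le0.
  have v0 : 0 <= (1 - y)^-1 by rewrite invr_ge0 subr_ge0 ltW //; case/andP: h.
  have h2 : 0 <= phi y / (1 - y) by apply: mulr_ge0 => //; exact: phi_ge0.
  apply: mulr_ge0; last exact: sqr_ge0.
  by apply: mulr_ge0 => //; apply: addr_ge0 => //; exact: Bge0.
have := isd_le x0 df f'0; rewrite mul0r {2}/f B0 phi_0 subr0 divr1 subrr expr0n /= subr0.
rewrite /f => fx; apply/eqP; rewrite -subr_eq0 -sqrf_eq0 eq_le fx sqr_ge0.
by [].
Qed.

(** The factor [(1 - x)^2] absorbs the homogeneous part of the equation for [E], so [Hf'] depends on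
    [phi] alone. [Hf] goes from [C] at 0 to the limit 0 at 1, which determines [C]. *)
Definition Hf x := - (1 - x) ^+ 2 * E x.

Lemma isd_v2 (F : R -> R) x l : isd F x l ->
  isd (fun y => (1 - y) ^+ 2 * F y) x (- 2 * (1 - x) * F x + (1 - x) ^+ 2 * l).
Proof.
move=> dF; have h := isdM (@isd_sqr _ (fun y => 1 - y) x _ (isd_1B x)) dF.
apply: (isd_eq h).
by rewrite /=; ring.
Qed.

Lemma isd_Hf x : 0 <= x < 1 -> isd Hf x (1 - 2 * phi x ^+ 2).
Proof.
move=> x01; have v0 := v_neq0 x01.
rewrite /Hf (_ : (fun x => _) = (fun x => - ((1 - x) ^+ 2 * E x))); last first.
  by apply/funext => y; rewrite mulNr.
apply: isd_eq; first by apply: isdN; apply: isd_v2; exact: dE.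
by rewrite B_phi //; field.
Qed.

Lemma Hf_bound x : 0 <= x < 1 -> `|Hf x| <= A * (1 - x).
Proof.
move=> x01; have v0 := v_neq0 x01; have := Ebd x01; have /andP[_ x1] := x01.
have v1 : 0 < 1 - x by rewrite subr_gt0.
rewrite /Hf mulNr normrN normrM (ger0_norm (sqr_ge0 _)) => h.
apply: le_trans (ler_wpM2l (sqr_ge0 _) h) _.
by rewrite le_eqVlt; apply/orP; left; apply/eqP; field.
Qed.

Lemma Hf_0 : Hf 0 = C.
Proof. by rewrite /Hf E0 subr0 expr1n mulrNN mul1r. Qed.

Let slope_aux (s p z : R) : 38 / 17 < s -> s < 161 / 72 -> 0 <= p -> p <= z / 2 -> z <= 1 ->
  `|- p * (2 * p + 2 * (s - 1))| <= 2 * z.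
Proof.
move=> s1 s2 p1 p2 z1; rewrite mulNr normrN ger0_norm; last by apply: mulr_ge0 => //; lra.
by apply: le_trans (_ : p * 4 <= _); [apply: ler_wpM2l => //; lra|lra].
Qed.

(** [Hf'] tends to [1 - 2 beta^2 = sqrt 5 - 2]. The quadratic error is needed because the integrand
    of [C2] contains [Hf] divided by [(1 - x)^2]. *)
Lemma Hf_slope x : 0 <= x < 1 -> `|Hf x - (2 - s5) * (1 - x)| <= 2 * (1 - x) ^+ 2.
Proof.
move=> x01; have /andP[x0 x1] := x01; have /andP[s1 s2] := sqrt5_bounds R.
have ss := sqrt5_sqr R.
pose f y := Hf y - (2 - s5) * (1 - y).
have -> : Hf x - (2 - s5) * (1 - x) = f x - 0 by rewrite /f subr0.
have -> : 2 * (1 - x) ^+ 2 = 2 * (1 - x) * (1 - x) by ring.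
apply: (isd_dist_limit (f := f) (f' := fun y => 3 - s5 - 2 * phi y ^+ 2) (A := `|A| + 3) x1);
  move=> y xy; have y01 := sub01 x0 xy; have /andP[y0 y1] := y01; have /andP[xy1 _] := xy.
- apply: isd_eq; first by apply: isdB; [exact: isd_Hf|apply: isdZ; exact: isd_1B].
  by ring.
- have /andP[p1 p2] := phi_bounds y01.
  have -> : 3 - s5 - 2 * phi y ^+ 2 = - (phi y - beta) * (2 * (phi y - beta) + 2 * (s5 - 1))
    by field: ss.
  move: (phi y - beta) p1 p2 => p p1 p2.
  apply: slope_aux s1 s2 p1 (le_trans p2 _) _; lra.
- rewrite subr0 /f; apply: le_trans (ler_normB _ _) _; rewrite [X in _ <= X]mulrDl.
  have v1 : 0 < 1 - y by rewrite subr_gt0.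
  apply: lerD.
    apply: le_trans (Hf_bound y01) _; apply: ler_wpM2r; [exact: ltW|exact: ler_norm].
  rewrite normrM (gtr0_norm v1); apply: ler_wpM2r; first exact: ltW.
  by rewrite ler_norml; apply/andP; split; lra.
Qed.

Lemma continuous_phi_1B : {within `[(0:R), 1], continuous (fun v => phi (1 - v))}.
Proof.
have /andP[s1 s2] := sqrt5_bounds R.
have dw v : 0 < v <= 1 -> isd (fun v => phi (1 - v)) v (- ((1 - phi (1 - v) - phi (1 - v) ^+
  2) / (1 - (1 - v)))).
  move=> /andP[v0 v1]; have x01 : 0 <= 1 - v < 1 by apply/andP; split; lra.
  have h := @is_derive1_comp R phi (fun y => 1 - y) v _ _ (isd_phi x01) (isd_1B v).
  by apply: (isd_eq h); rewrite mulrN1.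
apply/(continuous_within_itvP _ (@ltr01 R)); split.
- move=> v; rewrite in_itv /= => /andP[v0 v1].
  by apply: isd_continuous; apply: dw; rewrite v0 ltW.
(* At v = 0 the power is 0 and [phi] takes the value [beta]; the formula for the derivative stops
   there, so the one-sided limit is computed directly. *)
- have c0 := @powR_cvg0 R s5 (_ : 0 < s5).
  have c : v `^ s5 @[v --> 0^'+] --> (0 : R) by apply: c0; lra.
  rewrite {2}/phi /den /w_ subr0 subrr powR0; last by rewrite gt_eqF //; lra.
  rewrite /phi /den /w_.
  have -> : (fun v : R => beta + 2 * s5 * (1 - (1 - v)) `^ s5 / (7 + 3 * s5 - 2 * (1 - (1 -
    v)) `^ s5)) =
    (fun v => beta + 2 * s5 * (v `^ s5) / (7 + 3 * s5 - 2 * (v `^ s5))).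
    by apply/funext => v; rewrite subKr.
  apply: cvgD; first exact: cvg_cst.
  apply: cvgM; first by apply: cvgM => //; exact: cvg_cst.
  apply: cvgV; first by rewrite gt_eqF //; lra.
  by apply: cvgB; [exact: cvg_cst|apply: cvgM => //; exact: cvg_cst].
- have := isd_continuous (dw 1 _); rewrite ltr01 lexx => /(_ isT).
  by move=> h; apply: cvg_at_left_filter.
Qed.

Lemma C1_C : C1 R = C.
Proof.
(* The bounds on [E] hold only for v > 0; the value 0 at v = 0 is the limit given by [Hf_bound]. *)
pose F v := if v <= 0 then 0 else Hf (1 - v).
have dF v : 0 < v <= 1 -> isd (fun v => Hf (1 - v)) v (2 * phi (1 - v) ^+ 2 - 1).
  move=> /andP[v0 v1]; have x01 : 0 <= 1 - v < 1 by apply/andP; split; lra.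
  have h := @is_derive1_comp R Hf (fun y => 1 - y) v _ _ (isd_Hf x01) (isd_1B v).
  by apply: (isd_eq h); ring.
have dF' v : 0 < v <= 1 -> isd F v (2 * phi (1 - v) ^+ 2 - 1).
  move=> v01; apply: isd_near (dF v v01).
  near=> y; rewrite /F leNgt ifN // negbK; near: y; apply: lt_nbhsr.
  by case/andP: v01.
have -> : C1 R = \int[mu]_(v in `[0, 1]) (2 * phi (1 - v) ^+ 2 - 1).
  by apply: eq_Rintegral => v; rewrite inE /= in_itv /= => v01; rewrite g_phi.
rewrite (@Rintegral_FTC _ _ F); first 1 last.
- exact: ler01.
- move=> v; apply: cvgB; last exact: cvg_cst.
  apply: cvgM; first exact: cvg_cst.
  by apply: cvgM; exact: continuous_phi_1B.
- apply/(continuous_within_itvP _ (@ltr01 R)); split.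
  + move=> v; rewrite in_itv /= => /andP[v0 v1].
    by apply: isd_continuous; apply: dF'; rewrite v0 ltW.
  + rewrite {2}/F lexx; apply: norm_cvg0.
    apply: (squeeze_cvgr (f := fun=> 0) (h := fun v => A * v)); last 2 first.
    * exact: cvg_cst.
    * rewrite -[X in _ --> X](mulr0 A); apply: cvgM; first exact: cvg_cst.
      by apply: cvg_at_right_filter; exact: cvg_id.
    near=> v.
    have v0 : 0 < v by near: v; exact: nbhs_right_gt.
    have v1 : v < 1 by near: v; exact: nbhs_right_lt.
    rewrite normr_ge0 /= /F (leNgt v 0) v0 /=.
    have := @Hf_bound (1 - v); rewrite subKr; apply; apply/andP; split; lra.
  + have := isd_continuous (dF' 1 _); rewrite ltr01 lexx => /(_ isT).
    by move=> h; apply: cvg_at_left_filter.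
- by move=> v /andP[v0 v1]; apply: dF'; rewrite v0 ltW.
by rewrite /F lexx subrr Hf_0 leNgt ltr01 /= subr0.
Unshelve. all: by end_near. Qed.

(** [G] solves the equation of [E] with value 0 at 0 instead of [- C]; the difference is [C] times
    the homogeneous solution [(1 - x)^-2]. *)
Lemma G_E x : 0 <= x < 1 -> G x = E x + C / (1 - x) ^+ 2.
Proof.
move=> x01; have v0 := v_neq0 x01; have /andP[x0 x1] := x01.
have -> : G x = 1 / (1 - x) ^+ 2 * \int[mu]_(u in `[0, x]) (2 * phi u ^+ 2 - 1).
  congr (_ * _); apply: eq_Rintegral => u; rewrite inE /= in_itv /= => /andP[u0 ux].
  by rewrite g_phi ?subKr //; apply/andP; split; lra.
rewrite (@Rintegral_FTC_isd _ _ (fun u => 4 * phi u * ((1 - phi u - phi u ^+ 2) / (1 - u)))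
  (fun u => - Hf u)); first 1 last.
- exact: x0.
- move=> u /andP[u0 ux]; have u01 : 0 <= u < 1 by rewrite u0 (le_lt_trans ux).
  apply: isd_eq.
    by apply: isdB (isdC 1 u); apply: isdZ; apply: isd_sqr; exact: isd_phi u01.
  by ring.
- move=> u /andP[u0 ux]; have u01 : 0 <= u < 1 by rewrite u0 (le_lt_trans ux).
  by apply: isd_eq; [apply: isdN; exact: isd_Hf|ring].
by rewrite Hf_0 /Hf; field.
Qed.

(** The response of the equation for [Cf] to replacing [E] by [G]: the extra source is
    [2 C / (1 - x)^3], and [Xb 0 = 1] makes [Cf + C * Xb] vanish at 0, as [G_minus] does. *)
Definition Xb x := phi x / (1 - x) + x * (1 - phi x ^+ 2) / (1 - x) ^+ 2.

Lemma isd_Xb x : 0 <= x < 1 ->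
  isd Xb x (2 / (1 - x) ^+ 3 - 2 * (phi x / (1 - x)) * Xb x).
Proof.
move=> x01; have v0 := v_neq0 x01; have /andP[x0 x1] := x01.
have h1 := isd_phi_div x01.
have h2 := isdB (isdC 1 x) (isd_sqr (isd_phi x01)).
have h3 := isd_sqr (isd_inv1B x1).
have h4 := isdD h1 (isdM (isdM (isd_id x) h2) h3).
rewrite (_ : Xb = (fun y => phi y / (1 - y) + y * (1 - phi y ^+ 2) * (1 - y)^-1 ^+ 2));
  last first.
  by apply/funext => y; rewrite /Xb exprVn.
by apply: (isd_eq h4); rewrite /=; field.
Qed.

(* The integrating factor of the linear equation satisfied by [Cf]. *)
Definition kernel x := den x ^+ 2 * ((1 - x) / w_ x).

Lemma w_neq0 x : 0 <= x < 1 -> w_ x != 0.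
Proof. by move=> /andP[_ x1]; rewrite gt_eqF // w_gt0. Qed.

Lemma den_neq0 x : 0 <= x < 1 -> den x != 0.
Proof. by move=> /den_bounds /andP[h _]; rewrite gt_eqF //; lra. Qed.

Lemma isd_kernel x : 0 <= x < 1 -> isd kernel x (2 * (phi x / (1 - x)) * kernel x).
Proof.
move=> x01; have v0 := v_neq0 x01; have /andP[x0 x1] := x01.
have w0 := w_neq0 x01; have d0 := den_neq0 x01.
have h := isdM (isd_sqr (isd_den x1)) (isdM (isd_1B x) (isdV (isd_w x1) w0)).
by apply: (isd_eq h); rewrite /kernel /phi /=; field; rewrite v0 d0 w0.
Qed.

Lemma G_minus_E x : 0 <= x < 1 -> G_minus x = Cf x + C * Xb x.
Proof.
move=> x01; have v0 := v_neq0 x01; have /andP[x0 x1] := x01.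
have w0 := w_neq0 x01; have d0 := den_neq0 x01.
pose f u := kernel u * (2 * (E u + C / (1 - u) ^+ 2) / (1 - u) - (1 - phi u ^+ 2) / (1 - u)
  ^+ 2).
pose F u := kernel u * (Cf u + C * Xb u).
have sub u : 0 <= u <= x -> 0 <= u < 1 by move=> /andP[-> ux]; exact: le_lt_trans x1.
have pw u : u < 1 -> (1 - u) `^ (s5 - 1) = w_ u / (1 - u).
  move=> u1; have u0 : 0 < 1 - u by rewrite subr_gt0.
  by rewrite powRB ?(gt_eqF u0) ?implybT // powRr1 // ltW.
have -> : G_minus x = (1 - x) `^ (s5 - 1) / den x ^+ 2 * \int[mu]_(u in `[0, x]) f u.
  congr (_ * _); apply: eq_Rintegral => u; rewrite inE /= in_itv /= => ux.
  have u01 := sub u ux; have /andP[u0 u1] := u01.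
  by rewrite pw // G_E // F_minus_derive // /f /kernel -/(w_ u) -/(den u) invf_div; ring.
rewrite (@Rintegral_FTC _ f F 0 x x0); first 1 last.
- apply: isd_within_ex => u /sub u01; have /andP[u0 u1] := u01; eexists.
  have hv := isd_inv1B u1.
  apply: isdM; first exact: isd_kernel.
  apply: isdB.
    apply: (isdM _ hv); apply: isdZ; apply: isdD; first exact: dE.
    apply: isdZ; rewrite (_ : (fun y => _) = (fun y => ((1 - y)^-1) ^+ 2)); last first.
      by apply/funext => y; rewrite exprVn.
    by apply: isd_sqr; exact: hv.
  rewrite (_ : (fun y => _) = (fun y => (1 - phi y ^+ 2) * ((1 - y)^-1) ^+ 2)); last first.
    by apply/funext => y; rewrite exprVn.
  apply: isdM; last by apply: isd_sqr; exact: hv.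
  by apply: isdB; [exact: isdC|apply: isd_sqr; exact: isd_phi].
- apply: isd_within_ex => u /sub u01; eexists.
  by apply: isdM; [exact: isd_kernel|apply: isdD; [exact: dCf|apply: isdZ; exact: isd_Xb]].
- move=> u /andP[u0 ux]; have u01 : 0 <= u < 1 by rewrite ltW //= (lt_trans ux).
  have h := isdM (isd_kernel u01) (isdD (dCf u01) (isdZ C (isd_Xb u01))).
  have u0' := v_neq0 u01.
  by apply: (isd_eq h); rewrite /f B_phi //; field.
have -> : F 0 = 0.
  by rewrite /F /Xb Cf0 phi_0 mul0r mul0r addr0 subr0 divr1 mulr1 addNr mulr0.
rewrite /F subr0 pw // /kernel; field.
by rewrite v0 d0 w0.
Qed.

(* [Jf] is the primitive of the integrand of [C2], rewritten as [If]. *)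
Definition Lf x := 2 * ((1 - x) ^+ 2 * E x + x * (2 * ((1 - x) * E x) + 2 * phi x ^+ 2 - 1)).
Definition Jf x := (1 - x) ^+ 2 * M x + C * Lf x.
Definition If x := 1 - 4 * (1 - x) * (E x + C / (1 - x) ^+ 2)
  + 2 * (1 - x) ^+ 2 * (E x + C / (1 - x) ^+ 2) ^+ 2
  + 8 * (1 - x) ^+ 2 * (phi x / (1 - x)) * (Cf x + C * Xb x) - 2 * C ^+ 2 / (1 - x) ^+ 2.

Lemma isd_Jf x : 0 <= x < 1 -> isd Jf x (If x).
Proof.
move=> x01; have v0 := v_neq0 x01; have /andP[x0 x1] := x01.
have h1 := isd_v2 (dM x01); have h2 := isd_v2 (dE x01).
have h3 := isdZ 2 (isdM (isd_1B x) (dE x01)).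
have h4 := isdZ 2 (isd_sqr (isd_phi x01)).
have h := isdD h1 (isdZ C (isdZ 2 (isdD h2 (isdM (isd_id x) (isdB (isdD h3 h4) (isdC 1 x)))))).
by apply: (isd_eq h); rewrite /If /Xb /= !B_phi //; field.
Qed.

Lemma isd_If x : 0 <= x < 1 -> exists l, isd If x l.
Proof.
move=> x01; have /andP[x0 x1] := x01; eexists.
have hv := isd_1B x; have hi := isd_inv1B x1.
have hi2 : isd (fun y => ((1 - y) ^+ 2)^-1) x (2 * (1 - x)^-1 * (1 - x) ^- 2).
  rewrite (_ : (fun y => _) = (fun y => ((1 - y)^-1) ^+ 2)); last first.
    by apply/funext => y; rewrite exprVn.
  exact: isd_sqr hi.
have hG := isdD (dE x01) (isdZ C hi2).
have hv2 := @isd_sqr _ (fun y => 1 - y) _ _ hv.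
exact: (isdB (isdD (isdD (isdB (isdC 1 x) (isdM (isdZ 4 hv) hG))
   (isdM (isdZ 2 hv2) (isd_sqr hG)))
   (isdM (isdM (isdZ 8 hv2) (isd_phi_div x01)) (isdD (dCf x01) (isdZ C (isd_Xb x01)))))
   (isdZ (2 * C ^+ 2) hi2)).
Qed.

Lemma A_ge0 : 0 <= A.
Proof. by have := le_trans (normr_ge0 _) (Ebd (x := 0) _); rewrite subr0 divr1 lexx ltr01;
  apply. Qed.

Definition hf x := Hf x / (1 - x).

Lemma hf_bound x : 0 <= x < 1 -> `|hf x| <= A.
Proof.
move=> x01; have := Hf_bound x01; have /andP[_ x1] := x01.
have v0 : 0 < 1 - x by rewrite subr_gt0.
by move=> hb; rewrite /hf (normrM (Hf x)) normfV (gtr0_norm v0) ler_pdivrMr.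
Qed.

Lemma hf_slope x : 0 <= x < 1 -> `|hf x - (2 - s5)| <= 2 * (1 - x).
Proof.
move=> x01; have := Hf_slope x01; have /andP[_ x1] := x01;
  have v0 : 0 < 1 - x by rewrite subr_gt0.
have -> : hf x - (2 - s5) = (Hf x - (2 - s5) * (1 - x)) / (1 - x) by rewrite /hf; field;
  rewrite gt_eqF.
by move=> hb; rewrite normrM normfV (gtr0_norm v0) ler_pdivrMr // -mulrA -expr2.
Qed.

Lemma psi_bound x : 0 <= x < 1 -> `|(1 - x) * Cf x| <= A.
Proof.
move=> x01; have := Cbd x01; have /andP[_ x1] := x01; have v0 : 0 < 1 - x by rewrite subr_gt0.
by move=> hb; rewrite normrM (gtr0_norm v0) mulrC -ler_pdivlMr.
Qed.

Lemma phi_le1 x : 0 <= x < 1 -> phi x <= 2.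
Proof.
move=> x01; have /andP[_] := phi_bounds x01; have /andP[x0 x1] := x01.
by have /andP[s1 s2] := sqrt5_bounds R; lra.
Qed.

Lemma E_hf x : 0 <= x < 1 -> E x = - hf x / (1 - x).
Proof. by move=> x01; have v0 := v_neq0 x01; rewrite /hf /Hf; field. Qed.

Lemma If_bound x : 0 <= x < 1 ->
  `|If x| <= 1 + 4 * A + 2 * A ^+ 2 + 16 * A + `|C| * (24 + 32 + 48).
Proof.
move=> x01; have v0 := v_neq0 x01; have /andP[x0 x1] := x01.
have v1 : 0 < 1 - x by rewrite subr_gt0.
have /andP[s1 s2] := sqrt5_bounds R.
pose psi := (1 - x) * Cf x; pose p := phi x; pose h := hf x.
pose kap := - 4 * (1 + h) + 8 * p * (1 - p ^+ 2).
(* The terms in [C^2] cancel, and what is singular at 1 is collected in [kap / (1 - x)]. *)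
have -> : If x = (1 + 4 * h + 2 * h ^+ 2 + 8 * p * psi) +
   C * (kap / (1 - x) + 8 * p ^+ 2 - 8 * p * (1 - p ^+ 2)).
  by rewrite /kap /psi /If /Xb E_hf // -/h -/p; field.
have vle : 1 - x <= 1 by rewrite lerBlDr lerDl.
have kb : `|kap / (1 - x)| <= 24.
  rewrite normrM normfV (gtr0_norm v1) ler_pdivrMr //.
  exact: kappa_bound s1 s2 (sqrt5_sqr R) (ltW v1) vle (phi_bounds x01) (hf_slope x01).
have hb := hf_bound x01; have pb := psi_bound x01.
have p0 := phi_ge0 x01; have p2 := phi_le1 x01.
rewrite -/h in hb; rewrite -/psi in pb; rewrite -/p in p0 p2.
exact: integrand_bound.
Qed.

Lemma Jf_limit x : 0 <= x < 1 ->
  `|Jf x - (K + C * (2 * (s5 - 2)))| <= (A + `|C| * (2 * (A + 10))) * (1 - x).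
Proof.
move=> x01; have v0 := v_neq0 x01; have /andP[x0 x1] := x01.
have v1 : 0 < 1 - x by rewrite subr_gt0.
have /andP[s1 s2] := sqrt5_bounds R.
have -> : Jf x - (K + C * (2 * (s5 - 2))) = (1 - x) ^+ 2 * (M x - K / (1 - x) ^+ 2) + C * (Lf
  x - 2 * (s5 - 2)).
  by rewrite /Jf; field.
rewrite [X in _ <= X]mulrDl; apply: le_trans (ler_normD _ _) _; apply: lerD.
  rewrite normrM (ger0_norm (sqr_ge0 _)).
  apply: le_trans (ler_wpM2l (sqr_ge0 _) (Mbd x01)) _.
  by rewrite le_eqVlt; apply/orP; left; apply/eqP; field.
rewrite normrM -mulrA; apply: ler_wpM2l => //.
have -> : Lf x - 2 * (s5 - 2) = 2 * (- Hf x + x * (- 2 * hf x + 2 * phi x ^+ 2 - 1) - (s5 - 2)).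
  by rewrite /Lf E_hf // /hf; field.
have hb := Hf_bound x01.
have vle : 1 - x <= 1 by rewrite lerBlDr lerDl.
exact: (Lf_limit_aux s1 s2 (sqrt5_sqr R) (ltW v1) vle (phi_bounds x01) (hf_slope x01) hb A_ge0).
Qed.

Lemma Jf_0 : Jf 0 = - C ^+ 2.
Proof. by rewrite /Jf /Lf M0 E0 subr0 mul0r expr1n; ring. Qed.

(** The integral is the limit of [Jf] at 1 minus [Jf 0]. These boundary values account for the terms
    [4 C1 - 2 sqrt 5 C1 - C1^2] of [K2]. *)
Lemma C2_K : C2 R = K + C * (2 * (s5 - 2)) + C ^+ 2.
Proof.
have -> : C2 R = \int[mu]_(x in `[0, 1[) If x.
  apply: eq_Rintegral => x; rewrite inE /= in_itv /= => x01; have /andP[x0 x1] := x01.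
  by rewrite C1_C G_minus_E // G_E // F_minus_phi // /If [1 + (_ - 1)]addrC subrK.
rewrite (Rintegral_improper isd_Jf isd_If If_bound Jf_limit) Jf_0.
by rewrite opprK.
Qed.

Lemma K2_K : K2 R = K.
Proof. by rewrite /K2 C2_K C1_C; ring. Qed.

(** * Numerical value of K *)

Lemma w01 x : 0 <= x < 1 -> 0 <= w_ x <= 1.
Proof.
move=> x01; have := w_le x01; have /andP[x0 x1] := x01; have := w_gt0 x1.
by move=> ? ?; apply/andP; split; lra.
Qed.

Lemma den_phi x : 0 <= x < 1 -> den x * phi x = 4 + 2 * s5 + (1 + s5) * w_ x.
Proof.
move=> x01; have d0 := den_neq0 x01; have s2 := sqrt5_sqr R.
by move: d0; rewrite /phi /den => d0; field: s2.
Qed.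

Definition eps : R := 10 ^- 9.

(** [Hf] and [(1 - x) hh(w)] both vanish at 1, and their derivatives differ by the residual
    [res1 / (10^13 den^2)]; integrating back from 1 and dividing by [1 - x] keeps the bound. *)
Lemma hf_hh x : 0 <= x < 1 -> `|hf x - hh (w_ x)| <= eps.
Proof.
move=> x01; have /andP[x0 x1] := x01; have v0 := v_neq0 x01.
have v1 : 0 < 1 - x by rewrite subr_gt0.
pose F y := Hf y - (1 - y) * hh (w_ y).
have dF y : 0 <= y < 1 -> isd F y (1 - 2 * phi y ^+ 2 + hh (w_ y) + s5 * w_ y * hh' (w_ y)).
  move=> y01; have /andP[_ y1] := y01; have y0 := v_neq0 y01.
  have h := isdB (isd_Hf y01) (isdM (isd_1B y) (isdM (isd_peval hpoly (isd_w y1)) (isdC (10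
    ^+ 13)^-1 y))).
  by apply: (isd_eq h); rewrite /hh /hh' /=; field; rewrite ?y0 ?expf_neq0.
have Eres y : 0 <= y < 1 -> 1 - 2 * phi y ^+ 2 + hh (w_ y) + s5 * w_ y * hh' (w_ y) =
    peval res1 (w_ y) / (10 ^+ 13 * den y ^+ 2).
  move=> y01; have d0 := den_neq0 y01; have S0 := lt0r_neq0 (scale_gt0 R).
  rewrite res1E -(den_phi y01) -/(den y); move: (10 ^+ 13) S0 (den y) d0 => S S0 d d0.
  by field; rewrite S0 d0.
have b y : 0 <= y < 1 -> `|1 - 2 * phi y ^+ 2 + hh (w_ y) + s5 * w_ y * hh' (w_ y)| <= eps.
  move=> y01; rewrite (Eres y y01); have [r1 _ _] := res_bounds (w01 y01).
  have /andP[d1 _] := den_bounds y01; have S0 := scale_gt0 R.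
  have d2 : 100 <= den y ^+ 2 by rewrite expr2; nra.
  have P0 : 0 < 10 ^+ 13 * den y ^+ 2 by rewrite mulr_gt0 // (lt_le_trans _ d2).
  rewrite normrM normfV (gtr0_norm P0) ler_pdivrMr //; apply: le_trans r1 _.
  rewrite /eps mulrA -[13%N]/(9 + 4)%N exprD mulKf ?expf_neq0 //.
  by apply: le_trans (_ : 10 ^+ 4 * 100 <= _); [lra|apply: ler_wpM2l => //; rewrite exprn_ge0].
have lim y : 0 <= y < 1 -> `|F y - 0| <= (A + 1) * (1 - y).
  move=> y01; rewrite subr0 /F; apply: le_trans (ler_normB _ _) _; rewrite [X in _ <= X]mulrDl.
  have /andP[_ y1] := y01; have y0 : 0 < 1 - y by rewrite subr_gt0.
  apply: lerD; first exact: Hf_bound.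
  have [h1 _ _] := poly_bounds (w01 y01).
  by rewrite normrM (gtr0_norm y0) mulrC; apply: ler_wpM2r => //; exact: ltW.
have ext (P : R -> Prop) : (forall y, 0 <= y < 1 -> P y) -> forall y, x <= y < 1 -> P y.
  by move=> H y xy; apply: H; exact: sub01 x0 xy.
have := isd_dist_limit x1 (ext _ dF) (ext _ b) (ext _ lim).
rewrite subr0 => FB.
have -> : hf x - hh (w_ x) = F x / (1 - x) by rewrite /F /hf; field.
by rewrite normrM normfV (gtr0_norm v1) ler_pdivrMr.
Qed.

Lemma eps_pow : eps * 10 ^+ 9 = 1.
Proof. by rewrite /eps mulVf // expf_neq0. Qed.

Lemma eps_bounds : 0 < eps <= 1 / 1000.
Proof.
have e := eps_pow.
by apply/andP; split; lra.
Qed.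

Lemma hf_le2 x : 0 <= x < 1 -> `|hf x| <= 2.
Proof.
move=> x01; have := hf_hh x01; have [h1 _ _] := poly_bounds (w01 x01).
have /andP[e0 e1] := eps_bounds.
by move: h1; rewrite !ler_norml => /andP[? ?] /andP[? ?]; apply/andP; split; lra.
Qed.

Lemma hf_0 : hf 0 = C.
Proof. by rewrite /hf Hf_0 subr0 divr1. Qed.

Definition Qf x := kernel x * Cf x.

Lemma isd_Qf x : 0 <= x < 1 ->
  isd Qf x (den x ^+ 2 * (phi x ^+ 2 - 1 - 2 * hf x) / (w_ x * (1 - x))).
Proof.
move=> x01; have v0 := v_neq0 x01; have w0 := w_neq0 x01.
apply: (isd_eq (isdM (isd_kernel x01) (dCf x01))).
by rewrite E_hf // B_phi // /kernel; field; rewrite v0 w0.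
Qed.

Lemma den_0 : den 0 = 5 + 3 * s5.
Proof. by rewrite /den w_0; ring. Qed.

Lemma Qf_0 : Qf 0 = - (70 + 30 * s5) * C.
Proof.
have s2 := sqrt5_sqr R.
by rewrite /Qf /kernel den_0 w_0 Cf0 subr0 divr1; ring: s2.
Qed.

(** [Qf] is compared with [440 / w], whose derivative [440 sqrt 5 / (w (1 - x))] dominates that of
    [Qf]: the numerator there is at most [196 * 5 = 980], and [440 sqrt 5 > 983]. *)
Lemma wQ_bound x : 0 <= x < 1 -> `|w_ x * Qf x| <= 440.
Proof.
move=> x01; have /andP[x0 x1] := x01; have /andP[s1 s2] := sqrt5_bounds R.
have q_bound y : 0 <= y < 1 -> `|den y ^+ 2 * (phi y ^+ 2 - 1 - 2 * hf y)| <= 440 * s5.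
  move=> y01; have /andP[d1 d2] := den_bounds y01; have /andP[y0 y1] := y01.
  rewrite normrM (ger0_norm (sqr_ge0 _)).
  have dd : den y ^+ 2 <= 196 by rewrite expr2; nra.
  have /andP[p1 p2] := phi_bounds y01.
  have pp : 0 <= phi y ^+ 2 <= 2 by rewrite sqr_ge0 /= expr2; nra.
  have hb := hf_le2 y01.
  have qq : `|phi y ^+ 2 - 1 - 2 * hf y| <= 5.
    move: hb pp; rewrite !ler_norml => /andP[? ?] /andP[? ?]; apply/andP; split; lra.
  by apply: le_trans (ler_pM _ _ dd qq) _ => //; [exact: sqr_ge0|lra].
have Cb : `|C| <= 2 by rewrite -hf_0; apply: hf_le2; rewrite lexx ltr01.
have Q0 : `|Qf 0| <= 440.
  rewrite Qf_0 normrM normrN (ger0_norm (x := 70 + 30 * s5)); last by lra.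
  by apply: le_trans (ler_wpM2l _ Cb) _; lra.
have sub y : 0 <= y <= x -> 0 <= y < 1 by move=> /andP[-> yx]; exact: le_lt_trans x1.
have dw y : 0 <= y < 1 -> isd (fun z => 440 / w_ z) y (440 * s5 / (w_ y * (1 - y))).
  move=> y01; have /andP[_ y1] := y01; have v0 := v_neq0 y01; have w0 := w_neq0 y01.
  apply: (isd_eq (isdZ 440 (isdV (isd_w y1) w0))).
  by field; rewrite v0 w0.
have wv y : 0 <= y < 1 -> 0 <= (w_ y * (1 - y))^-1.
  by move=> /andP[y0 y1]; rewrite invr_ge0 mulr_ge0 // ?(ltW (w_gt0 y1)) // subr_ge0 ltW.
have up := isd_ge x0 (fun y yx => isdD (isd_Qf (sub y yx)) (dw y (sub y yx))) (eps := 0).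
have lo := isd_le x0 (fun y yx => isdB (isd_Qf (sub y yx)) (dw y (sub y yx))) (eps := 0).
have {up}up : 0 <= Qf x + 440 / w_ x.
  have -> : Qf x + 440 / w_ x = (Qf x + 440 / w_ x - (Qf 0 + 440 / w_ 0)) + (Qf 0 + 440 / w_
    0) by rewrite subrK.
  apply: addr_ge0.
    have := up _; rewrite mul0r; apply => y /sub y01; rewrite -mulrDl.
    apply: mulr_ge0; last exact: wv.
    by have := q_bound y y01; rewrite ler_norml => /andP[? ?]; lra.
  by rewrite w_0 divr1; move: Q0; rewrite ler_norml => /andP[? ?]; lra.
have {lo}lo : Qf x - 440 / w_ x <= 0.
  have -> : Qf x - 440 / w_ x = (Qf x - 440 / w_ x - (Qf 0 - 440 / w_ 0)) + (Qf 0 - 440 / w_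
    0) by rewrite subrK.
  rewrite -[X in _ <= X]addr0; apply: lerD.
    have := lo _; rewrite mul0r; apply => y /sub y01; rewrite -mulrBl.
    apply: mulr_le0_ge0; last exact: wv.
    by have := q_bound y y01; rewrite ler_norml => /andP[? ?]; lra.
  by rewrite w_0 divr1; move: Q0; rewrite ler_norml => /andP[? ?]; lra.
have w0 := w_gt0 x1.
have l1 : 0 <= w_ x * (Qf x + 440 / w_ x) by rewrite mulr_ge0 // ltW.
have l2 : w_ x * (Qf x - 440 / w_ x) <= 0 by rewrite mulr_ge0_le0 // ltW.
have e1 : w_ x * (440 / w_ x) = 440 by field; rewrite gt_eqF.
by rewrite ler_norml; apply/andP; split; move: l1 l2; rewrite mulrDr mulrBr e1; lra.
Qed.

(* [M'] involves [Cf], which solves a linear equation. The middle term is chosen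
   so that [Cf] cancels in the derivative, up to the truncation errors of the
   Taylor polynomials. *)
Definition ff x := (1 - x) ^+ 2 * M x + (1 - x) * (w_ x * xx (w_ x)) * Qf x + (1 - x) * oo
  (w_ x).

Definition ff' x := 1 + 4 * hf x + 2 * hf x ^+ 2 + xx (w_ x) * (den x ^+ 2 * (phi x ^+ 2 - 1
  - 2 * hf x))
  + (w_ x * Qf x) * (8 * phi x / den x ^+ 2 - ((1 + s5) * xx (w_ x) + s5 * w_ x * xx' (w_ x)))
  - (oo (w_ x) + s5 * w_ x * oo' (w_ x)).

Lemma isd_ff x : 0 <= x < 1 -> isd ff x (ff' x).
Proof.
move=> x01; have v0 := v_neq0 x01; have w0 := w_neq0 x01; have d0 := den_neq0 x01.
have /andP[x0 x1] := x01.
have hx := isdM (isd_peval xpoly (isd_w x1)) (isdC (10 ^+ 13)^-1 x).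
have ho := isdM (isd_peval opoly (isd_w x1)) (isdC (10 ^+ 13)^-1 x).
have h := isdD (isdD (isd_v2 (dM x01)) (isdM (isdM (isd_1B x) (isdM (isd_w x1) hx)) (isd_Qf
  x01)))
  (isdM (isd_1B x) ho).
apply: (isd_eq h); rewrite /ff' /xx' /oo' /xx /oo /= B_phi // E_hf // /Qf /kernel.
move: (10 ^+ 13) (lt0r_neq0 (scale_gt0 R)) => S S0.
by field; rewrite v0 w0 d0 S0.
Qed.

(** Each term is one source of error: the residual for [Om], the replacement of [hf] by its Taylor
    polynomial, and the residual for [Xi] multiplied by the bounded [w * Qf]. *)
Lemma ff'E x : 0 <= x < 1 -> ff' x = peval res3 (w_ x) / 10 ^+ 26
  + (hf x - hh (w_ x)) * (4 + 4 * hh (w_ x) + 2 * (hf x - hh (w_ x)) - 2 * xx (w_ x) * den x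
    ^+ 2)
  + (w_ x * Qf x) * (peval res2 (w_ x) / (10 ^+ 13 * den x ^+ 3)).
Proof.
move=> x01; have d0 := den_neq0 x01.
rewrite res3E res2E -(den_phi x01) -/(den x) /ff' -[26%N]/(13 * 2)%N exprM.
move: (10 ^+ 13) (lt0r_neq0 (scale_gt0 R)) (den x) d0 (w_ x * Qf x) => S S0 d d0 q.
by field; rewrite S0 d0.
Qed.

Lemma ff'_bound x : 0 <= x < 1 -> `|ff' x| <= 150 * eps.
Proof.
move=> x01; have w01' := w01 x01; have /andP[d1 d2] := den_bounds x01.
have [_ r2 r3] := res_bounds w01'; have [hb xb _] := poly_bounds w01'.
have /andP[e0 e1] := eps_bounds; have hd := hf_hh x01; have qb := wQ_bound x01.
have S0 := scale_gt0 R.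
have t3 : `|peval res3 (w_ x) / 10 ^+ 26| <= eps.
  have P0 : 0 < (10 : R) ^+ 26 by rewrite exprn_gt0.
  rewrite normrM normfV (gtr0_norm P0) ler_pdivrMr // /eps -[26%N]/(9 + 17)%N exprD mulKf
    ?expf_neq0 //.
have t2 : `|peval res2 (w_ x) / (10 ^+ 13 * den x ^+ 3)| <= eps / 10.
  have d3 : 1000 <= den x ^+ 3 by rewrite exprSr expr2; nra.
  have d30 : 0 < den x ^+ 3 by rewrite exprn_gt0 //; lra.
  have P0 := mulr_gt0 S0 d30.
  rewrite normrM normfV (gtr0_norm P0) ler_pdivrMr //; apply: le_trans r2 _.
  have -> : eps / 10 * (10 ^+ 13 * den x ^+ 3) = 1000 * den x ^+ 3.
    rewrite -[13%N]/(9 + 4)%N exprD; move: (den x ^+ 3) => y.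
    have -> : eps / 10 * (10 ^+ 9 * 10 ^+ 4 * y) = eps * 10 ^+ 9 * (1000 * y) by field.
    by rewrite eps_pow mul1r.
  by move: (den x ^+ 3) d3 => y d3; lra.
have dd : 0 <= den x ^+ 2 <= 196 by rewrite sqr_ge0 expr2; nra.
have t1 : `|4 + 4 * hh (w_ x) + 2 * (hf x - hh (w_ x)) - 2 * xx (w_ x) * den x ^+ 2| <= 60.
  have xd : `|xx (w_ x) * den x ^+ 2| <= 1 / 10 * 196.
    rewrite normrM (ger0_norm (sqr_ge0 _)); apply: ler_pM => //; first exact: sqr_ge0.
    by case/andP: dd.
  rewrite -(mulrA 2); move: hb hd xd; move: (xx (w_ x) * den x ^+ 2) => z.
  by rewrite !ler_norml => /andP[? ?] /andP[? ?] /andP[? ?]; apply/andP; split; lra.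
rewrite ff'E //; apply: le_trans (ler_normD _ _) _; apply: le_trans (lerD (ler_normD _ _)
  (lexx _)) _.
rewrite (normrM (hf x - _)) (normrM (w_ x * Qf x)).
(* In units of [eps], the three terms contribute at most 1, 60 and [440 / 10]. *)
have m1 := ler_pM (normr_ge0 _) (normr_ge0 _) hd t1.
have m2 := ler_pM (normr_ge0 _) (normr_ge0 _) qb t2.
apply: le_trans (lerD (lerD t3 m1) m2) _; lra.
Qed.

Lemma ff_limit x : 0 <= x < 1 -> `|ff x - K| <= (A + 44 + 10) * (1 - x).
Proof.
move=> x01; have v0 := v_neq0 x01; have /andP[_ x1] := x01;
  have v1 : 0 < 1 - x by rewrite subr_gt0.
have [_ xb ob] := poly_bounds (w01 x01); have qb := wQ_bound x01.
have -> : ff x - K = (1 - x) ^+ 2 * (M x - K / (1 - x) ^+ 2)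
    + (1 - x) * (xx (w_ x) * (w_ x * Qf x)) + (1 - x) * oo (w_ x).
  by rewrite /ff; field.
have m := ler_pM (normr_ge0 _) (normr_ge0 _) xb qb.
apply: le_trans (ler_normD _ _) _; apply: le_trans (lerD (ler_normD _ _) (lexx _)) _.
rewrite [X in _ <= X]mulrDl [(A + 44) * _]mulrDl; apply: lerD; first apply: lerD.
- rewrite normrM (ger0_norm (sqr_ge0 _)).
  apply: le_trans (ler_wpM2l (sqr_ge0 _) (Mbd x01)) _.
  by rewrite le_eqVlt; apply/orP; left; apply/eqP; field.
- rewrite normrM (gtr0_norm v1) mulrC; apply: ler_wpM2r; first exact: ltW.
  by rewrite normrM; apply: le_trans m _; lra.
- by rewrite normrM (gtr0_norm v1) mulrC; apply: ler_wpM2r; first exact: ltW.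
Qed.

(** Error budget in units of 10^-9: 150 from [ff'], 18 from replacing [C] by [hh 1] in [ff 0], 1
    from [final_value], and 285 for the digits dropped after 0.057162, in total 454 < 500. *)
Lemma K_value : `|K - (57 / 10 ^+ 3 + 162 / 10 ^+ 6)| < 5 / 10 ^+ 7.
Proof.
have /andP[s1 s2] := sqrt5_bounds R.
have z01 : 0 <= (0 : R) < 1 by rewrite lexx ltr01.
have ext (P : R -> Prop) : (forall y, 0 <= y < 1 -> P y) -> forall y, 0 <= y < 1 -> P y by [].
have := isd_dist_limit ltr01 (ext _ isd_ff) (ext _ ff'_bound) (ext _ ff_limit).
rewrite subr0 mulr1 => fK.
have := hf_hh z01; rewrite hf_0 w_0 => Ch.
have w11 : 0 <= (1 : R) <= 1 by rewrite ler01 lexx.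
have [hb xb _] := poly_bounds w11.
have f0 : ff 0 = C ^+ 2 - (70 + 30 * s5) * xx 1 * C + oo 1.
  by rewrite /ff w_0 M0 Qf_0 subr0; ring.
have := final_value R => V.
have Cdiff : `|ff 0 - (hh 1 ^+ 2 - (70 + 30 * s5) * xx 1 * hh 1 + oo 1)| <= eps * 18.
  have -> : ff 0 - (hh 1 ^+ 2 - (70 + 30 * s5) * xx 1 * hh 1 + oo 1) =
     (C - hh 1) * (2 * hh 1 + (C - hh 1) - (70 + 30 * s5) * xx 1) by rewrite f0; ring.
  rewrite normrM; apply: ler_pM => //.
  have xs : `|(70 + 30 * s5) * xx 1| <= 138 * (1 / 10).
    rewrite normrM; apply: ler_pM => //; rewrite ger0_norm; lra.
  have /andP[e0 e1] := eps_bounds.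
  move: hb Ch xs; move: (_ * xx 1) => z.
  by rewrite !ler_norml => /andP[? ?] /andP[? ?] /andP[? ?]; apply/andP; split; lra.
move: fK Cdiff V; rewrite /eps; move: (ff 0) (hh 1 ^+ 2 - _ + _) => f v.
by rewrite !ler_norml ltr_norml => /andP[? ?] /andP[? ?] /andP[? ?]; apply/andP; split; lra.
Qed.

End Identification.

(* K2 is approximately 0.057162, an approximation to six decimals being an
   equality up to half a unit of the sixth decimal. *)
Theorem proposition4p6 (R : realType) :
  ((fun n : nat =>
      tree_variance n (fun T => (N0 R T)%:R : R) - K2 R * n%:R)
     =O_\oo (fun=> 1 : R))
  /\ `|K2 R - (57 / 10 ^+ 3 + 162 / 10 ^+ 6)| < 5 / 10 ^+ 7.
Proof.
have [lam [K [A [dA cA mA]]]] := moments_asymptotics R.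
have x1 x : 0 <= x < 1 -> `|x| < 1 :> R by move=> /andP[x0 x1]; rewrite ger0_norm.
pose B := psum (@b_ R); pose E := psum (d_ lam); pose Cf := psum (c_ lam);
  pose M := psum (m_ lam).
have dB x : 0 <= x < 1 -> isd B x ((1 - x) ^- 2 - B x ^+ 2).
  by move=> /x1 /is_derive_B.
have dE x : 0 <= x < 1 -> isd E x (2 * E x / (1 - x) + 2 * B x ^+ 2 - (1 - x) ^- 2).
  by move=> /x1; exact: is_derive_E dA x.
have dCf x : 0 <= x < 1 -> isd Cf x
    (2 * E x / (1 - x) + B x ^+ 2 - (1 - x) ^- 2 - 2 * B x * Cf x).
  by move=> /x1; exact: is_derive_C dA cA x.
have dM x : 0 <= x < 1 -> isd M x
    (2 * M x / (1 - x) + 2 * E x ^+ 2 + 8 * Cf x * B x - 4 * E x / (1 - x) + (1 - x) ^- 2).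
  by move=> /x1; exact: is_derive_M dA cA mA x.
have B0 : B 0 = 1 by exact: B_0.
have E0 : E 0 = - lam by exact: E_0.
have C0 : Cf 0 = - lam by exact: C_0.
have M0 : M 0 = lam ^+ 2 by exact: M_0.
have Bge0 x : 0 <= x < 1 -> 0 <= B x by exact: B_ge0.
have Ebd x : 0 <= x < 1 -> `|E x| <= A / (1 - x) by exact: E_bound.
have Cbd x : 0 <= x < 1 -> `|Cf x| <= A / (1 - x) by exact: C_bound.
have Mbd x : 0 <= x < 1 -> `|M x - K / (1 - x) ^+ 2| <= A / (1 - x) by exact: M_bound mA x.
have K2K := K2_K dB dE dCf dM B0 E0 C0 M0 Bge0 Ebd Cbd Mbd.
split; last first.
  by rewrite K2K; exact: (K_value dB dE dCf dM B0 E0 C0 M0 Bge0 Ebd Mbd).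
have A0 : 0 <= A by apply: le_trans (dA 0%N).
apply/eqOP; exists (A + `|K| + A ^+ 2); split; first exact: num_real.
move=> k Bk; apply: filterE => n; rewrite normr1 mulr1; apply: le_trans (ltW Bk).
rewrite (variance_cnul lam) K2K.
(* The second moment is asymptotic to [K (n + 1)]; the surplus [K] joins the bounded error, as does
   the squared mean. *)
have -> : m_ lam n - d_ lam n ^+ 2 - K * n%:R = (m_ lam n - K * n.+1%:R) + K - d_ lam n ^+ 2.
  by rewrite -natr1; ring.
apply: le_trans (ler_normB _ _) _; apply: lerD.
  by apply: le_trans (ler_normD _ _) _; rewrite lerD2r.
by rewrite normrX; apply: lerXn2r; rewrite ?nnegrE.
Qed.
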